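(* Let $N$ be the marked Hawkes process described in the context, and assume $\|F\|_{L^1}<1$ and $\int_0^\infty tF(t)\,dt<\infty$. Let $A\in\boldsymbol{\mathcal X}$, and let $Z^A_n$, $n=1,2,\ldots$, be an i.i.d. sequence of real-valued random variables with finite first moment, independent of $N$. Define $$C^A_t=\sum_{n=1}^{N(t,A)}Z^A_n,\qquad t\ge0,$$ and $\upsilon(v)=v\,m\,\mathbb Q(A)\,(\|R\|_{L^1}+1)\,\mathbb E(Z^A_1)$ for $v\ge0$. Then the family of processes $\{(T^{-1}C^A_{Tv})_{T\ge0},\ v\ge0\}$ converges to $\upsilon$ point-wise in probability as $T\to\infty$; that is, for each $v\ge0$, $$\frac{C^A_{Tv}}{T}\longrightarrow\upsilon(v)\quad\text{in probability as }T\to\infty .$$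
   Context: Setting. $(\Omega,\mathcal F,\mathbb P)$ is a probability space and $(\mathcal X,\boldsymbol{\mathcal X})$ is a Borel space; $\partial$ is a point external to $\mathcal X$. A marked point process with mark space $\mathcal X$ is a sequence $N=((T_n,X_n))_{n\ge1}$ of random elements, where $T_n$ takes values in $(0,\infty]$, $X_n$ takes values in $\mathcal X\cup\{\partial\}$, $T_n\le T_{n+1}$, with $T_n<T_{n+1}$ if $T_n<\infty$, and $X_n=\partial$ iff $T_n=\infty$. It is identified with the integer-valued random measure $N(dt,dx)=\sum_{n\ge1}\delta_{(T_n,X_n)}(dt,dx)\mathbf 1_{\{T_n<\infty\}}$ on $\mathbb R_+\times\mathcal X$. $N$ is a marked Hawkes process: with respect to the natural filtration of $N$, the compensator of the random measure $N$ is $\kappa(t,dx)\,dt$, where $$\kappa(t,A)=\Big(m+\int_{(0,t)\times\mathcal X}f(t-s,x)\,N(ds,dx)\Big)\mathbb Q(A),\qquad t\ge0,\ A\in\boldsymbol{\mathcal X}.$$ Here $\mathbb Q$ is a probability measure on $(\mathcal X,\boldsymbol{\mathcal X})$, $m\ge0$ is a constant, and $f:\mathbb R_+\times\mathcal X\to\mathbb R_+$ is non-negative, bounded and measurable with $\int_{\mathcal X}\|f(\cdot,x)\|_{L^1}^2\,\mathbb Q(dx)<\infty$, where $L^1=L^1(\mathbb R_+)$. Notation. $N(t,A)=N((0,t],A)=\sum_{n\ge1}\mathbf 1_{\{T_n\le t\}}\mathbf 1_{\{X_n\in A\}}$. $F(t)=\int_{\mathcal X}f(t,x)\,\mathbb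 Q(dx)$ for $t\ge0$. Convolution is $g\ast h(t)=\int_0^t g(t-s)h(s)\,ds$. $R=-r$, where $r$ is the unique solution (resolvent of $-F$) of $r(t)=F\ast r(t)-F(t)$, $t\ge0$; equivalently $R=F+F\ast R$ and $R=\sum_{n\ge1}F_n$ with $F_1=F$, $F_{n+1}=F_n\ast F$. An empty sum is $0$. Convention: $0/0=0$. *)

(* Defs.v *)
From HB Require Import structures.
From mathcomp Require Import all_boot all_order all_algebra.
From mathcomp Require Import all_classical all_reals all_analysis measurable_realfun.

Set Implicit Arguments.
Unset Strict Implicit.
Unset Printing Implicit Defensive.

Import Order.TTheory GRing.Theory Num.Theory.
Import numFieldNormedType.Exports.

Local Open Scope classical_set_scope.
Local Open Scope ring_scope.

(* Measurably isomorphic to a Borel subset of the line: [phi] is a bijection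
   onto its range, which is Borel (take [A = setT]), and its inverse is
   measurable. *)
Definition borel_space (R : realType) d (X : measurableType d) : Prop :=
  exists phi : X -> R, [/\ measurable_fun [set: X] phi, injective phi &
    forall A : set X, measurable A -> measurable (phi @` A)].

(* [option X] is the mark space with the external point [None] adjoined; the
   complement of [Some @` setT] shows that {None} is measurable. *)
Notation extended_mark X :=
  (g_sigma_algebraType [set (@Some _) @` A | A in @measurable _ X]).

(* Events are numbered from 0: [event_time n] is T_(n+1). *)
Record marked_point_process (R : realType) dO (Omega : measurableType dO)
    dX (X : measurableType dX) := MarkedPointProcess {
  event_time : nat -> {mfun Omega >-> \bar R} ;
  event_mark : nat -> {mfun Omega >-> extended_mark X} ;
  event_time_gt0 : forall n w, (0 < event_time n w)%E ;
  event_time_le : forall n w, (event_time n w <= event_time n.+1 w)%E ;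
  event_time_lt : forall n w, (event_time n w < +oo)%E ->
    (event_time n w < event_time n.+1 w)%E ;
  event_mark_None : forall n w,
    event_mark n w = None <-> event_time n w = +oo%E
}.

Section random_measure.
Context (R : realType) dO (Omega : measurableType dO)
  dX (X : measurableType dX).
Variable N : marked_point_process R Omega X.

Definition atom (w : Omega) (n : nat) : {measure set (R * X) -> \bar R} :=
  match event_time N n w, (event_mark N n w : option X) with
  | t%:E, Some x => \d_(t, x)
  | _, _ => mzero
  end.

Definition random_measure (w : Omega) : {measure set (R * X) -> \bar R} :=
  mseries (atom w) 0.

Definition event_count (t : R) (A : set X) (w : Omega) : \bar R :=
  random_measure w (`]0, t] `*` A).

Definition natural_filtration (t : R) : set (set Omega) :=
  <<s \bigcup_(s in `[0, t]) \bigcup_(A in @measurable _ X)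
        preimage_set_system setT (event_count s A) measurable >>.

Definition sigma_process : set (set Omega) :=
  <<s \bigcup_n (preimage_set_system setT (event_time N n) measurable `|`
                 preimage_set_system setT (event_mark N n) measurable) >>.

(* Generators of the predictable sigma-algebra on Omega * [0, +oo[; time ranges
   over the whole of R here, and negative times form part of a single atom that
   no integral below sees. *)
Definition predictable_rect : set (set (Omega * R)) :=
  [set B `*` [set 0] | B in natural_filtration 0] `|`
  [set D | exists s t B, [/\ 0 <= s, s <= t, natural_filtration s B &
                             D = B `*` `]s, t]%classic]].

Definition predictable_process (Y : Omega * R -> \bar R) : Prop :=
  measurable_fun [set: g_sigma_algebraType predictable_rect] Y.

Definition predictable_function (W : (Omega * R) * X -> \bar R) : Prop :=
  measurable_fun [set: g_sigma_algebraType predictable_rect * X] W.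

(* The random measure kappa(t, dx) dt is the compensator (dual predictable
   projection) of N with respect to the natural filtration: it is predictable,
   and it integrates every nonnegative predictable function to the same
   expectation as N does. *)
Definition compensated_by (P : probability Omega R)
    (kappa : Omega -> R -> {measure set X -> \bar R}) : Prop :=
  (forall W, predictable_function W -> (forall p, 0 <= W p)%E ->
     predictable_process (fun wt =>
       \int[lebesgue_measure]_(s in `]0%R, wt.2])
         \int[kappa wt.1 s]_x W (wt.1, s, x))%E) /\
  (forall W, predictable_function W -> (forall p, 0 <= W p)%E ->
     (\int[P]_w \int[random_measure w]_p W (w, p.1, p.2) =
      \int[P]_w \int[lebesgue_measure]_(t in `[0%R, +oo[)
        \int[kappa w t]_x W (w, t, x))%E).

End random_measure.

Section hawkes.
Context (R : realType) dO (Omega : measurableType dO)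
  dX (X : measurableType dX).
Variables (N : marked_point_process R Omega X) (m : {nonneg R})
  (f : R * X -> {nonneg R}) (Q : probability X R).
Local Open Scope ereal_scope.

Definition hawkes_intensity (w : Omega) (t : R) : \bar R :=
  m%:num%:E + \int[random_measure N w]_(p in `]0%R, t[ `*` [set: X])
                 (f (t - p.1, p.2)%R)%:num%:E.

Definition hawkes_kernel (w : Omega) (t : R) (A : set X) : \bar R :=
  hawkes_intensity w t * Q A.

Section hawkes_kernel_measure.
Variables (w : Omega) (t : R).

Let hawkes_kernel0 : hawkes_kernel w t set0 = 0.
Proof. by rewrite /hawkes_kernel measure0 mule0. Qed.

Let hawkes_intensity_ge0 : 0 <= hawkes_intensity w t.
Proof. by apply: adde_ge0 => //; apply: integral_ge0. Qed.

Let hawkes_kernel_ge0 A : 0 <= hawkes_kernel w t A.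
Proof. exact: mule_ge0. Qed.

Let hawkes_kernel_sigma_additive : semi_sigma_additive (hawkes_kernel w t).
Proof.
move=> F mF tF mUF; rewrite /hawkes_kernel -integral_cst//.
rewrite ge0_integral_bigcup//.
under [X in _ --> X]eq_eseriesr do rewrite integral_cst//.
by apply: is_cvg_ereal_nneg_natsum => n _; exact: mule_ge0.
Qed.

HB.instance Definition _ := isMeasure.Build _ _ _ (hawkes_kernel w t)
  hawkes_kernel0 hawkes_kernel_ge0 hawkes_kernel_sigma_additive.

End hawkes_kernel_measure.

Definition marked_hawkes (P : probability Omega R) : Prop :=
  compensated_by N P (fun w t => hawkes_kernel w t).

Definition mean_kernel (t : R) : R := (\int[Q]_x (f (t, x))%:num)%R.

End hawkes.

Section half_line.
Context (R : realType).
Implicit Types g h : R -> R.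

Definition L1norm g : \bar R :=
  (\int[lebesgue_measure]_(t in `[0%R, +oo[) `|(g t)%:E|)%E.

Definition convolution g h (t : R) : R :=
  \int[lebesgue_measure]_(s in `[0, t]) (g (t - s) * h s).

(* The solution of this equation is unique, on [0, +oo[, in the class of
   locally integrable functions. *)
Definition is_resolvent (F r : R -> R) : Prop :=
  [/\ measurable_fun (`[0, +oo[ : set R) r,
      forall t, 0 <= t -> lebesgue_measure.-integrable `[0, t] (EFin \o r) &
      forall t, 0 <= t -> r t = convolution F r t - F t].

End half_line.

Section probability_notions.
Context (R : realType) d (Omega : measurableType d) (P : probability Omega R).

Definition independent_systems (G H : set (set Omega)) : Prop :=
  forall A B, G A -> H B -> (P (A `&` B) = P A * P B)%E.

Definition mutually_independent (Z : nat -> {RV P >-> R}) : Prop :=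
  forall (s : seq nat) (U : nat -> set R), uniq s ->
    (forall i, measurable (U i)) ->
    (P (\bigcap_(i in [set` s]) (Z i @^-1` U i)) =
     \prod_(i <- s) P (Z i @^-1` U i))%E.

Definition identically_distributed (Z : nat -> {RV P >-> R}) : Prop :=
  forall n (U : set R), measurable U ->
    distribution P (Z n) U = distribution P (Z 0%N) U.

Definition sigma_sequence (Z : nat -> {RV P >-> R}) : set (set Omega) :=
  <<s \bigcup_n preimage_set_system setT (Z n) measurable >>.

Definition cvg_in_probability (Y : R -> Omega -> R) (y : R) : Prop :=
  forall eps : R, 0 < eps ->
    P [set w | eps < `|Y T w - y|] @[T --> +oo] --> 0%E.

(* [Z n] is Z_(n+1). If infinitely many events occur before t, [fine] makes the
   sum empty; for a Hawkes process this has probability zero. *)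
Definition compound_process dX (X : measurableType dX)
    (N : marked_point_process R Omega X) (Z : nat -> {RV P >-> R})
    (A : set X) (t : R) (w : Omega) : R :=
  \sum_(n < Num.truncn (fine (event_count N t A w))) Z n w.

Definition upsilon dX (X : measurableType dX) (m : R) (Q : probability X R)
    (A : set X) (r : R -> R) (Z : nat -> {RV P >-> R}) (v : R) : R :=
  v * m * fine (Q A) * (fine (L1norm r) + 1) * fine ('E_P[Z 0%N])%E.

End probability_notions.

(* Main.v *)
Require Import Defs.
From HB Require Import structures.
From mathcomp Require Import all_boot all_order all_algebra.
From mathcomp Require Import all_classical all_reals all_analysis measurable_realfun.
From mathcomp Require Import ring lra.

Set Implicit Arguments.
Unset Strict Implicit.
Unset Printing Implicit Defensive.

Import Order.TTheory GRing.Theory Num.Theory.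
Import numFieldNormedType.Exports.

Local Open Scope classical_set_scope.
Local Open Scope ring_scope.

(* Idea.  Stop at the event of index k, so that every quantity is bounded, and
   write q for the L1 norm of F and Lam for the integral of the stopped intensity.
   The mean intensity satisfies b <= m + F * b, hence b <= m / (1 - q).  The
   compensator identity, applied to the predictable processes N(s-, A) and Lam(s),
   gives E (N(t, A) - Q(A) Lam(t))^2 <= E N(t, A) = O(t).  Integrating the
   intensity in time gives the balance
     Lam(t) + tail(t) = m t + \int g dN,   g(x) = || f(., x) ||_1,
   where the tail has bounded mean because F has a finite first moment; replacing
   g by a simple function and \int g dN by q Lam(t) costs o(t) in mean, so that
   N(t, A) / t tends to m Q(A) / (1 - q), and the bounds do not depend on k.  The
   resolvent equation yields || r ||_1 = q / (1 - q).  Finally the random sum is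
   compared with N(t, A) E(Z) by conditioning on N(t, A), using an L1 law of large
   numbers for the partial sums of Z. *)

(** * Lebesgue measure and indicators *)

(** The compensator identity equates possibly infinite expectations of nonnegative integrands, so
    differences cannot be formed directly. The moment identities are therefore stated additively,
    and a term is cancelled only once stopping has made it finite. For the second moment, with Lam_A
    = Q(A) Lam, integration by parts along each path gives N_A^2 = N_A + 2 \int N_A(s-) dN_A, N_A
    Lam_A = \int Lam_A dN_A + \int N_A(s-) dLam_A and Lam_A^2 <= 2 \int Lam_A dLam_A; in mean,
    compensation turns dN_A into dLam_A, and the mixed terms cancel. The stopping is not undone by a
    limit of processes: P(T_k <= t) is at most a constant times t / (k + 1), so the stopped and
    unstopped counts agree outside an event of arbitrarily small probability. The square bound
    concerns counts of marks in a set, whence the simple function below g. The mean deviations are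
    bounded by B + d t with d arbitrarily small and B depending on d; the partial sums of Z get a
    bound of the same shape, so that both errors are treated alike by Markov's inequality. *)

Section lebesgue_affine.
Context {R : realType}.
Local Notation mu := (@lebesgue_measure R).

Lemma measurable_addr (c : R) : measurable_fun [set: R] (fun x : R => x + c).
Proof. exact: measurable_funD. Qed.

Lemma lebesgue_measure_shift (c : R) (A : set R) : measurable A ->
  mu ((fun x => x + c) @^-1` A) = mu A.
Proof.
move=> mA; pose phi : measurableTypeR R -> measurableTypeR R := fun x => x + c.
have mphi : measurable_fun [set: measurableTypeR R] phi by exact: measurable_addr.
have := @lebesgue_measure_unique R (pushforward mu phi).
rewrite /pushforward /= => /(_ mphi _ A mA) -> //.
move=> X [[a b] _ <-]; rewrite /pushforward /=.
have -> : phi @^-1` `]a, b] = `]a - c, b - c]%classic.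
  by apply/seteqP; split=> x /=; rewrite /phi !in_itv /= ltrBlDr lerBrDr.
by rewrite !lebesgue_measure_itv /= !lte_fin ltrD2r -!EFinB; case: ifP => // _; congr EFin; ring.
Qed.

Lemma ge0_integral_shift (c : R) (h : R -> \bar R) :
  measurable_fun [set: R] h -> (forall x, 0 <= h x)%E ->
  (\int[mu]_x h (x + c)%R = \int[mu]_x h x)%E.
Proof.
move=> mh h0; pose phi : measurableTypeR R -> measurableTypeR R := fun x => x + c.
have mphi : measurable_fun [set: measurableTypeR R] phi by exact: measurable_addr.
transitivity (\int[pushforward mu phi]_x h x)%E.
  by rewrite (ge0_integral_pushforward mphi).
apply: eq_measure_integral => A mA _ /=.
exact: lebesgue_measure_shift.
Qed.

Lemma ge0_integral_reflect (c : R) (h : R -> \bar R) :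
  measurable_fun [set: R] h -> (forall x, 0 <= h x)%E ->
  (\int[mu]_x h (c - x)%R = \int[mu]_x h x)%E.
Proof.
move=> mh h0; rewrite -(ge0_integral_shift c mh h0).
pose phi : measurableTypeR R -> measurableTypeR R := fun x => - x.
have mphi : measurable_fun [set: measurableTypeR R] phi by exact: oppr_measurable.
have mhc : measurable_fun [set: R] (fun x => h (x + c)).
  by apply: measurableT_comp => //; exact: measurable_addr.
transitivity (\int[pushforward mu phi]_x h (x + c)%R)%E; last first.
  by apply: eq_measure_integral => A mA _ /=; exact: lebesgue_measureN.
rewrite (ge0_integral_pushforward mphi)//.
by apply: eq_integral => x _ /=; rewrite addrC.
Qed.

End lebesgue_affine.

Section indicator.
Context {R : realType}.
Local Open Scope ereal_scope.

(** A boolean test with extended real value: integrals over a domain become integrals of products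
    over the whole space, and intersections of domains become boolean algebra before Tonelli is
    applied. *)
Definition ind (b : bool) : \bar R := if b then 1 else 0.

Lemma ind_ge0 b : 0 <= ind b.
Proof. by case: b; rewrite /= ?lee01. Qed.

Lemma ind_le1 b : ind b <= 1.
Proof. by case: b; rewrite /= ?lee01. Qed.

Lemma ind_and b c : ind (b && c) = ind b * ind c.
Proof. by case: b; rewrite /= ?mul1e ?mul0e. Qed.

Lemma le_ind b c : (b ==> c) -> ind b <= ind c.
Proof. by case: b; case: c => //= _; rewrite lee01. Qed.

Lemma indM_ge0 b x : 0 <= x -> 0 <= ind b * x.
Proof. by move=> x0; rewrite mule_ge0 ?ind_ge0. Qed.

Lemma measurable_ind d (T : measurableType d) (b : T -> bool) :
  measurable_fun [set: T] b -> measurable_fun [set: T] (fun x => ind (b x)).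
Proof. by move=> mb; apply: measurable_fun_ifT. Qed.

Lemma integral_ind d (T : measurableType d) (m : {measure set T -> \bar R})
    (D : set T) (b : T -> bool) (h : T -> \bar R) : (forall x, D x <-> b x) ->
  \int[m]_(x in D) h x = \int[m]_x (ind (b x) * h x).
Proof.
move=> Db; rewrite integral_mkcond; apply: eq_integral => x _.
rewrite patchE; have -> : (x \in D) = b x.
  by apply/idP/idP => [/set_mem/Db|/Db/mem_set].
by rewrite /ind; case: (b x); rewrite ?mul1e ?mul0e.
Qed.

Lemma measurable_pred d (T : measurableType d) (b : T -> bool) :
  measurable_fun [set: T] b -> measurable [set x | b x].
Proof.
move=> mb; have := mb measurableT [set true] I.
by rewrite setTI.
Qed.

Lemma integral_ind_measure d (T : measurableType d) (m : {measure set T -> \bar R})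
    (b : T -> bool) : measurable_fun [set: T] b ->
  \int[m]_x ind (b x) = m [set x | b x].
Proof.
move=> mb; rewrite -(setIT [set x | b x]) -integral_indic//; last exact: measurable_pred.
apply: eq_integral => x _; rewrite indicE.
have -> : (x \in [set x | b x]) = b x by apply/idP/idP => [/set_mem|/mem_set].
by case: (b x).
Qed.

End indicator.

(** * Point processes and predictability *)

Section point_process.
Context (R : realType) dO (Omega : measurableType dO)
  dX (X : measurableType dX).
Variables (N : marked_point_process R Omega X) (x0 : X).
Local Open Scope ereal_scope.

Definition arrival (n : nat) (w : Omega) : R := fine (event_time N n w).

(* The default mark [x0] stands for the external point. *)
Definition inner_mark (u : extended_mark X) : X := odflt x0 (u : option X).

Definition mark (n : nat) (w : Omega) : X := inner_mark (event_mark N n w).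

Lemma measurable_inner_mark : measurable_fun [set: extended_mark X] inner_mark.
Proof.
move=> _ B mB; rewrite setTI.
have mS A : measurable A -> measurable ((@Some X @` A) : set (extended_mark X)).
  by move=> mA; apply: sub_sigma_algebra; exists A.
(* The external point is sent to [x0]. Its singleton, the complement of the range of [Some],
   therefore belongs to the preimage exactly when [x0] lies in [B]. *)
have -> : inner_mark @^-1` B = (@Some X @` B) `|`
    (if x0 \in B then ~` (@Some X @` setT) else set0).
  apply/seteqP; split=> [[x|]|[x|]] /=.
  - by move=> Bx; left; exists x.
  - by rewrite /inner_mark/= => /mem_set ->; right => -[].
  - case=> [[y By [<-]]//|]; case: ifP => // _ /= nx; exfalso; apply: nx.
    by exists x.
  - by case=> [[]//|]; case: ifP => // /set_mem.
apply: measurableU; first exact: mS.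
by case: ifP => // _; apply: measurableC; exact: mS.
Qed.

Lemma measurable_mark n : measurable_fun [set: Omega] (mark n).
Proof. exact: measurableT_comp measurable_inner_mark (measurable_funP _). Qed.

Lemma measurable_arrival n : measurable_fun [set: Omega] (arrival n).
Proof.
apply: (measurable_comp (F := setT)) => //; exact: fine_measurable.
Qed.

Lemma event_time_fin n w : event_time N n w < +oo ->
  event_time N n w = (arrival n w)%:E.
Proof.
move=> fin; rewrite /arrival fineK// ge0_fin_numE//.
exact/ltW/event_time_gt0.
Qed.

Lemma event_time_lt_of_lt n k w : (n < k)%N -> event_time N n w < +oo ->
  event_time N n w < event_time N k w.
Proof.
elim: k => // k IH; rewrite ltnS leq_eqVlt => /orP[/eqP ->|nk] fin.
  exact: event_time_lt.
by apply: lt_le_trans (event_time_le N k w); exact: IH.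
Qed.

Lemma event_time_le_of_le n k w : (n <= k)%N ->
  event_time N n w <= event_time N k w.
Proof.
elim: k => [|k IH]; first by rewrite leqn0 => /eqP ->.
rewrite leq_eqVlt => /orP[/eqP ->//|]; rewrite ltnS => /IH nk.
exact: le_trans (event_time_le N k w).
Qed.

(** Finite event times increase strictly, so that comparing times amounts to comparing indices; this
    is how stopping at a time becomes truncation of a sum. *)
Lemma event_time_le_arrival n k w : event_time N n w < +oo ->
  (event_time N n w <= event_time N k w) = (n <= k)%N.
Proof.
move=> fin; apply/idP/idP; last exact: event_time_le_of_le.
apply: contraTT; rewrite -ltnNge -ltNge => kn.
apply: event_time_lt_of_lt => //; apply: le_lt_trans fin.
exact/event_time_le_of_le/ltnW.
Qed.

Lemma event_time_ltE n t w : (event_time N n w < t%:E) =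
  (event_time N n w < +oo) && (arrival n w < t)%R.
Proof.
have [fin|] := boolP (event_time N n w < +oo).
  by rewrite (event_time_fin fin) lte_fin.
rewrite -leNgt => le; apply/negbTE; rewrite -leNgt.
by apply: le_trans le; rewrite leey.
Qed.

Lemma event_time_leE n t w : (event_time N n w <= t%:E) =
  (event_time N n w < +oo) && (arrival n w <= t)%R.
Proof.
have [fin|] := boolP (event_time N n w < +oo).
  by rewrite (event_time_fin fin) lee_fin.
rewrite -leNgt => le; apply/negbTE; rewrite -ltNge.
by apply: lt_le_trans le; rewrite ltey.
Qed.

Lemma arrival_gt0 n w : event_time N n w < +oo -> (0 < arrival n w)%R.
Proof.
by move=> fin; rewrite -lte_fin -event_time_fin//; exact: event_time_gt0.
Qed.

(** By [event_mark_None] the time and the mark cannot disagree, so finiteness of the time alone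
    decides whether there is an atom. *)
Lemma atomE w n : atom N w n =
  if event_time N n w < +oo
  then (\d_(arrival n w, mark n w) : {measure set (R * X) -> \bar R})
  else (mzero : {measure set (R * X) -> \bar R}).
Proof.
have := event_mark_None N n w; have := event_time_gt0 N n w.
rewrite /atom /arrival /mark /inner_mark.
case: (event_time N n w) => [t| |] //= _.
  rewrite ltry; case: (event_mark N n w : option X) => //= -[/(_ erefl)].
by case: (event_mark N n w : option X).
Qed.

Lemma integral_random_measure (h : R * X -> \bar R) w :
  measurable_fun [set: R * X] h -> (forall p, 0 <= h p) ->
  \int[random_measure N w]_p h p =
  \sum_(n <oo) ind (event_time N n w < +oo) * h (arrival n w, mark n w).
Proof.
move=> mh h0; rewrite ge0_integral_measure_series//.
apply: eq_eseriesr => n _; rewrite atomE; case: ifP => _ /=.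
  by rewrite integral_dirac// diracT.
by rewrite integral_measure_zero mul0e.
Qed.

Lemma random_measureE (B : set (R * X)) w :
  random_measure N w B =
  \sum_(n <oo) ind (event_time N n w < +oo) *
    ind ((arrival n w, mark n w) \in B).
Proof.
rewrite /random_measure /= /mseries; apply: eq_eseriesr => n _.
rewrite atomE; case: ifP => _ /=; last by rewrite mul0e.
by rewrite diracE mul1e; case: (_ \in _).
Qed.

Lemma in_setX_itv (J : interval R) (A : set X) (t : R) x :
  ((t, x) \in [set` J] `*` A) = (t \in J) && (x \in A).
Proof. by rewrite in_setX /= mem_setE. Qed.

Lemma event_countE t A w : event_count N t A w =
  \sum_(n <oo) ind (event_time N n w <= t%:E) * ind (mark n w \in A).
Proof.
rewrite /event_count random_measureE; apply: eq_eseriesr => n _.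
rewrite in_setX_itv event_time_leE; case: ltP => fin /=; last by rewrite !mul0e.
by rewrite in_itv/= arrival_gt0//= mul1e ind_and.
Qed.

(** The left limit N(t-, A), which is the predictable version of the count. *)
Definition count_before (t : R) (A : set X) (w : Omega) : \bar R :=
  random_measure N w (`]0%R, t[ `*` A).

Lemma count_beforeE t A w : count_before t A w =
  \sum_(n <oo) ind (event_time N n w < t%:E) * ind (mark n w \in A).
Proof.
rewrite /count_before random_measureE; apply: eq_eseriesr => n _.
rewrite in_setX_itv event_time_ltE; case: ltP => fin /=; last by rewrite !mul0e.
by rewrite in_itv/= arrival_gt0//= mul1e ind_and.
Qed.

End point_process.

Section measurable_count.
Context (R : realType) d (S : measurableType d) dX (X : measurableType dX).
Local Open Scope ereal_scope.

Lemma measurable_mem_set (u : S -> X) (A : set X) : measurable A ->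
  measurable_fun [set: S] u -> measurable_fun [set: S] (fun w => u w \in A).
Proof.
move=> mA mu; apply: (@measurable_fun_bool _ _ _ _ true).
have -> : (fun w => u w \in A) @^-1` [set true] = u @^-1` A.
  by apply/seteqP; split=> w /=; [move/set_mem|move/mem_set].
exact: mu.
Qed.

(** Stated over an arbitrary space because it serves twice: on [Omega], and on the same set with the
    sigma-algebra generated by the point process. *)
Lemma measurable_count (T : nat -> S -> \bar R) (u : nat -> S -> X) t A :
  measurable A -> (forall n, measurable_fun [set: S] (T n)) ->
  (forall n, measurable_fun [set: S] (u n)) ->
  measurable_fun [set: S]
    (fun w => \sum_(n <oo) ind (T n w <= t%:E) * ind (u n w \in A) : \bar R).
Proof.
move=> mA mT mu.
have -> : (fun w => \sum_(n <oo) ind (T n w <= t%:E) * ind (u n w \in A) : \bar R) =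
  (fun w => \sum_(n <oo | n \in predT) ind (T n w <= t%:E) * ind (u n w \in A)).
  by apply/funext => w; apply: eq_eseriesl.
apply: ge0_emeasurable_sum => [k w _ _|k _]; first by rewrite indM_ge0 ?ind_ge0.
apply: emeasurable_funM; apply: measurable_ind.
  exact: measurable_fun_lee.
exact: measurable_mem_set.
Qed.

End measurable_count.

Lemma sume1 (R : realType) k : (\sum_(0 <= n < k) 1 = k%:R%:E :> \bar R)%E.
Proof.
elim: k => [|k IH]; first by rewrite big_geq.
by rewrite big_nat_recr//= IH -EFinD -natr1.
Qed.

Section predictability.
Context (R : realType) dO (Omega : measurableType dO)
  dX (X : measurableType dX).
Variables (N : marked_point_process R Omega X) (x0 : X).
Local Open Scope ereal_scope.
Local Notation PO := (g_sigma_algebraType (predictable_rect N)).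

Lemma measurable_event_count t A : measurable A ->
  measurable_fun [set: Omega] (event_count N t A).
Proof.
move=> mA.
have -> : event_count N t A = (fun w =>
    \sum_(n <oo) ind (event_time N n w <= t%:E) * ind (mark N x0 n w \in A)).
  by apply/funext => w; exact: event_countE.
by apply: measurable_count => // n; exact: measurable_mark.
Qed.

Lemma natural_filtration_setT t : natural_filtration N t setT.
Proof.
rewrite -setC0 -setTD; apply: sigma_algebraCD; exact: sigma_algebra0.
Qed.

Lemma natural_filtration_event_count t A (Y : set (\bar R)) : (0 <= t)%R ->
  measurable A -> measurable Y ->
  natural_filtration N t (event_count N t A @^-1` Y).
Proof.
move=> t0 mA mY; apply: sub_sigma_algebra.
exists t; first by rewrite /= in_itv/= t0 lexx.
exists A => //; exists Y => //; by rewrite setTI.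
Qed.

Lemma natural_filtration_measurable t B : natural_filtration N t B ->
  measurable B.
Proof.
apply: smallest_sub; first exact: sigma_algebra_measurable.
move=> _ [s _ [A mA [Y mY <-]]].
exact: measurable_event_count.
Qed.

Lemma predictable_after q B : (0 <= q)%R -> natural_filtration N q B ->
  measurable (B `*` `]q, +oo[ : set PO).
Proof.
move=> q0 FB.
have -> : B `*` `]q, +oo[ = \bigcup_n (B `*` `]q, (q + n%:R)%R]) :> set (Omega * R).
  apply/seteqP; split=> -[w s] /=.
    rewrite in_itv/= andbT => -[Bw qs]; exists (Num.truncn (s - q)).+1 => //=.
    split=> //; rewrite in_itv/= qs/= addrC -lerBlDr.
    by rewrite ltW// truncnS_gt.
  by move=> [n _ [Bw]] /=; rewrite !in_itv/= => /andP[-> _].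
apply: bigcupT_measurable => n; apply: sub_sigma_algebra; right.
by exists q, (q + n%:R)%R, B; split => //; rewrite lerDl.
Qed.

Lemma predictable_measurable (D : set PO) : measurable D ->
  measurable (D : set (Omega * R)).
Proof.
apply: smallest_sub; first exact: sigma_algebra_measurable.
move=> _ [[B FB <-]|[s [t [B [s0 st FB ->]]]]].
  by apply: measurableX => //; exact: natural_filtration_measurable FB.
by apply: measurableX => //; exact: natural_filtration_measurable FB.
Qed.

Lemma predictable_id : measurable_fun [set: Omega * R] (id : Omega * R -> PO).
Proof. by move=> _ Y mY; rewrite setTI; exact: predictable_measurable. Qed.

(** No generator separates two negative times, so only the positive part of time is predictable. *)
Lemma predictable_time :
  measurable_fun [set: PO] (fun p => Num.max p.2 0%R : R).
Proof.
apply: (measurability _ (RGenOInfty.measurableE R)) => //.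
move=> _ [_ [a ->] <-]; rewrite setTI.
have [a0|a0] := ltP a 0%R.
  have -> : (fun p : PO => Num.max p.2 0%R) @^-1` `]a, +oo[ = setT.
    by apply/seteqP; split=> p //= _; rewrite in_itv/= andbT lt_max a0 orbT.
  exact: measurableT.
have -> : (fun p : PO => Num.max p.2 0%R) @^-1` `]a, +oo[ = setT `*` `]a, +oo[.
  apply/seteqP; split=> -[w s] /=; rewrite !in_itv/= !andbT lt_max.
    by move=> /orP[->//|]; rewrite ltNge a0.
  by move=> [_ ->].
by apply: predictable_after => //; exact: natural_filtration_setT.
Qed.

(* Left continuity in time: [N(t-, A)] is the supremum of the [N(q, A)] over
   rational [q < t], which makes it predictable. *)
Lemma count_before_gt t A w (a : \bar R) : measurable A -> 0 <= a ->
  a < count_before N t A w <->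
  exists q : rat, [/\ (0 <= ratr q :> R)%R, (ratr q < t)%R &
                      a < event_count N (ratr q) A w].
Proof.
move=> mA a0; split; last first.
  move=> [q [q0 qt]] /lt_le_trans; apply.
  rewrite /event_count /count_before; apply: le_measure; rewrite ?inE//.
  - exact: measurableX.
  - exact: measurableX.
  - move=> -[s x] /= []; rewrite !in_itv/= => /andP[-> sq] Ax; split=> //=.
    exact: le_lt_trans qt.
have [t0|t0] := leP t 0%R.
  rewrite /count_before set_itv_ge ?set0X ?measure0; last first.
    by rewrite -leNgt bnd_simp.
  by rewrite ltNge a0.
(* Windows with closed right ends increasing to [t]; continuity from below along them turns N(t-, A)
   into a limit of counts at earlier times. *)
pose V n : set (R * X) := `]0%R, (t - t / n.+1%:R)%R] `*` A.
have -> : count_before N t A w = limn (random_measure N w \o V).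
  apply/esym/cvg_lim => //; rewrite /count_before.
  have -> : `]0%R, t[ `*` A = \bigcup_n V n.
    apply/seteqP; split=> -[s x] /=; rewrite !in_itv/=.
      move=> [/andP[s0 st] Ax].
      (* The inequality s <= t - t / (n + 1) amounts to t / (t - s) <= n + 1. *)
      exists (Num.truncn (t / (t - s))) => //; split=> //=.
      rewrite in_itv/= s0/= lerBrDr -lerBrDl ler_pdivrMr//.
      rewrite mulrC -ler_pdivrMr ?subr_gt0//.
      exact/ltW/truncnS_gt.
    move=> [n _ []] /=; rewrite !in_itv/= => /andP[-> sn] Ax; split=> //=.
    by apply: le_lt_trans sn _; rewrite ltrBlDr ltrDl divr_gt0.
  apply: nondecreasing_cvg_mu.
  - by move=> n; apply: measurableX.
  - by apply: bigcupT_measurable => n; apply: measurableX.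
  - apply/nondecreasing_seqP => n; rewrite subsetEset => -[s x]; rewrite /V /=.
    rewrite !in_itv/= => -[/andP[-> sn] Ax]; split=> //=.
    apply: le_trans sn _; rewrite lerD2l lerN2 ler_pM2l//.
    by rewrite lef_pV2 ?posrE// ler_nat.
have ndV : nondecreasing_seq (random_measure N w \o V).
  apply/nondecreasing_seqP => n /=; apply: le_measure; rewrite ?inE//.
  - exact: measurableX.
  - exact: measurableX.
  - move=> -[s x]; rewrite /V /= !in_itv/= => -[/andP[-> sn] Ax]; split=> //=.
    apply: le_trans sn _; rewrite lerD2l lerN2 ler_pM2l//.
    by rewrite lef_pV2 ?posrE// ler_nat.
move=> alim.
have [n an] : exists n, a < random_measure N w (V n).
  apply/not_existsP => H; move: alim; rewrite ltNge => /negP; apply.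
  apply: lime_le; first exact: ereal_nondecreasing_is_cvgn.
  by apply: nearW => n; rewrite leNgt; apply/negP/H.
have : (t - t / n.+1%:R < t)%R by rewrite ltrBlDr ltrDl divr_gt0.
have tn0 : (0 <= t - t / n.+1%:R)%R.
  by rewrite subr_ge0 ler_pdivrMr// -{1}(mulr1 t) ler_pM2l// ler1n.
move=> /rat_in_itvoo[q]; rewrite in_itv/= => /andP[q1 q2].
exists q; split => //; first exact: le_trans (ltW q1).
apply: lt_le_trans an _; rewrite /event_count /=; apply: le_measure; rewrite ?inE//.
- exact: measurableX.
- exact: measurableX.
- move=> -[s x]; rewrite /V /= !in_itv/= => -[/andP[-> sn] Ax]; split=> //=.
  exact: le_trans (ltW q1).
Qed.

Lemma predictable_count_before A : measurable A ->
  measurable_fun [set: PO] (fun p => count_before N p.2 A p.1).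
Proof.
move=> mA; apply: (measurability _ (ErealGenOInfty.measurableE R)) => //.
move=> _ [_ [a ->] <-]; rewrite setTI.
have [a0|a0] := ltP a 0%R.
  have -> : (fun p : PO => count_before N p.2 A p.1) @^-1` `]a%:E, +oo[ = setT.
    apply/seteqP; split=> p //= _; rewrite in_itv/= andbT.
    by apply: lt_le_trans (measure_ge0 _ _); rewrite lte_fin.
  exact: measurableT.
pose E (q : rat) : set PO :=
  if (0 <= ratr q :> R)%R then
    (event_count N (ratr q) A @^-1` `]a%:E, +oo[) `*` `](ratr q : R), +oo[
  else set0.
have -> : (fun p : PO => count_before N p.2 A p.1) @^-1` `]a%:E, +oo[ =
    \bigcup_q E q.
  apply/seteqP; split=> -[w s] /=.
    rewrite in_itv/= andbT count_before_gt ?lee_fin// => -[q [q0 qs aq]].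
    by exists q => //; rewrite /E q0; split; rewrite /= in_itv/= andbT.
  move=> [q _]; rewrite /E; case: ifP => // q0 [] /=; rewrite !in_itv/= !andbT.
  by move=> aq qs; rewrite count_before_gt ?lee_fin//; exists q.
apply: bigcupT_measurable_rat => q; rewrite /E; case: ifP => [q0|_]; last first.
  exact: measurable0.
apply: predictable_after => //; apply: natural_filtration_event_count => //.
exact: emeasurable_itv.
Qed.

(** Numbering starts from 0, so index [k] carries the (k+1)-st event. This recovers event times from
    counts, the only generators of the natural filtration. *)
Lemma event_count_gt t k w :
  (k%:R%:E < event_count N t setT w) = (event_time N k w <= t%:E).
Proof.
have sumE : event_count N t setT w = \sum_(n <oo) ind (event_time N n w <= t%:E).
  rewrite (event_countE N x0); apply: eq_eseriesr => n _.
  by rewrite in_setT mule1.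
rewrite sumE; apply/idP/idP => [|tk].
  apply: contraTT; rewrite -ltNge -leNgt => kt.
  rewrite (nneseries_split 0%N k)//; last by move=> *; exact: ind_ge0.
  rewrite [X in _ + X]eseries0 ?adde0; last first.
    move=> n kn _; rewrite /ind ifF//; apply/negbTE; rewrite -ltNge.
    by apply: lt_le_trans kt _; apply: event_time_le_of_le; rewrite add0n in kn.
  rewrite add0n; apply: (@le_trans _ _ (\sum_(0 <= n < k) 1)).
    by apply: lee_sum => n _; exact: ind_le1.
  by rewrite sume1.
have e : \sum_(0 <= n < k.+1) ind (event_time N n w <= t%:E) = k.+1%:R%:E :> \bar R.
  rewrite (eq_big_nat _ _ (F2 := fun=> 1)); last first.
    move=> n /andP[_]; rewrite ltnS => nk; rewrite /ind ifT//.
    by apply: le_trans tk; exact: event_time_le_of_le.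
  exact: sume1.
apply: (@lt_le_trans _ _ k.+1%:R%:E); first by rewrite lte_fin ltr_nat.
by rewrite -e; apply: nneseries_lim_ge => n _ _; exact: ind_ge0.
Qed.

(** The complement, T_k < t, is the union over rationals q < t of the events that more than k points
    have occurred by time q, each of which is followed by a predictable half-line of times. *)
Lemma predictable_stop k :
  measurable_fun [set: PO] (fun p => p.2%:E <= event_time N k p.1).
Proof.
apply: (@measurable_fun_bool _ _ _ _ false); rewrite setTI.
pose E (q : rat) : set PO :=
  if (0 <= ratr q :> R)%R then
    (event_count N (ratr q) setT @^-1` `]k%:R%:E, +oo[) `*` `](ratr q : R), +oo[
  else set0.
have -> : (fun p : PO => p.2%:E <= event_time N k p.1) @^-1` [set false] =
    \bigcup_q E q.
  apply/seteqP; split=> -[w s] /=.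
    move/negbT; rewrite -ltNge event_time_ltE => /andP[fin].
    move=> /rat_in_itvoo[q]; rewrite in_itv/= => /andP[kq qs].
    have q0 : (0 <= ratr q :> R)%R by rewrite (le_trans _ (ltW kq))// ltW// arrival_gt0.
    exists q => //; rewrite /E q0; split; rewrite /= in_itv/= andbT ?qs//.
    by rewrite event_count_gt event_time_leE fin ltW.
  move=> [q _]; rewrite /E; case: ifP => // q0 [] /=; rewrite !in_itv/= !andbT.
  rewrite event_count_gt => kq qs; apply/negbTE; rewrite -ltNge.
  by apply: le_lt_trans kq _; rewrite lte_fin.
apply: bigcupT_measurable_rat => q; rewrite /E; case: ifP => [q0|_]; last first.
  exact: measurable0.
apply: predictable_after => //; apply: natural_filtration_event_count => //.
exact: emeasurable_itv.
Qed.

Lemma predictable_section w :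
  measurable_fun [set: R] (fun s => (w, s) : PO).
Proof.
exact: measurableT_comp predictable_id (pair1_measurable w).
Qed.

Lemma predictable_function_section W w : predictable_function N W ->
  measurable_fun [set: R * X] (fun p => W (w, p.1, p.2)).
Proof.
move=> mW.
have h : measurable_fun [set: R * X] (fun p => ((w, p.1) : PO, p.2)).
  apply: measurable_fun_pair; last exact: measurable_snd.
  exact: measurableT_comp (predictable_section w) measurable_fst.
exact: (measurableT_comp mW h).
Qed.

End predictability.

(** * The stopped intensity and its mean *)

Section intensity.
Context (R : realType) dO (Omega : measurableType dO)
  dX (X : measurableType dX).
Variables (N : marked_point_process R Omega X) (x0 : X).
Variables (m : {nonneg R}) (f : R * X -> {nonneg R}) (Q : probability X R).
Hypothesis f_meas : measurable_fun ((`[0, +oo[ : set R) `*` [set: X])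
  (fun p => (f p)%:num).
Local Open Scope ereal_scope.
Local Notation T := (event_time N).
Local Notation arrival := (arrival N).
Local Notation mark := (mark N x0).
Local Notation lambda := (hawkes_intensity N m f).

(* [f] is only measurable for nonnegative times, and time 0 never contributes. *)
Definition causal (p : R * X) : \bar R := ind (0 < p.1)%R * (f p)%:num%:E.

Lemma causal_ge0 p : 0 <= causal p.
Proof. by rewrite indM_ge0. Qed.

Lemma measurable_causal : measurable_fun [set: R * X] causal.
Proof.
pose D : set (R * X) := (`]0%R, +oo[ : set R) `*` [set: X].
have mD : measurable D by apply: measurableX.
have -> : causal = (fun p => (f p)%:num%:E) \_ D.
  apply/funext => p; rewrite patchE /causal.
  have -> : (p \in D) = (0 < p.1)%R.
    apply/idP/idP => [/set_mem[]|p0]; first by rewrite /= in_itv/= andbT.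
    by apply/mem_set; split=> //=; rewrite in_itv/= p0.
  by case: ifP; rewrite /= ?mul1e ?mul0e.
apply/(measurable_restrictT _ mD)/measurable_EFinP.
apply: measurable_funS f_meas; first exact: measurableX.
by move=> p []; rewrite /= !in_itv/= !andbT => /ltW.
Qed.

Lemma hawkes_intensity_ge0 w t : 0 <= lambda w t.
Proof. by rewrite adde_ge0// integral_ge0. Qed.

Lemma hawkes_intensityE w t : lambda w t = m%:num%:E +
  \sum_(n <oo) ind (T n w < t%:E) * causal (t - arrival n w, mark n w)%R.
Proof.
rewrite /hawkes_intensity; congr (_ + _).
rewrite (@integral_ind _ _ _ _ _ (fun p => p.1 \in `]0%R, t[)); last first.
  by move=> [s x]; split=> [[]|]//=.
transitivity (\int[random_measure N w]_p
    (ind (p.1 \in `]0%R, t[) * causal (t - p.1, p.2)%R)).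
  apply: eq_integral => -[s x] _ /=; rewrite in_itv/= /causal/=.
  have [s0|s0] := ltP 0%R s; rewrite ?mul0e//=.
  by have [st|st] := ltP s t; rewrite ?mul0e//= subr_gt0 st !mul1e.
rewrite (integral_random_measure N x0)//.
- apply: eq_eseriesr => n _ /=; rewrite event_time_ltE.
  have [fin|fin] := ltP (T n w) +oo; rewrite ?mul0e//= mul1e.
  by rewrite in_itv/= arrival_gt0.
- apply: emeasurable_funM.
    apply: measurable_ind.
    have -> : (fun p : R * X => p.1 \in `]0%R, t[) =
        (fun p => (0 < p.1)%R && (p.1 < t)%R).
      by apply/funext => p; rewrite in_itv.
    by apply: measurable_and; apply: measurable_fun_ltr.
  apply: (measurableT_comp measurable_causal).
  by apply: measurable_fun_pair => //; exact: measurable_funB.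
- by move=> p; rewrite indM_ge0 ?causal_ge0.
Qed.

Lemma measurable_hawkes_intensity :
  measurable_fun [set: Omega * R] (fun p => lambda p.1 p.2).
Proof.
have -> : (fun p : Omega * R => lambda p.1 p.2) = (fun p => m%:num%:E +
    \sum_(n <oo | n \in predT)
      ind (T n p.1 < p.2%:E) * causal (p.2 - arrival n p.1, mark n p.1)%R).
  by apply/funext => p; rewrite hawkes_intensityE; congr (_ + _); apply: eq_eseriesl.
apply: emeasurable_funD => //; apply: ge0_emeasurable_sum => [n p _ _|n _].
  by rewrite indM_ge0 ?causal_ge0.
apply: emeasurable_funM.
  apply: measurable_ind; apply: measurable_fun_lte.
    exact: measurableT_comp measurable_fst.
  by apply/measurable_EFinP; exact: measurable_snd.
apply: (measurableT_comp measurable_causal); apply: measurable_fun_pair.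
  apply: measurable_funB => //.
  exact: measurableT_comp (measurable_arrival N n) measurable_fst.
exact: measurableT_comp (measurable_mark N x0 n) measurable_fst.
Qed.

(** At a finite intensity the kernel is a real multiple of [Q], and integration against [mscale]
    applies; its factor has to be a real number. *)
Lemma integral_hawkes_kernel w t (h : X -> \bar R) :
  lambda w t < +oo -> measurable_fun [set: X] h -> (forall x, 0 <= h x) ->
  \int[hawkes_kernel N m f Q w t]_x h x = lambda w t * \int[Q]_x h x.
Proof.
move=> fin mh h0; have l0 := hawkes_intensity_ge0 w t.
have l0' : (0 <= fine (lambda w t))%R by exact: fine_ge0.
rewrite -(@fineK _ (lambda w t)) ?ge0_fin_numE//.
rewrite -[fine _]/((NngNum l0')%:num) -ge0_integral_mscale//.
apply: eq_measure_integral => A mA _ /=.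
by rewrite /hawkes_kernel /mscale /= fineK// ge0_fin_numE.
Qed.

(** Only events strictly before [s], hence of index below [k], contribute. The vanishing term of
    index [k] is kept so that the range agrees with that of the stopped sums. *)
Lemma hawkes_intensity_stopE k w s : s%:E <= T k w ->
  lambda w s = m%:num%:E + \sum_(0 <= n < k.+1)
    ind (T n w < s%:E) * causal (s - arrival n w, mark n w)%R.
Proof.
move=> sk; rewrite hawkes_intensityE; congr (_ + _).
rewrite (nneseries_split 0%N k.+1)//; last by move=> *; rewrite indM_ge0 ?causal_ge0.
rewrite [X in _ + X]eseries0 ?adde0; last first.
  move=> n kn _; rewrite /ind ifF ?mul0e//; apply/negbTE; rewrite -leNgt.
  by apply: le_trans sk _; apply: event_time_le_of_le; exact: ltnW.
by rewrite add0n.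
Qed.

Section stopped.
Variable M : R.
Hypothesis M_ge0 : (0 <= M)%R.
Hypothesis f_le : forall t x, (0 <= t)%R -> ((f (t, x))%:num <= M)%R.

Lemma causal_le p : causal p <= M%:E.
Proof.
rewrite /causal; case: (ltrP 0%R p.1) => p0; last by rewrite mul0e.
by rewrite mul1e lee_fin; case: p p0 => t x /ltW; exact: f_le.
Qed.

Lemma hawkes_intensity_le w s k : s%:E <= T k w ->
  lambda w s <= (m%:num + M * k%:R)%:E.
Proof.
move=> sk; rewrite (hawkes_intensity_stopE sk) EFinD; apply: leeD => //.
(* The term of index [k] vanishes since [s] does not exceed its time; [k] terms remain. *)
rewrite big_nat_recr//= [X in _ + X](_ : _ = 0) ?adde0; last first.
  by rewrite ltNge sk mul0e.
apply: (@le_trans _ _ (\sum_(0 <= n < k) M%:E * 1)).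
  apply: lee_sum => n _; rewrite muleC; apply: lee_pmul.
  - exact: causal_ge0.
  - exact: ind_ge0.
  - exact: causal_le.
  - exact: ind_le1.
by rewrite -ge0_sume_distrr ?sume1// => *; rewrite lee01.
Qed.

End stopped.

(* Up to the event of index [k] only [k] events contribute to the intensity, so
   that it is bounded and no expectation below is infinite a priori. *)
Definition stopped_intensity (k : nat) (w : Omega) (s : R) : \bar R :=
  ind ((0 <= s)%R && (s%:E <= T k w)) * lambda w s.

Lemma stopped_intensity_ge0 k w s : 0 <= stopped_intensity k w s.
Proof. by rewrite indM_ge0 ?hawkes_intensity_ge0. Qed.

Lemma stopped_intensity_le M k w s : (0 <= M)%R ->
  (forall t x, (0 <= t)%R -> ((f (t, x))%:num <= M)%R) ->
  stopped_intensity k w s <= (m%:num + M * k%:R)%:E.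
Proof.
move=> M0 fM; rewrite /stopped_intensity.
case: (lerP 0%R s) => s0 /=; last first.
  by rewrite mul0e lee_fin addr_ge0 ?mulr_ge0.
case: (leP s%:E (T k w)) => sk /=; last first.
  by rewrite mul0e lee_fin addr_ge0 ?mulr_ge0.
by rewrite mul1e; exact: hawkes_intensity_le.
Qed.

Lemma measurable_stopped_intensity k :
  measurable_fun [set: Omega * R] (fun p => stopped_intensity k p.1 p.2).
Proof.
apply: emeasurable_funM; last exact: measurable_hawkes_intensity.
apply: measurable_ind; apply: measurable_and.
  by apply: measurable_fun_ler => //; exact: measurable_snd.
apply: measurable_fun_lee; first by apply/measurable_EFinP; exact: measurable_snd.
exact: measurableT_comp measurable_fst.
Qed.

End intensity.

(** * The compensator identity up to an event *)

Section compensation.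
Context (R : realType) dO (Omega : measurableType dO) (P : probability Omega R)
  dX (X : measurableType dX).
Variables (N : marked_point_process R Omega X) (x0 : X).
Variables (m : {nonneg R}) (f : R * X -> {nonneg R}) (Q : probability X R).
Hypothesis f_meas : measurable_fun ((`[0, +oo[ : set R) `*` [set: X])
  (fun p => (f p)%:num).
Hypothesis f_bounded : exists M : R, forall t x, 0 <= t -> (f (t, x))%:num <= M.
Hypothesis N_hawkes : marked_hawkes N m f Q P.
Local Open Scope ereal_scope.
Local Notation T := (event_time N).
Local Notation arrival := (arrival N).
Local Notation mark := (mark N x0).
Local Notation ell := (stopped_intensity N m f).

Lemma stopped_intensity_bound k : exists B : R,
  (0 <= B)%R /\ forall w s, ell k w s <= B%:E.
Proof.
have [M fM] := f_bounded; pose M' := Num.max M 0%R.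
exists (m%:num + M' * k%:R)%R; split.
  by rewrite addr_ge0 ?mulr_ge0// le_max lexx orbT.
move=> w s; apply: stopped_intensity_le => //; first by rewrite le_max lexx orbT.
by move=> t x t0; rewrite le_max fM.
Qed.

Lemma predictable_function_stop k W : predictable_function N W ->
  predictable_function N (fun p => ind (p.1.2%:E <= T k p.1.1) * W p).
Proof.
move=> mW; apply: emeasurable_funM => //; apply: measurable_ind.
exact: (measurableT_comp (predictable_stop x0 k) measurable_fst).
Qed.

(** Either an indicator kills both sides or the intensity is below the stopped bound, so the
    finiteness required by [integral_hawkes_kernel] holds whenever it matters. *)
Lemma integral_hawkes_kernel_stop k w t (h : X -> \bar R) :
  measurable_fun [set: X] h -> (forall x, 0 <= h x) ->
  ind (0 <= t)%R * \int[hawkes_kernel N m f Q w t]_x (ind (t%:E <= T k w) * h x) =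
  ell k w t * \int[Q]_x h x.
Proof.
move=> mh h0; have [B [B0 lB]] := stopped_intensity_bound k.
have := lB w t; rewrite /stopped_intensity.
case: (lerP 0%R t) => t0 /=; last by rewrite !mul0e.
case: (leP t%:E (T k w)) => tk /=; last first.
  by rewrite !mul0e integral0_eq ?mule0// => x _; rewrite mul0e.
rewrite !mul1e => le; under eq_integral do rewrite mul1e.
by rewrite integral_hawkes_kernel//; apply: le_lt_trans le _; exact: ltry.
Qed.

(** The identity is applied to [W] multiplied by the predictable indicator of t <= T_k. This
    interval is closed on the right and keeps the event of index [k], whence k + 1 terms. *)
Lemma stopped_compensation k W : predictable_function N W ->
  (forall p, 0 <= W p) ->
  \int[P]_w (\sum_(0 <= n < k.+1)
     ind (T n w < +oo) * W (w, arrival n w, mark n w)) =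
  \int[P]_w \int[lebesgue_measure]_t (ell k w t * \int[Q]_x W (w, t, x)).
Proof.
move=> mW W0.
have [_ /(_ _ (predictable_function_stop k mW))] := N_hawkes.
move=> /(_ (fun p => indM_ge0 _ (W0 p))) /= => E.
transitivity (\int[P]_w \int[random_measure N w]_p
    (ind (p.1%:E <= T k w) * W (w, p.1, p.2))).
  apply: eq_integral => w _; rewrite (integral_random_measure N x0); last 2 first.
  - exact: (predictable_function_section x0 w (predictable_function_stop k mW)).
  - by move=> p; rewrite indM_ge0.
  rewrite [RHS](nneseries_split 0%N k.+1)//; last first.
    by move=> *; rewrite indM_ge0// indM_ge0.
  rewrite [X in _ = _ + X]eseries0 ?adde0; last first.
    move=> n kn _ /=; rewrite add0n in kn.
    case: (ltP (T n w) +oo) => fin; last by rewrite mul0e.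
    by rewrite -event_time_fin// event_time_le_arrival// leqNgt kn mul0e mule0.
  rewrite add0n; apply: eq_big_nat => n /andP[_]; rewrite ltnS => nk.
  case: (ltP (T n w) +oo) => fin; last by rewrite !mul0e.
  by rewrite /= -event_time_fin// event_time_le_arrival// nk !mul1e.
rewrite E; apply: eq_integral => w _.
rewrite (@integral_ind _ _ (measurableTypeR R) _ _ (fun t : R => 0 <= t)%R); last first.
  by move=> t; rewrite /= in_itv/= andbT.
apply: eq_integral => t _; apply: integral_hawkes_kernel_stop => //.
exact: (measurableT_comp (predictable_function_section x0 w mW) (pair1_measurable t)).
Qed.

End compensation.

(** * Marginals of the excitation kernel *)

Section mean_kernel.
Context (R : realType) dX (X : measurableType dX).
Variables (f : R * X -> {nonneg R}) (Q : probability X R).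
Hypothesis f_meas : measurable_fun ((`[0, +oo[ : set R) `*` [set: X])
  (fun p => (f p)%:num).
Hypothesis f_bounded : exists M : R, forall t x, 0 <= t -> (f (t, x))%:num <= M.
Local Open Scope ereal_scope.
Local Notation mu := (@lebesgue_measure R).

(** The kernel F, extended by zero to nonpositive times and with extended real values: convolutions
    and translations then become integrals over the whole line. *)
Definition mean_causal (t : R) : \bar R := \int[Q]_x causal f (t, x).

Definition mass (x : X) : \bar R := \int[mu]_t causal f (t, x).

(** The excitation that an event with mark [x] still has to produce once a time [r] has passed since
    it occurred. *)
Definition tail_mass (r : R) (x : X) : \bar R :=
  \int[mu]_s (ind (r < s)%R * causal f (s, x)).

Lemma mean_causal_ge0 t : 0 <= mean_causal t.
Proof. by apply: integral_ge0 => x _; exact: causal_ge0. Qed.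

Lemma mass_ge0 x : 0 <= mass x.
Proof. by apply: integral_ge0 => t _; exact: causal_ge0. Qed.

Lemma tail_mass_ge0 r x : 0 <= tail_mass r x.
Proof. by apply: integral_ge0 => t _; rewrite indM_ge0 ?causal_ge0. Qed.

Lemma measurable_mean_causal : measurable_fun [set: R] mean_causal.
Proof.
apply: (measurable_fun_fubini_tonelli_F (m2 := Q) (causal f)).
- exact: measurable_causal.
- exact: causal_ge0.
Qed.

Lemma measurable_mass : measurable_fun [set: X] mass.
Proof.
apply: (measurable_fun_fubini_tonelli_G (m1 := mu) (causal f)).
- exact: measurable_causal.
- exact: causal_ge0.
Qed.

Lemma measurable_tail_mass :
  measurable_fun [set: R * X] (fun p => tail_mass p.1 p.2).
Proof.
apply: (measurable_fun_fubini_tonelli_F (m2 := mu)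
  (fun p : (R * X) * R => ind (p.1.1 < p.2)%R * causal f (p.2, p.1.2))).
- apply: emeasurable_funM.
    apply: measurable_ind; apply: measurable_fun_ltr => //.
    exact: (measurableT_comp measurable_fst measurable_fst).
  apply: (measurableT_comp (measurable_causal f_meas)).
  apply: measurable_fun_pair => //.
  exact: (measurableT_comp measurable_snd measurable_fst).
- by move=> p; rewrite indM_ge0 ?causal_ge0.
Qed.

Lemma integral_mass : \int[Q]_x mass x = \int[mu]_t mean_causal t.
Proof.
rewrite -(fubini_tonelli (m1 := mu) (m2 := Q) (causal f))//.
- exact: measurable_causal.
- exact: causal_ge0.
Qed.

Lemma integral_tail_mass r :
  \int[Q]_x tail_mass r x = \int[mu]_s (ind (r < s)%R * mean_causal s).
Proof.
rewrite -(fubini_tonelli (m1 := mu) (m2 := Q) (fun p => ind (r < p.1)%R * causal f p))/=.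
- apply: eq_integral => s _; rewrite /fubini_F/= ge0_integralZl//.
  + exact: (measurableT_comp (measurable_causal f_meas) (pair1_measurable s)).
  + by move=> x _; exact: causal_ge0.
  + exact: ind_ge0.
- apply: emeasurable_funM; last exact: measurable_causal.
  by apply: measurable_ind; apply: measurable_fun_ltr.
- by move=> p; rewrite indM_ge0 ?causal_ge0.
Qed.

Lemma mean_causal_le0 t : (t <= 0)%R -> mean_causal t = 0.
Proof.
move=> t0; rewrite /mean_causal integral0_eq// => x _.
by rewrite /causal/= ltNge t0 mul0e.
Qed.

(** Boundedness of [f] makes the integral finite, so the [fine] hidden in the real-valued integral
    loses nothing. *)
Lemma mean_causalE t : (0 < t)%R -> mean_causal t = (mean_kernel f Q t)%:E.
Proof.
move=> t0; rewrite /mean_kernel /Rintegral /mean_causal.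
have -> : \int[Q]_x causal f (t, x) = \int[Q]_x ((f (t, x))%:num)%:E.
  by apply: eq_integral => x _; rewrite /causal/= t0 mul1e.
have [M fM] := f_bounded.
rewrite fineK// ge0_fin_numE ?integral_ge0//.
apply: (@le_lt_trans _ _ (\int[Q]_x (Num.max M 0%R)%:E)).
  apply: ge0_le_integral => //.
  - have := measurableT_comp (measurable_causal f_meas) (pair1_measurable t).
    apply: eq_measurable_fun => x _ /=.
    by rewrite /causal/= t0 mul1e.
  - by move=> x _; rewrite lee_fin le_max fM// ltW.
rewrite integral_cst// [X in _ * X](_ : _ = 1) ?mule1 ?ltry//.
exact: probability_setT.
Qed.

Lemma mean_kernel_ge0 t : (0 <= mean_kernel f Q t)%R.
Proof. by rewrite fine_ge0// integral_ge0// => x _; rewrite lee_fin. Qed.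

Lemma measurable_mean_kernel :
  measurable_fun (`]0%R, +oo[ : set R) (mean_kernel f Q).
Proof.
apply/measurable_EFinP; apply: (eq_measurable_fun mean_causal).
  by move=> t /set_mem; rewrite /= in_itv/= andbT => t0; rewrite mean_causalE.
exact: (measurable_funTS measurable_mean_causal).
Qed.

Lemma integral_mean_kernel (h : R -> R) : measurable_fun [set: R] h ->
  \int[mu]_(t in `[0%R, +oo[) (h t * mean_kernel f Q t)%:E =
  \int[mu]_t ((h t)%:E * mean_causal t).
Proof.
move=> mh; rewrite -integral_itv_obnd_cbnd; last first.
  apply/measurable_EFinP/measurable_funM; last exact: measurable_mean_kernel.
  exact: measurable_funTS.
rewrite integral_mkcond; apply: eq_integral => t _; rewrite patchE.
have [t0|t0] := ltP 0%R t.
  by rewrite mem_set/= ?in_itv/= ?t0// EFinM mean_causalE.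
rewrite mean_causal_le0// mule0 memNset//= in_itv/= andbT.
by apply/negP; rewrite -leNgt.
Qed.

Lemma L1norm_mean_kernel : L1norm (mean_kernel f Q) = \int[mu]_t mean_causal t.
Proof.
transitivity (\int[mu]_t ((1%R : R)%:E * mean_causal t)); last first.
  by apply: eq_integral => t _; rewrite mul1e.
rewrite -(integral_mean_kernel (h := cst 1%R))//.
apply: eq_integral => t _; rewrite mul1r gee0_abs// lee_fin.
exact: mean_kernel_ge0.
Qed.

(** By Tonelli: for fixed [s], the times [u] in ]0, t] with t - u < s lie in ]t - s, t], of length
    [s]. Thus the first moment of F bounds the accumulated tails uniformly in [t]. *)
Lemma integral_tail_mean (t : R) : (0 <= t)%R ->
  \int[mu]_u (ind (0 < u <= t)%R * \int[Q]_x tail_mass (t - u)%R x) <=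
  \int[mu]_s (s%:E * mean_causal s).
Proof.
move=> t0.
pose h (p : R * R) := ind (0 < p.1 <= t)%R * ind (t - p.1 < p.2)%R * mean_causal p.2.
have mh : measurable_fun [set: R * R] h.
  apply: emeasurable_funM; last exact: measurableT_comp measurable_mean_causal measurable_snd.
  apply: emeasurable_funM; apply: measurable_ind.
    by apply: measurable_and; [apply: measurable_fun_ltr|apply: measurable_fun_ler].
  by apply: measurable_fun_ltr => //; exact: measurable_funB.
have h0 p : 0 <= h p by rewrite mule_ge0 ?mean_causal_ge0 ?mule_ge0 ?ind_ge0.
have -> : \int[mu]_u (ind (0 < u <= t)%R * \int[Q]_x tail_mass (t - u)%R x) =
    \int[mu]_u \int[mu]_s h (u, s).
  apply: eq_integral => u _; rewrite integral_tail_mass -ge0_integralZl//.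
  - by apply: eq_integral => s _; rewrite muleA.
  - apply: emeasurable_funM; last exact: measurable_mean_causal.
    by apply: measurable_ind; exact: measurable_fun_ltr.
  - by move=> s _; rewrite indM_ge0 ?mean_causal_ge0.
  - exact: ind_ge0.
rewrite (fubini_tonelli (m1 := mu) (m2 := mu) h mh h0); apply: ge0_le_integral => //.
- by move=> s _; exact: integral_ge0.
- exact: (measurable_fun_fubini_tonelli_G (m1 := mu) h mh h0).
- by apply: emeasurable_funM; [apply/measurable_EFinP|exact: measurable_mean_causal].
move=> s _; rewrite /fubini_G/h/=.
have [s0|s0] := leP s 0%R.
  by rewrite mean_causal_le0// mule0 integral0_eq// => u _; rewrite mule0.
rewrite ge0_integralZr//; first last.
- exact: mean_causal_ge0.
- by move=> u _; rewrite mule_ge0 ?ind_ge0.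
- apply: emeasurable_funM; apply: measurable_ind.
    by apply: measurable_and; [apply: measurable_fun_ltr|apply: measurable_fun_ler].
  by apply: measurable_fun_ltr => //; exact: measurable_funB.
apply: lee_wpmul2r; first exact: mean_causal_ge0.
apply: (@le_trans _ _ (\int[mu]_u ind (u \in `](t - s)%R, t]))).
  apply: ge0_le_integral => //.
  - by move=> u _; rewrite mule_ge0 ?ind_ge0.
  - apply: emeasurable_funM; apply: measurable_ind.
      by apply: measurable_and; [apply: measurable_fun_ltr|apply: measurable_fun_ler].
    by apply: measurable_fun_ltr => //; exact: measurable_funB.
  - apply: measurable_ind; rewrite (_ : (fun u => _) = (fun u => (t - s < u)%R && (u <= t)%R)).
      by apply: measurable_and; [apply: measurable_fun_ltr|apply: measurable_fun_ler].
    by apply/funext => u; rewrite in_itv.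
  - move=> u _; rewrite -ind_and in_itv/=; apply: le_ind; apply/implyP.
    by move=> /andP[/andP[_ ->]]; rewrite andbT; rewrite ltrBlDr ltrBlDl.
rewrite integral_ind_measure/=.
  rewrite lebesgue_measure_itv/= lte_fin; case: ifP => _.
    by rewrite -EFinD lee_fin opprB addrC subrK.
  by rewrite lee_fin ltW.
rewrite (_ : (fun u => _) = (fun u => (t - s < u)%R && (u <= t)%R)).
  by apply: measurable_and; [apply: measurable_fun_ltr|apply: measurable_fun_ler].
by apply/funext => u; rewrite in_itv.
Qed.

End mean_kernel.

(** * Uniform bound on the mean intensity *)

Section moments.
Context (R : realType) dO (Omega : measurableType dO) (P : probability Omega R)
  dX (X : measurableType dX).
Variables (N : marked_point_process R Omega X) (x0 : X).
Variables (m : {nonneg R}) (f : R * X -> {nonneg R}) (Q : probability X R).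
Hypothesis f_meas : measurable_fun ((`[0, +oo[ : set R) `*` [set: X])
  (fun p => (f p)%:num).
Hypothesis f_bounded : exists M : R, forall t x, 0 <= t -> (f (t, x))%:num <= M.
Hypothesis N_hawkes : marked_hawkes N m f Q P.
Variable q : R.
Hypothesis q_lt1 : q < 1.
Hypothesis qE : (\int[lebesgue_measure]_t mean_causal f Q t = q%:E)%E.
Local Open Scope ereal_scope.
Local Notation mu := (@lebesgue_measure R).
Local Notation T := (event_time N).
Local Notation arrival := (arrival N).
Local Notation mark := (mark N x0).
Local Notation ell := (stopped_intensity N m f).
Local Notation F := (mean_causal f Q).

(** The fixed point of b = m + q b; it is also the limiting number of events per unit of time. *)
Definition rate : R := (m%:num / (1 - q))%R.

Lemma rate_ge0 : (0 <= rate)%R.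
Proof. by rewrite divr_ge0// subr_ge0 ltW. Qed.

(** A function vanishing at nonpositive times factors through the positive part of time, which is
    predictable. *)
Lemma predictable_deterministic (H : R * X -> \bar R) :
  measurable_fun [set: R * X] H ->
  (forall u x, (u <= 0)%R -> H (u, x) = 0) ->
  predictable_function N (fun p => H (p.1.2, p.2)).
Proof.
move=> mH H0; have h : measurable_fun [set: g_sigma_algebraType (predictable_rect N) * X]
    (fun p => (Num.max p.1.2 0%R, p.2)).
  apply: measurable_fun_pair; last exact: measurable_snd.
  exact: (measurableT_comp (@predictable_time _ _ _ _ _ N) measurable_fst).
have -> : (fun p : Omega * R * X => H (p.1.2, p.2)) =
    (fun p => H (Num.max p.1.2 0%R, p.2)).
  by apply/funext => p; case: (leP p.1.2 0%R) => // u0; rewrite !H0.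
exact: (measurableT_comp mH h).
Qed.

Lemma measurable_ell k :
  measurable_fun [set: Omega * R] (fun p => ell k p.1 p.2).
Proof. exact: measurable_stopped_intensity. Qed.

Lemma ell_ge0 k w s : 0 <= ell k w s.
Proof. exact: stopped_intensity_ge0. Qed.

Lemma measurable_ell1 k w : measurable_fun [set: R] (ell k w).
Proof. exact: (measurableT_comp (measurable_ell k) (pair1_measurable w)). Qed.

Lemma measurable_ell2 k s : measurable_fun [set: Omega] (ell k ^~ s).
Proof. exact: (measurableT_comp (measurable_ell k) (pair2_measurable s)). Qed.

Definition mean_ell k s := \int[P]_w ell k w s.

Lemma mean_ell_ge0 k s : 0 <= mean_ell k s.
Proof. by apply: integral_ge0 => w _; exact: ell_ge0. Qed.

Lemma measurable_mean_ell k : measurable_fun [set: R] (mean_ell k).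
Proof.
apply: (measurable_fun_fubini_tonelli_G (m1 := P) (fun p => ell k p.1 p.2)).
- exact: measurable_ell.
- by move=> p; exact: ell_ge0.
Qed.

Lemma tonelli_ell k (h : R -> \bar R) : measurable_fun [set: R] h ->
  (forall s, 0 <= h s) ->
  \int[P]_w \int[mu]_s (ell k w s * h s) = \int[mu]_s (mean_ell k s * h s).
Proof.
move=> mh h0.
rewrite (fubini_tonelli (m1 := P) (m2 := mu) (fun p => ell k p.1 p.2 * h p.2)).
- apply: eq_integral => s _ /=; rewrite ge0_integralZr//.
  + exact: measurable_ell2.
  + by move=> w _; exact: ell_ge0.
- apply: emeasurable_funM; first exact: measurable_ell.
  exact: (measurableT_comp mh measurable_snd).
- by move=> p; rewrite mule_ge0 ?ell_ge0.
Qed.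

(** An integrand that does not depend on the path sees the intensity only through its mean. *)
Lemma deterministic_compensation k (H : R * X -> \bar R) :
  measurable_fun [set: R * X] H -> (forall p, 0 <= H p) ->
  (forall u x, (u <= 0)%R -> H (u, x) = 0) ->
  \int[P]_w (\sum_(0 <= n < k.+1)
     ind (T n w < +oo) * H (arrival n w, mark n w)) =
  \int[mu]_s (mean_ell k s * \int[Q]_x H (s, x)).
Proof.
move=> mH H0 Hle0.
rewrite (stopped_compensation x0 f_meas f_bounded N_hawkes k
  (predictable_deterministic mH Hle0))//=.
rewrite tonelli_ell//; last by move=> s; exact: integral_ge0.
exact: (measurable_fun_fubini_tonelli_F (m2 := Q)).
Qed.

(** Dropping the stopping indicator on the right leaves, for fixed [s], a sum over events with a
    deterministic integrand, to which compensation applies. *)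
Lemma ell_le_sum k w s : ell k w s <= m%:num%:E + \sum_(0 <= n < k.+1)
  ind (T n w < +oo) * (ind (0 < arrival n w < s)%R *
     causal f (s - arrival n w, mark n w)%R).
Proof.
have sum0 : 0 <= \sum_(0 <= n < k.+1)
  ind (T n w < +oo) * (ind (0 < arrival n w < s)%R *
     causal f (s - arrival n w, mark n w)%R).
  by apply: sume_ge0 => n _; rewrite !indM_ge0 ?causal_ge0.
rewrite /stopped_intensity; case: (lerP 0%R s) => s0 /=; last first.
  by rewrite mul0e adde_ge0.
case: (leP s%:E (T k w)) => sk /=; last by rewrite mul0e adde_ge0.
rewrite mul1e (hawkes_intensity_stopE x0 _ _ sk)//; apply: leeD => //.
apply: lee_sum => n _; rewrite event_time_ltE.
case: (ltP (T n w) +oo) => fin /=; last by rewrite !mul0e.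
by rewrite mul1e (arrival_gt0 fin).
Qed.

(* The expected intensity satisfies a renewal inequality with kernel [F]; being
   bounded, it stays below the fixed point of that inequality. *)
Lemma renewal_step k (B : R) : (forall s, mean_ell k s <= B%:E) ->
  forall s, mean_ell k s <= (m%:num + q * B)%:E.
Proof.
move=> bB s.
pose H (p : R * X) := ind (0 < p.1 < s)%R * causal f (s - p.1, p.2)%R.
have mH : measurable_fun [set: R * X] H.
  apply: emeasurable_funM.
    by apply: measurable_ind; apply: measurable_and; apply: measurable_fun_ltr.
  apply: (measurableT_comp (measurable_causal f_meas)).
  by apply: measurable_fun_pair => //; exact: measurable_funB.
have H0 p : 0 <= H p by rewrite indM_ge0 ?causal_ge0.
have mterm n : measurable_fun [set: Omega]
    (fun w => ind (T n w < +oo) * H (arrival n w, mark n w)).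
  apply: emeasurable_funM.
    by apply: measurable_ind; apply: measurable_fun_lte.
  apply: (measurableT_comp mH); apply: measurable_fun_pair; last exact: measurable_mark.
  exact: measurable_arrival.
have mF : measurable_fun [set: R] (fun u => F (s - u)%R).
  apply: (measurableT_comp (measurable_mean_causal Q f_meas)).
  exact: measurable_funB.
have mb := measurable_mean_ell k.
apply: (@le_trans _ _ (\int[P]_w (m%:num%:E + \sum_(0 <= n < k.+1)
    ind (T n w < +oo) * H (arrival n w, mark n w)))).
  apply: ge0_le_integral => //.
  - by move=> w _; exact: ell_ge0.
  - exact: measurable_ell2.
  - by apply: emeasurable_funD => //; exact: emeasurable_sum.
  - by move=> w _; exact: ell_le_sum.
rewrite ge0_integralD//; first last.
- exact: emeasurable_sum.
- by move=> w _; apply: sume_ge0 => n _; rewrite indM_ge0.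
rewrite integral_cst// [X in _ * X](_ : _ = 1) ?mule1; last exact: probability_setT.
rewrite EFinD; apply: leeD => //.
rewrite deterministic_compensation//; last first.
  by move=> u x u0; rewrite /H/= ltNge u0 mul0e.
apply: (@le_trans _ _ (\int[mu]_u (B%:E * F (s - u)%R))).
  apply: ge0_le_integral => //.
  - by move=> u _; rewrite mule_ge0 ?mean_ell_ge0 ?integral_ge0.
  - apply: emeasurable_funM => //.
    exact: (measurable_fun_fubini_tonelli_F (m2 := Q)).
  - exact: emeasurable_funM.
  - move=> u _; apply: lee_pmul => //; rewrite ?mean_ell_ge0 ?integral_ge0//.
    rewrite /H/= ge0_integralZl//.
    + by rewrite -[leRHS]mul1e lee_wpmul2r ?ind_le1// mean_causal_ge0.
    + exact: (measurableT_comp (measurable_causal f_meas) (pair1_measurable _)).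
    + by move=> x _; exact: causal_ge0.
    + exact: ind_ge0.
have B0 : (0 <= B)%R by rewrite -lee_fin (le_trans (mean_ell_ge0 k 0%R)).
rewrite ge0_integralZl//; last by move=> u _; exact: mean_causal_ge0.
rewrite (ge0_integral_reflect s (measurable_mean_causal Q f_meas)); last first.
  by move=> u; exact: mean_causal_ge0.
by rewrite qE -EFinM mulrC.
Qed.

(** The supremum S of the mean intensity satisfies S <= m + q S. The a priori bound, which depends
    on [k], only ensures that S is finite; the resulting bound does not depend on [k]. *)
Lemma mean_ell_le k s : mean_ell k s <= rate%:E.
Proof.
have [B [B0 lB]] := stopped_intensity_bound N x0 m f_meas f_bounded k.
have bB u : mean_ell k u <= B%:E.
  apply: (@le_trans _ _ (\int[P]_w B%:E)).
    apply: ge0_le_integral => //.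
    - by move=> w _; exact: ell_ge0.
    - exact: measurable_ell2.
  by rewrite integral_cst// [X in _ * X](_ : _ = 1) ?mule1//; exact: probability_setT.
have fin u : mean_ell k u \is a fin_num.
  by rewrite ge0_fin_numE ?mean_ell_ge0// (le_lt_trans (bB u))// ltry.
pose E := [set fine (mean_ell k u) | u in [set: R]].
have ubE : has_sup E.
  split; first by exists (fine (mean_ell k 0%R)), 0%R.
  by exists B => _ [u _ <-]; rewrite -lee_fin fineK.
have bS u : mean_ell k u <= (sup E)%:E.
  by rewrite -(fineK (fin u)) lee_fin; apply: sup_upper_bound => //; exists u.
have supE : (sup E <= m%:num + q * sup E)%R.
  apply: ge_sup; first by case: ubE.
  by move=> _ [u _ <-]; rewrite -lee_fin fineK//; exact: renewal_step.
apply: (le_trans (bS s)); rewrite lee_fin /rate ler_pdivlMr ?subr_gt0//.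
by rewrite mulrBr mulr1 lerBlDr mulrC.
Qed.

End moments.

(** * Stopped sums over events and the balance equation *)

Section stopped_sums.
Context (R : realType) dO (Omega : measurableType dO) (P : probability Omega R)
  dX (X : measurableType dX).
Variables (N : marked_point_process R Omega X) (x0 : X).
Variables (m : {nonneg R}) (f : R * X -> {nonneg R}) (Q : probability X R).
Hypothesis f_meas : measurable_fun ((`[0, +oo[ : set R) `*` [set: X])
  (fun p => (f p)%:num).
Hypothesis f_bounded : exists M : R, forall t x, 0 <= t -> (f (t, x))%:num <= M.
Hypothesis N_hawkes : marked_hawkes N m f Q P.
Variable q : R.
Hypothesis q_lt1 : q < 1.
Hypothesis qE : (\int[lebesgue_measure]_t mean_causal f Q t = q%:E)%E.
Local Open Scope ereal_scope.
Local Notation mu := (@lebesgue_measure R).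
Local Notation T := (event_time N).
Local Notation arrival := (arrival N).
Local Notation mark := (mark N x0).
Local Notation ell := (stopped_intensity N m f).
Local Notation F := (mean_causal f Q).

Local Notation rate := (rate m q).
Local Notation mean_ell := (mean_ell P N m f).

Definition mark_sum k t (h : X -> \bar R) w : \bar R :=
  \sum_(0 <= n < k.+1) ind (T n w <= t%:E) * h (mark n w).

(** The excitation that the events up to time [t] will produce after [t]. *)
Definition tail_sum k t w : \bar R := \sum_(0 <= n < k.+1)
  ind (T n w <= t%:E) * tail_mass f (t - arrival n w) (mark n w).

(** The stopped compensator Lam of the total count. For events with marks in [A] the factor [Q A] is
    put in front. *)
Definition compensator k t w : \bar R :=
  \int[mu]_s (ell k w s * ind (0 < s <= t)%R).

Lemma measurable_ind_oc (t : R) :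
  measurable_fun [set: R] (fun s : R => ind (0 < s <= t)%R : \bar R).
Proof.
apply: measurable_ind; apply: measurable_and; first exact: measurable_fun_ltr.
exact: measurable_fun_ler.
Qed.

Lemma integral_ind_oc (t : R) : (0 <= t)%R -> \int[mu]_s ind (0 < s <= t)%R = t%:E.
Proof.
move=> t0; rewrite integral_ind_measure; last first.
  apply: measurable_and; [exact: measurable_fun_ltr|exact: measurable_fun_ler].
have -> : [set s : R | (0 < s <= t)%R] = `]0%R, t]%classic.
  by apply/seteqP; split=> s; rewrite /= in_itv.
rewrite /= lebesgue_measure_itv/= lte_fin; case: ltP => [_|t0']; first by rewrite sube0.
by congr EFin; apply/eqP; rewrite eq_le t0 t0'.
Qed.

Lemma mark_sum_ge0 k t h w : (forall x, 0 <= h x) -> 0 <= mark_sum k t h w.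
Proof. by move=> h0; apply: sume_ge0 => n _; rewrite indM_ge0. Qed.

Lemma tail_sum_ge0 k t w : 0 <= tail_sum k t w.
Proof. by apply: sume_ge0 => n _; rewrite indM_ge0 ?tail_mass_ge0. Qed.

Lemma compensator_ge0 k t w : 0 <= compensator k t w.
Proof.
by apply: integral_ge0 => s _; rewrite mule_ge0 ?stopped_intensity_ge0 ?ind_ge0.
Qed.

Lemma measurable_ind_event n t :
  measurable_fun [set: Omega] (fun w => ind (T n w <= t%:E) : \bar R).
Proof. by apply: measurable_ind; apply: measurable_fun_lee. Qed.

Lemma measurable_mark_sum k t h : measurable_fun [set: X] h ->
  measurable_fun [set: Omega] (mark_sum k t h).
Proof.
move=> mh; apply: emeasurable_sum => n; apply: emeasurable_funM.
  exact: measurable_ind_event.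
exact: measurableT_comp mh (measurable_mark N x0 n).
Qed.

Lemma measurable_tail_sum k t : measurable_fun [set: Omega] (tail_sum k t).
Proof.
apply: emeasurable_sum => n; apply: emeasurable_funM.
  exact: measurable_ind_event.
have h : measurable_fun [set: Omega] (fun w => ((t - arrival n w)%R, mark n w)).
  apply: measurable_fun_pair; last exact: measurable_mark.
  by apply: measurable_funB => //; exact: measurable_arrival.
exact: (measurableT_comp (measurable_tail_mass f_meas) h).
Qed.

Lemma measurable_compensator2 k :
  measurable_fun [set: Omega * R] (fun p => compensator k p.2 p.1).
Proof.
apply: (measurable_fun_fubini_tonelli_F (m2 := mu)
  (fun p : Omega * R * R => ell k p.1.1 p.2 * ind (0 < p.2 <= p.1.2)%R)).
- apply: emeasurable_funM.
    have h : measurable_fun [set: Omega * R * R] (fun p => (p.1.1, p.2)).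
      apply: measurable_fun_pair => //.
      exact: (measurableT_comp measurable_fst measurable_fst).
    exact: (measurableT_comp (measurable_ell N x0 m f_meas k) h).
  apply: measurable_ind; apply: measurable_and; first exact: measurable_fun_ltr.
  apply: measurable_fun_ler => //.
  exact: (measurableT_comp measurable_snd measurable_fst).
- by move=> p; rewrite mule_ge0 ?stopped_intensity_ge0 ?ind_ge0.
Qed.

Lemma measurable_compensator k t : measurable_fun [set: Omega] (compensator k t).
Proof. exact: (measurableT_comp (measurable_compensator2 k) (pair2_measurable t)). Qed.

Lemma compensator_bound k t : (0 <= t)%R -> exists B : R,
  (0 <= B)%R /\ forall w, compensator k t w <= B%:E.
Proof.
move=> t0.
have [B [B0 lB]] := stopped_intensity_bound N x0 m f_meas f_bounded k.
exists (B * t)%R; split; first exact: mulr_ge0.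
move=> w; rewrite EFinM -(integral_ind_oc t0) -ge0_integralZl//; last 2 first.
- exact: measurable_ind_oc.
- by move=> s _; exact: ind_ge0.
apply: ge0_le_integral => //.
- by move=> s _; rewrite mule_ge0 ?stopped_intensity_ge0 ?ind_ge0.
- apply: emeasurable_funM; last exact: measurable_ind_oc.
  exact: (measurable_ell1 N x0).
- by apply: emeasurable_funM => //; exact: measurable_ind_oc.
- by move=> s _; rewrite lee_wpmul2r ?ind_ge0.
Qed.

Lemma expectation_compensator k t :
  \int[P]_w compensator k t w = \int[mu]_s (mean_ell k s * ind (0 < s <= t)%R).
Proof.
rewrite (tonelli_ell P N x0 m f_meas)//; first exact: measurable_ind_oc.
by move=> s; exact: ind_ge0.
Qed.

Lemma expectation_compensator_le k t : (0 <= t)%R ->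
  \int[P]_w compensator k t w <= (rate * t)%:E.
Proof.
move=> t0; rewrite expectation_compensator EFinM -(integral_ind_oc t0).
rewrite -ge0_integralZl//; last 3 first.
- exact: measurable_ind_oc.
- by move=> s _; exact: ind_ge0.
- by rewrite lee_fin (rate_ge0 m q_lt1).
apply: ge0_le_integral => //.
- by move=> s _; rewrite mule_ge0 ?mean_ell_ge0 ?ind_ge0.
- apply: emeasurable_funM; last exact: measurable_ind_oc.
  exact: (measurable_mean_ell P N x0 m f_meas).
- by apply: emeasurable_funM => //; exact: measurable_ind_oc.
- move=> s _; rewrite lee_wpmul2r ?ind_ge0//.
  exact: (mean_ell_le x0 f_meas f_bounded N_hawkes q_lt1 qE).
Qed.

Lemma ind_event_leE n t w : ind (T n w <= t%:E) =
  ind (T n w < +oo) * ind (0 < arrival n w <= t)%R :> \bar R.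
Proof.
rewrite event_time_leE ind_and.
case: (ltP (T n w) +oo) => fin; last by rewrite !mul0e.
by rewrite (arrival_gt0 fin).
Qed.

(** The kernel is the product of the intensity and [Q], so the integral of [h] over the marks
    separates from the time integral. *)
Lemma expectation_mark_sum k t h : measurable_fun [set: X] h ->
  (forall x, 0 <= h x) ->
  \int[P]_w mark_sum k t h w = (\int[Q]_x h x) * \int[P]_w compensator k t w.
Proof.
move=> mh h0; pose H (p : R * X) := ind (0 < p.1 <= t)%R * h p.2.
have mH : measurable_fun [set: R * X] H.
  apply: emeasurable_funM.
    exact: (measurableT_comp (measurable_ind_oc t) measurable_fst).
  exact: (measurableT_comp mh measurable_snd).
have H0 p : 0 <= H p by rewrite indM_ge0.
have := deterministic_compensation x0 f_meas f_bounded N_hawkes k mH H0.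
rewrite expectation_compensator => E.
rewrite -ge0_integralZl//; last 3 first.
- apply: emeasurable_funM; last exact: measurable_ind_oc.
  exact: (measurable_mean_ell P N x0 m f_meas).
- by move=> s _; rewrite mule_ge0 ?mean_ell_ge0 ?ind_ge0.
- exact: integral_ge0.
transitivity (\int[mu]_s (mean_ell k s * \int[Q]_x H (s, x))).
  rewrite -E; last by move=> u x u0; rewrite /H/= ltNge u0 mul0e.
  apply: eq_integral => w _; apply: eq_bigr => n _.
  by rewrite ind_event_leE /H/= muleA.
apply: eq_integral => s _; rewrite /H/= ge0_integralZl ?ind_ge0//.
by rewrite muleA muleC.
Qed.

(** Compensation, the uniform bound on the mean intensity, then [integral_tail_mean]: the result
    depends neither on [t] nor on [k]. *)
Lemma expectation_tail_sum k t : (0 <= t)%R ->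
  \int[P]_w tail_sum k t w <= rate%:E * \int[mu]_s (s%:E * F s).
Proof.
move=> t0.
pose H (p : R * X) := ind (0 < p.1 <= t)%R * tail_mass f (t - p.1) p.2.
have mt : measurable_fun [set: R * X] (fun p => tail_mass f (t - p.1) p.2).
  have h : measurable_fun [set: R * X] (fun p => ((t - p.1)%R, p.2)).
    by apply: measurable_fun_pair => //; exact: measurable_funB.
  exact: (measurableT_comp (measurable_tail_mass f_meas) h).
have mH : measurable_fun [set: R * X] H.
  apply: emeasurable_funM => //.
  exact: (measurableT_comp (measurable_ind_oc t) measurable_fst).
have H0 p : 0 <= H p by rewrite indM_ge0 ?tail_mass_ge0.
have := deterministic_compensation x0 f_meas f_bounded N_hawkes k mH H0 => E.
have -> : \int[P]_w tail_sum k t w = \int[mu]_s (mean_ell k s * \int[Q]_x H (s, x)).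
  rewrite -E; last by move=> u x u0; rewrite /H/= ltNge u0 mul0e.
  apply: eq_integral => w _; apply: eq_bigr => n _.
  by rewrite ind_event_leE /H/= muleA.
have r0 : 0 <= rate%:E by rewrite lee_fin (rate_ge0 m q_lt1).
have mHs : measurable_fun [set: R] (fun s => \int[Q]_x H (s, x)).
  exact: (measurable_fun_fubini_tonelli_F (m2 := Q)).
apply: (@le_trans _ _ (\int[mu]_s (rate%:E * \int[Q]_x H (s, x)))).
  apply: ge0_le_integral => //.
  - by move=> s _; rewrite mule_ge0 ?mean_ell_ge0 ?integral_ge0.
  - apply: emeasurable_funM => //.
    exact: (measurable_mean_ell P N x0 m f_meas).
  - exact: emeasurable_funM.
  - move=> s _; rewrite lee_wpmul2r ?integral_ge0//.
    exact: (mean_ell_le x0 f_meas f_bounded N_hawkes q_lt1 qE).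
rewrite ge0_integralZl//; last by move=> s _; exact: integral_ge0.
apply: lee_wpmul2l => //.
apply: le_trans (integral_tail_mean Q f_meas t0).
rewrite le_eqVlt; apply/orP; left; apply/eqP; apply: eq_integral => s _.
rewrite /H/= ge0_integralZl ?ind_ge0//.
- exact: (measurableT_comp mt (pair1_measurable s)).
- by move=> x _; exact: tail_mass_ge0.
Qed.

(** Translating by the arrival time [a] cuts the total excitation of an event at the age t - a. *)
Lemma shifted_mass (a t : R) x : (0 < a)%R -> (a <= t)%R ->
  \int[mu]_s (ind (a < s <= t)%R * causal f (s - a, x)%R) +
    tail_mass f (t - a) x = mass f x.
Proof.
move=> a0 at_.
have mc : measurable_fun [set: R] (fun s => causal f (s, x)).
  exact: (measurableT_comp (measurable_causal f_meas) (pair2_measurable x)).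
have mi : measurable_fun [set: R] (fun s : R => ind (s <= t - a)%R * causal f (s, x)).
  by apply: emeasurable_funM => //; apply: measurable_ind; exact: measurable_fun_ler.
have -> : \int[mu]_s (ind (a < s <= t)%R * causal f (s - a, x)%R) =
    \int[mu]_s (ind (s <= t - a)%R * causal f (s, x)).
  rewrite -(ge0_integral_shift (- a) mi); last first.
    by move=> s; rewrite indM_ge0 ?causal_ge0.
  apply: eq_integral => s _; rewrite lerD2r /causal/= subr_gt0.
  by case: (ltP a s) => //=; rewrite ?mul0e ?mule0.
rewrite /tail_mass -ge0_integralD//.
- apply: eq_integral => s _; rewrite -ge0_muleDl ?ind_ge0//.
  by case: leP; rewrite /= ?add0e ?adde0 mul1e.
- by move=> s _; rewrite indM_ge0 ?causal_ge0.
- by move=> s _; rewrite indM_ge0 ?causal_ge0.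
- by apply: emeasurable_funM => //; apply: measurable_ind; exact: measurable_fun_ltr.
Qed.

(** When t < T_k the stopped intensity is the intensity itself on ]0, t], and each event by time [t]
    contributes its mass less its tail. The tails stand on the left because they may be infinite and
    cannot be subtracted. *)
Lemma compensator_balance k t w : (0 <= t)%R -> t%:E < T k w ->
  compensator k t w + tail_sum k t w =
  (m%:num * t)%:E + mark_sum k t (mass f) w.
Proof.
move=> t0 tk.
pose c n s : \bar R := ind (0 < s <= t)%R *
  (ind (T n w < s%:E) * causal f (s - arrival n w, mark n w)%R).
have mc n : measurable_fun [set: R] (c n).
  apply: emeasurable_funM; first exact: measurable_ind_oc.
  apply: emeasurable_funM; first by apply: measurable_ind; exact: measurable_fun_lte.
  apply: (measurableT_comp (measurable_causal f_meas)).
  by apply: measurable_fun_pair => //; exact: measurable_funB.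
have c0 n s : 0 <= c n s by rewrite !indM_ge0 ?causal_ge0.
have -> : compensator k t w =
    (m%:num * t)%:E + \sum_(0 <= n < k.+1) \int[mu]_s c n s.
  rewrite EFinM -(integral_ind_oc t0) -ge0_integralZl//; last 2 first.
  - exact: measurable_ind_oc.
  - by move=> s _; exact: ind_ge0.
  rewrite -ge0_integral_sum// -ge0_integralD//.
  - apply: eq_integral => s _; rewrite /stopped_intensity.
    rewrite -ge0_sume_distrr; last first.
      by move=> n _; rewrite !indM_ge0 ?causal_ge0.
    rewrite (muleC m%:num%:E) -ge0_muleDr ?lee_fin//; last first.
      by apply: sume_ge0 => n _; rewrite indM_ge0 ?causal_ge0.
    case: (boolP (0 < s <= t)%R) => [/andP[s0 st]|_]; last by rewrite mule0 mul0e.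
    have sk : s%:E <= T k w by apply: ltW; apply: le_lt_trans tk; rewrite lee_fin.
    by rewrite ltW// sk mul1e mule1 mul1e (hawkes_intensity_stopE x0 _ _ sk).
  - by move=> s _; rewrite mule_ge0 ?ind_ge0 ?lee_fin.
  - by apply: emeasurable_funM => //; exact: measurable_ind_oc.
  - by move=> s _; apply: sume_ge0.
  - exact: emeasurable_sum.
rewrite -addeA; congr (_ + _); rewrite -big_split/=; apply: eq_bigr => n _.
rewrite ind_event_leE.
case: (ltP (T n w) +oo) => fin; last first.
  rewrite !mul0e adde0 integral0_eq// => s _.
  by rewrite /c event_time_ltE (ltNge (T n w)) fin/= mul0e mule0.
rewrite !mul1e; have a0 := arrival_gt0 fin; rewrite a0/=.
case: (lerP (arrival n w) t) => at_; last first.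
  rewrite !mul0e adde0 integral0_eq// => s _.
  rewrite /c event_time_ltE fin/= muleA -ind_and [X in ind X](_ : _ = false) ?mul0e//.
  by apply/negbTE/negP => /andP[/andP[_ st]] /lt_le_trans/(_ st); rewrite ltNge (ltW at_).
rewrite !mul1e -(shifted_mass (mark n w) a0 at_); congr (_ + _).
apply: eq_integral => s _; rewrite /c event_time_ltE fin/= muleA -ind_and.
congr (ind _ * _); apply/idP/idP => [/andP[/andP[_ ->] ->]//|/andP[as_ ->]].
by rewrite as_ (lt_trans a0).
Qed.

End stopped_sums.

(** * Second moment of the compensated process *)

Section square_cancellation.
Context (R : realType) d (S : measurableType d) (P : probability S R).
Local Open Scope ereal_scope.

(** Expanding the square gives E(Y - L)^2 + 2 E(YL) = E Y^2 + E L^2 <= E Y + 2u + 2v = E Y + 2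
    E(YL). The bounds on [Y] and [L] make E(YL) finite, so it cancels. *)
Lemma expectation_square_sub (Y L : S -> \bar R) (b c : R) (u v : \bar R) :
  measurable_fun [set: S] Y -> measurable_fun [set: S] L ->
  (forall w, 0 <= Y w <= b%:E) -> (forall w, 0 <= L w <= c%:E) ->
  \int[P]_w (Y w * Y w) = \int[P]_w Y w + (u + u) ->
  \int[P]_w (Y w * L w) = v + u ->
  \int[P]_w (L w * L w) <= v + v ->
  \int[P]_w (((fine (Y w) - fine (L w)) ^+ 2)%R)%:E <= \int[P]_w Y w.
Proof.
move=> mY mL Yb Lc YY YL LL.
have Y0 w : 0 <= Y w by have /andP[] := Yb w.
have L0 w : 0 <= L w by have /andP[] := Lc w.
have YE w : Y w = (fine (Y w))%:E.
  rewrite fineK// ge0_fin_numE//; have /andP[_ ?] := Yb w.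
  exact: le_lt_trans (ltry b).
have LE w : L w = (fine (L w))%:E.
  rewrite fineK// ge0_fin_numE//; have /andP[_ ?] := Lc w.
  exact: le_lt_trans (ltry c).
have mfY : measurable_fun [set: S] (fine \o Y).
  by apply: (measurable_comp (F := setT)) => //; exact: fine_measurable.
have mfL : measurable_fun [set: S] (fine \o L).
  by apply: (measurable_comp (F := setT)) => //; exact: fine_measurable.
have mYL : measurable_fun [set: S] (fun w => Y w * L w) by exact: emeasurable_funM.
have YL0 w : 0 <= Y w * L w by exact: mule_ge0.
set I := \int[P]_w _.
have eqI : I + (\int[P]_w (Y w * L w) + \int[P]_w (Y w * L w)) =
    \int[P]_w (Y w * Y w) + \int[P]_w (L w * L w).
  rewrite /I -!ge0_integralD//.
  - apply: eq_integral => w _; rewrite (YE w) (LE w)/= -!EFinM -!EFinD.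
    by congr EFin; ring.
  - by move=> w _; exact: mule_ge0.
  - exact: emeasurable_funM.
  - by move=> w _; exact: mule_ge0.
  - exact: emeasurable_funM.
  - by move=> w _; rewrite lee_fin sqr_ge0.
  - apply/measurable_EFinP; apply: measurable_funX.
    by apply: measurable_funB.
  - by move=> w _; exact: adde_ge0.
  - exact: emeasurable_funD.
have finYL : \int[P]_w (Y w * L w) \is a fin_num.
  rewrite ge0_fin_numE ?integral_ge0//.
  apply: (@le_lt_trans _ _ (\int[P]_w (b * c)%:E)).
    apply: ge0_le_integral => // w _; rewrite EFinM.
    by have /andP[_ ?] := Yb w; have /andP[_ ?] := Lc w; exact: lee_pmul.
  rewrite integral_cst// [X in _ * X](_ : _ = 1) ?mule1 ?ltry//.
  exact: probability_setT.
have finYL2 : \int[P]_w (Y w * L w) + \int[P]_w (Y w * L w) \is a fin_num.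
  by rewrite fin_numD finYL.
rewrite -(leeD2rE _ _ finYL2) eqI YY YL -addeA.
apply: leeD => //.
have -> : v + u + (v + u) = u + u + (v + v) by rewrite addeACA addeC.
by rewrite (leeD (lexx _) LL).
Qed.

End square_cancellation.

Section second_moment.
Context (R : realType) dO (Omega : measurableType dO) (P : probability Omega R)
  dX (X : measurableType dX).
Variables (N : marked_point_process R Omega X) (x0 : X).
Variables (m : {nonneg R}) (f : R * X -> {nonneg R}) (Q : probability X R).
Hypothesis f_meas : measurable_fun ((`[0, +oo[ : set R) `*` [set: X])
  (fun p => (f p)%:num).
Hypothesis f_bounded : exists M : R, forall t x, 0 <= t -> (f (t, x))%:num <= M.
Hypothesis N_hawkes : marked_hawkes N m f Q P.
Variable q : R.
Hypothesis q_lt1 : q < 1.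
Hypothesis qE : (\int[lebesgue_measure]_t mean_causal f Q t = q%:E)%E.
Local Open Scope ereal_scope.
Local Notation mu := (@lebesgue_measure R).
Local Notation T := (event_time N).
Local Notation arrival := (arrival N).
Local Notation mark := (mark N x0).
Local Notation ell := (stopped_intensity N m f).

Local Notation rate := (rate m q).
Local Notation mark_sum := (mark_sum N x0).
Local Notation compensator := (compensator N m f).
Variable A : set X.
Hypothesis mA : measurable A.
Local Notation chi := (fun x : X => ind (x \in A) : \bar R).

Lemma measurable_chi : measurable_fun [set: X] chi.
Proof. by apply: measurable_ind; exact: measurable_mem_set. Qed.

Lemma integral_chi : \int[Q]_x chi x = Q A.
Proof.
rewrite integral_ind_measure; last exact: measurable_mem_set.
by congr (Q _); apply/seteqP; split => x /=; rewrite inE.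
Qed.

Lemma count_before_stop k s w : s%:E <= T k w ->
  count_before N s A w =
  \sum_(0 <= n < k.+1) ind (T n w < s%:E) * chi (mark n w).
Proof.
move=> sk; rewrite (count_beforeE N x0).
rewrite (nneseries_split 0%N k.+1)//; last by move=> *; rewrite indM_ge0 ?ind_ge0.
rewrite [X in _ + X]eseries0 ?adde0; last first.
  move=> n kn _; rewrite /ind ifF ?mul0e//; apply/negbTE; rewrite -leNgt.
  by apply: le_trans sk _; apply: event_time_le_of_le; exact: ltnW.
by rewrite add0n.
Qed.

Lemma count_before_arrival n w : T n w < +oo ->
  count_before N (arrival n w) A w = \sum_(0 <= j < n) chi (mark j w).
Proof.
move=> fin; rewrite (@count_before_stop n); last by rewrite -(event_time_fin fin).
rewrite -(event_time_fin fin) big_nat_recr//= ltxx mul0e adde0.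
apply: eq_big_nat => j /andP[_ jn].
rewrite event_time_lt_of_lt ?mul1e//.
by apply: le_lt_trans fin; exact/event_time_le_of_le/ltnW.
Qed.

(** Indicators are idempotent, so the diagonal gives back the sum; the rest is twice the sum over
    pairs j < n. *)
Lemma sqr_sum_ind K (b : nat -> bool) :
  (\sum_(0 <= n < K) ind (b n)) * (\sum_(0 <= n < K) ind (b n)) =
  \sum_(0 <= n < K) ind (b n) +
  (\sum_(0 <= n < K) (ind (b n) * \sum_(0 <= j < n) ind (b j)) +
   \sum_(0 <= n < K) (ind (b n) * \sum_(0 <= j < n) ind (b j))) :> \bar R.
Proof.
have indE c : ind c = (c%:R)%:E :> \bar R by case: c.
have sE L : \sum_(0 <= n < L) ind (b n) = (\sum_(0 <= n < L) (b n)%:R)%:E :> \bar R.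
  by rewrite -sumEFin; apply: eq_bigr => n _; rewrite indE.
under [X in _ = _ + (X + _)]eq_bigr do rewrite sE indE -EFinM.
under [X in _ = _ + (_ + X)]eq_bigr do rewrite sE indE -EFinM.
rewrite !sE !sumEFin -EFinM -!EFinD; congr EFin.
elim: K => [|K IH]; first by rewrite !big_geq// mulr0 !addr0.
rewrite !big_nat_recr//=; set s := (\sum_(0 <= n < K) _)%R in IH *.
set v := (\sum_(0 <= n < K) _)%R in IH *.
have -> : ((s + (b K)%:R) * (s + (b K)%:R) =
  s * s + (b K)%:R * (b K)%:R + ((b K)%:R * s + (b K)%:R * s))%R by ring.
rewrite IH; have -> : ((b K)%:R * (b K)%:R = (b K)%:R :> R)%R.
  by case: (b K); rewrite ?mulr1 ?mulr0.
by ring.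
Qed.

(** The integral of N(s-, A) against N(ds, A), that is the number of pairs of events with marks in
    [A]. *)
Definition pair_sum k t w : \bar R := \sum_(0 <= n < k.+1)
  ind (T n w <= t%:E) * (chi (mark n w) * count_before N (arrival n w) A w).

Lemma mark_sum_sqr k t w : mark_sum k t chi w * mark_sum k t chi w =
  mark_sum k t chi w + (pair_sum k t w + pair_sum k t w).
Proof.
pose b n := (T n w <= t%:E) && (mark n w \in A).
have sE : mark_sum k t chi w = \sum_(0 <= n < k.+1) ind (b n).
  by apply: eq_bigr => n _; rewrite /b ind_and.
have pE : pair_sum k t w =
    \sum_(0 <= n < k.+1) (ind (b n) * \sum_(0 <= j < n) ind (b j)).
  apply: eq_bigr => n _; rewrite /b ind_and -muleA.
  case: leP => tn /=; last by rewrite !mul0e.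
  rewrite !mul1e; congr (_ * _).
  rewrite count_before_arrival ?(le_lt_trans tn) ?ltry//.
  apply: eq_big_nat => j /andP[_ jn]; rewrite (le_trans _ tn)//.
  exact/event_time_le_of_le/ltnW.
by rewrite sE pE sqr_sum_ind.
Qed.

(** The integral of N(s-, A) against Q(A) dLam(s). *)
Definition cross_term k t w : \bar R :=
  \int[mu]_s (ell k w s * (ind (0 < s <= t)%R * (count_before N s A w * Q A))).

Lemma measurable_count_before :
  measurable_fun [set: Omega * R] (fun p => count_before N p.2 A p.1).
Proof.
exact: (measurableT_comp (predictable_count_before mA) (predictable_id x0)).
Qed.

(** Compensation of N(s-, A) times the indicator of [A], predictable because the count stops short
    of [s]. *)
Lemma expectation_pair_sum k t :
  \int[P]_w pair_sum k t w = \int[P]_w cross_term k t w.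
Proof.
pose H (p : R * X) := ind (0 < p.1 <= t)%R * chi p.2.
have mH : measurable_fun [set: R * X] H.
  apply: emeasurable_funM.
    exact: (measurableT_comp (measurable_ind_oc t) measurable_fst).
  exact: (measurableT_comp measurable_chi measurable_snd).
pose W (p : Omega * R * X) := H (p.1.2, p.2) * count_before N p.1.2 A p.1.1.
have pH : predictable_function N (fun p => H (p.1.2, p.2)).
  by apply: predictable_deterministic => // u x u0; rewrite /H/= ltNge u0 mul0e.
have pW : predictable_function N W.
  apply: emeasurable_funM; first exact: pH.
  exact: (measurableT_comp (predictable_count_before mA) measurable_fst).
have W0 p : 0 <= W p by rewrite mule_ge0// indM_ge0// ind_ge0.
have E := stopped_compensation x0 f_meas f_bounded N_hawkes k pW W0.
transitivity (\int[P]_w \sum_(0 <= n < k.+1)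
  ind (T n w < +oo) * W (w, arrival n w, mark n w)).
  apply: eq_integral => w _; apply: eq_bigr => n _.
  by rewrite ind_event_leE /W/H/= !muleA.
rewrite E; apply: eq_integral => w _; apply: eq_integral => s _; congr (_ * _).
rewrite /W/H/=; under eq_integral do rewrite muleAC.
rewrite ge0_integralZl ?ind_ge0// ?mule_ge0 ?ind_ge0//.
- by rewrite integral_chi muleA.
- exact: measurable_chi.
- by move=> x _; exact: ind_ge0.
Qed.


(** The integral of Q(A) Lam(s) against N(ds, A); [past_integral] is its compensated counterpart,
    against Q(A) dLam(s). *)
Definition past_term k t w : \bar R := \sum_(0 <= n < k.+1)
  ind (T n w <= t%:E) * (chi (mark n w) * (Q A * compensator k (arrival n w) w)).

Definition past_integral k t w : \bar R :=
  \int[mu]_s (ell k w s * (ind (0 < s <= t)%R * (Q A * compensator k s w * Q A))).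

(** The predictability half of [compensated_by], applied to the indicator of t <= T_k and of [A]:
    integrating the latter over the marks produces the factor [Q A]. *)
Lemma predictable_compensator k :
  predictable_process N (fun wt => Q A * compensator k wt.2 wt.1).
Proof.
pose W (p : Omega * R * X) := ind (p.1.2%:E <= T k p.1.1) * chi p.2.
have pchi : predictable_function N (fun p => chi p.2).
  exact: (measurableT_comp measurable_chi measurable_snd).
have pW : predictable_function N W := predictable_function_stop x0 k pchi.
have W0 p : 0 <= W p by rewrite indM_ge0 ?ind_ge0.
have [/(_ _ pW W0) + _] := N_hawkes; apply: eq_measurable_fun => -[w t] _ /=.
rewrite (@integral_ind _ _ (measurableTypeR R) _ _ (fun s : R => 0 < s <= t)%R); last first.
  by move=> s; rewrite /= in_itv/=.
rewrite /compensator -ge0_integralZl//.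
- apply: eq_integral => s _.
  case: (boolP (0 < s <= t)%R) => [/andP[s0 _]|_]; last by rewrite mul0e !mule0.
  rewrite mul1e mule1 [RHS]muleC -integral_chi.
  rewrite -(integral_hawkes_kernel_stop N x0 m Q f_meas f_bounded)//.
  + by rewrite ltW// mul1e.
  + exact: measurable_chi.
  + by move=> x; exact: ind_ge0.
- apply: emeasurable_funM; last exact: measurable_ind_oc.
  exact: (measurable_ell1 N x0).
- by move=> s _; rewrite mule_ge0 ?stopped_intensity_ge0 ?ind_ge0.
Qed.

Lemma expectation_past_term k t :
  \int[P]_w past_term k t w = \int[P]_w past_integral k t w.
Proof.
pose H (p : R * X) := ind (0 < p.1 <= t)%R * chi p.2.
have mH : measurable_fun [set: R * X] H.
  apply: emeasurable_funM.
    exact: (measurableT_comp (measurable_ind_oc t) measurable_fst).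
  exact: (measurableT_comp measurable_chi measurable_snd).
have pH : predictable_function N (fun p => H (p.1.2, p.2)).
  by apply: predictable_deterministic => // u x u0; rewrite /H/= ltNge u0 mul0e.
pose W (p : Omega * R * X) := H (p.1.2, p.2) * (Q A * compensator k p.1.2 p.1.1).
have pW : predictable_function N W.
  apply: emeasurable_funM; first exact: pH.
  exact: (measurableT_comp (predictable_compensator k) measurable_fst).
have W0 p : 0 <= W p.
  by rewrite mule_ge0// ?indM_ge0 ?ind_ge0// mule_ge0 ?compensator_ge0.
have E := stopped_compensation x0 f_meas f_bounded N_hawkes k pW W0.
transitivity (\int[P]_w \sum_(0 <= n < k.+1)
  ind (T n w < +oo) * W (w, arrival n w, mark n w)).
  apply: eq_integral => w _; apply: eq_bigr => n _.
  by rewrite ind_event_leE /W/H/= !muleA.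
rewrite E; apply: eq_integral => w _; apply: eq_integral => s _; congr (_ * _).
rewrite /W/H/=; under eq_integral do rewrite muleAC.
rewrite ge0_integralZl ?ind_ge0//.
- by rewrite integral_chi -!muleA.
- exact: measurable_chi.
- by move=> x _; exact: ind_ge0.
- by rewrite mule_ge0 ?ind_ge0// mule_ge0 ?compensator_ge0.
Qed.

Lemma compensator_split k (a t : R) w : (0 < a)%R -> (a <= t)%R ->
  compensator k t w = compensator k a w +
    \int[mu]_s (ell k w s * ind (a < s <= t)%R).
Proof.
move=> a0 at_; rewrite /compensator -ge0_integralD//.
- apply: eq_integral => s _; rewrite -ge0_muleDr ?ind_ge0//; congr (_ * _).
  case: (leP s a) => sa; rewrite ?andbF ?andbT/=.
    by rewrite (le_trans sa at_) andbT adde0.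
  by rewrite (lt_trans a0 sa) add0e.
- by move=> s _; rewrite mule_ge0 ?stopped_intensity_ge0 ?ind_ge0.
- apply: emeasurable_funM; last exact: measurable_ind_oc.
  exact: (measurable_ell1 N x0).
- by move=> s _; rewrite mule_ge0 ?stopped_intensity_ge0 ?ind_ge0.
- apply: emeasurable_funM; first exact: (measurable_ell1 N x0).
  apply: measurable_ind; apply: measurable_and; first exact: measurable_fun_ltr.
  exact: measurable_fun_ler.
Qed.

(** Integration by parts for the product of N and Lam: every event splits Lam(t) at its arrival; the
    earlier parts add up to [past_term], the later ones to [cross_term]. *)
Lemma mark_sum_compensator k t w :
  mark_sum k t chi w * (Q A * compensator k t w) =
  past_term k t w + cross_term k t w.
Proof.
pose g n s : \bar R := ind (T n w <= t%:E) * chi (mark n w) *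
  (ell k w s * ind (arrival n w < s <= t)%R * Q A).
have mg' n : measurable_fun [set: R]
    (fun s => ell k w s * ind (arrival n w < s <= t)%R).
  apply: emeasurable_funM; first exact: (measurable_ell1 N x0).
  apply: measurable_ind; apply: measurable_and; first exact: measurable_fun_ltr.
  exact: measurable_fun_ler.
have g'0 n s : 0 <= ell k w s * ind (arrival n w < s <= t)%R.
  by rewrite mule_ge0 ?stopped_intensity_ge0 ?ind_ge0.
have mg n : measurable_fun [set: R] (g n).
  by apply: emeasurable_funM => //; apply: emeasurable_funM.
have g0 n s : 0 <= g n s.
  by apply: mule_ge0; rewrite mule_ge0 ?ind_ge0.
(* N(s-, A) is expanded over events, so that the time integral can be taken event by event, over
   times after the arrival. *)
have -> : cross_term k t w = \sum_(0 <= n < k.+1) \int[mu]_s g n s.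
  rewrite -ge0_integral_sum//; apply: eq_integral => s _; rewrite /g.
  case: (boolP (0 < s <= t)%R) => [/andP[s0 st]|nst]; last first.
    rewrite mul0e mule0 big1// => n _; rewrite event_time_leE.
    case: (ltP (T n w) +oo) => fin; last by rewrite !mul0e.
    rewrite (_ : (_ < s <= t)%R = false) ?mule0 ?mul0e ?mule0//.
    apply/negbTE; apply: contra nst => /andP[as_ ->].
    by rewrite (lt_trans (arrival_gt0 fin) as_).
  rewrite /stopped_intensity; case: (boolP ((0 <= s)%R && _)) => [/andP[_ sk]|_]; last first.
    by rewrite /= !mul0e big1// => n _; rewrite !mul0e mule0.
  rewrite !mul1e (count_before_stop sk) ge0_sume_distrl; last first.
    by move=> n _; rewrite indM_ge0 ?ind_ge0.
  rewrite ge0_sume_distrr; last by move=> n _; rewrite mule_ge0// indM_ge0 ?ind_ge0.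
  apply: eq_bigr => n _; rewrite event_time_ltE event_time_leE st andbT.
  case: (ltP (T n w) +oo) => fin; last by rewrite !mul0e mule0.
  case: (ltP (arrival n w) s) => as_ /=; last by rewrite !mule0 !mul0e !mule0.
  by rewrite (le_trans (ltW as_) st) !mul1e mule1 muleCA.
rewrite /past_term -big_split/= ge0_sume_distrl; last first.
  by move=> n _; rewrite indM_ge0 ?ind_ge0.
apply: eq_bigr => n _; rewrite ge0_integralZl//; last 3 first.
- by apply: emeasurable_funM; [exact: mg'|exact: measurable_cst].
- by move=> s _; rewrite mule_ge0.
- by rewrite mule_ge0 ?ind_ge0.
rewrite ge0_integralZr//; last exact: mg'.
rewrite [X in _ = X + _]muleA -ge0_muleDr; last 2 first.
- by rewrite mule_ge0 ?compensator_ge0.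
- by rewrite mule_ge0// integral_ge0.
rewrite event_time_leE.
case: (ltP (T n w) +oo) => fin; last by rewrite !mul0e.
case: (leP (arrival n w) t) => at_ /=; last by rewrite !mul0e.
rewrite (compensator_split k w (arrival_gt0 fin) at_).
congr (_ * _); rewrite ge0_muleDr ?compensator_ge0 ?integral_ge0//.
by congr (_ + _); rewrite muleC.
Qed.

(* Symmetrization: [1 <= 1_(u <= s) + 1_(s <= u)] in the double integral. *)
Lemma compensator_sqr k t w :
  (Q A * compensator k t w) * (Q A * compensator k t w) <=
  past_integral k t w + past_integral k t w.
Proof.
pose l s : \bar R := ell k w s * ind (0 < s <= t)%R * Q A.
have l0 s : 0 <= l s by rewrite mule_ge0// mule_ge0 ?stopped_intensity_ge0 ?ind_ge0.
have ml' u : measurable_fun [set: R] (fun s => ell k w s * ind (0 < s <= u)%R).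
  apply: emeasurable_funM; last exact: measurable_ind_oc.
  exact: (measurable_ell1 N x0).
have ml : measurable_fun [set: R] l by exact: emeasurable_funM.
have LE : Q A * compensator k t w = \int[mu]_s l s.
  rewrite ge0_integralZr//; last 2 first.
  - exact: ml'.
  - by move=> s _; rewrite mule_ge0 ?stopped_intensity_ge0 ?ind_ge0.
  by rewrite muleC.
pose h (p : R * R) := l p.1 * (l p.2 * ind (p.2 <= p.1)%R).
have mh : measurable_fun [set: R * R] h.
  apply: emeasurable_funM; first exact: (measurableT_comp ml measurable_fst).
  apply: emeasurable_funM; first exact: (measurableT_comp ml measurable_snd).
  by apply: measurable_ind; apply: measurable_fun_ler.
have h0 p : 0 <= h p by apply: mule_ge0 => //; apply: mule_ge0 => //; exact: ind_ge0.
have pE : past_integral k t w = \int[mu]_s \int[mu]_u h (s, u).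
  apply: eq_integral => s _; rewrite /h/=.
  have mls : measurable_fun [set: R] (fun u => l u * ind (u <= s)%R).
    apply: emeasurable_funM => //; apply: measurable_ind; exact: measurable_fun_ler.
  rewrite ge0_integralZl//; last by move=> u _; rewrite mule_ge0 ?ind_ge0.
  case: (boolP (0 < s <= t)%R) => [/andP[s0 st]|nst]; last first.
    by rewrite /l (negbTE nst) /= mule0 !mul0e mule0.
  have -> : \int[mu]_u (l u * ind (u <= s)%R) = compensator k s w * Q A.
    rewrite /compensator -ge0_integralZr//; last 2 first.
    - exact: ml'.
    - by move=> u _; rewrite mule_ge0 ?stopped_intensity_ge0 ?ind_ge0.
    apply: eq_integral => u _; rewrite /l [LHS]muleAC; congr (_ * _).
    rewrite -muleA -ind_and -andbA; congr (_ * ind (_ && _)).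
    by case: (leP u s) => us; rewrite ?andbF// (le_trans us st).
  by rewrite /l s0 st /= mule1 mul1e !muleA.
(* Tonelli exchanges the two times, giving the other half of the square ]0, t] x ]0, t]. *)
have pE' : past_integral k t w = \int[mu]_s \int[mu]_u h (u, s).
  by rewrite pE; exact: (fubini_tonelli (m1 := mu) (m2 := mu) h mh h0).
rewrite {1}pE pE' -ge0_integralD//; last 4 first.
- by move=> s _; exact: integral_ge0.
- exact: (measurable_fun_fubini_tonelli_F (m2 := mu) h).
- by move=> s _; exact: integral_ge0.
- exact: (measurable_fun_fubini_tonelli_G (m1 := mu) h).
rewrite LE -ge0_integralZr//; last exact: integral_ge0.
apply: ge0_le_integral => //.
- by move=> s _; rewrite mule_ge0// integral_ge0.
- exact: emeasurable_funM.
- apply: emeasurable_funD.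
    exact: (measurable_fun_fubini_tonelli_F (m2 := mu) h).
  exact: (measurable_fun_fubini_tonelli_G (m1 := mu) h).
move=> s _; rewrite -ge0_integralZl// -ge0_integralD//; last 2 first.
- exact: (measurableT_comp mh (pair1_measurable s)).
- exact: (measurableT_comp mh (pair2_measurable s)).
apply: ge0_le_integral => //.
- by move=> u _; exact: mule_ge0.
- exact: emeasurable_funM.
- apply: emeasurable_funD.
    exact: (measurableT_comp mh (pair1_measurable s)).
  exact: (measurableT_comp mh (pair2_measurable s)).
move=> u _; rewrite /h/= [l u * (l s * _)]muleCA -ge0_muleDr; last 2 first.
- by apply: mule_ge0 => //; exact: ind_ge0.
- by apply: mule_ge0 => //; exact: ind_ge0.
apply: lee_wpmul2l => //; rewrite -ge0_muleDr ?ind_ge0//.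
rewrite -[leLHS]mule1; apply: lee_wpmul2l => //.
case: (leP u s) => us /=; first by rewrite leeDl ?ind_ge0.
by rewrite (ltW us) add0e.
Qed.

(** The variance of the compensated count is at most its mean count, as for a Poisson process, and
    the mean count is at most [rate * t]. *)
Lemma expectation_centered_sqr k t : (0 <= t)%R ->
  \int[P]_w ((fine (mark_sum k t chi w) - fine (Q A * compensator k t w)) ^+ 2)%:E
  <= (rate * t)%:E.
Proof.
move=> t0.
have QA1 : Q A <= 1 by exact: probability_le1.
have [B [B0 cB]] := compensator_bound N x0 m f_meas f_bounded k t0.
have mc := measurable_compensator N x0 m f_meas k t.
have mY := measurable_mark_sum N x0 k t measurable_chi.
have ms0 w : 0 <= mark_sum k t chi w.
  by apply: mark_sum_ge0 => x; exact: ind_ge0.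
have mcross : measurable_fun [set: Omega] (cross_term k t).
  apply: (measurable_fun_fubini_tonelli_F (m2 := mu) (fun p : Omega * R =>
    ell k p.1 p.2 * (ind (0 < p.2 <= t)%R * (count_before N p.2 A p.1 * Q A)))).
    apply: emeasurable_funM; first exact: (measurable_ell N x0 m f_meas k).
    apply: emeasurable_funM.
      exact: (measurableT_comp (measurable_ind_oc t) measurable_snd).
    by apply: emeasurable_funM => //; exact: measurable_count_before.
  by move=> p; rewrite !mule_ge0 ?hawkes_intensity_ge0 ?ind_ge0 ?measure_ge0.
have cross0 w : 0 <= cross_term k t w.
  apply: integral_ge0 => s _.
  by rewrite !mule_ge0 ?hawkes_intensity_ge0 ?ind_ge0 ?measure_ge0.
have mpast : measurable_fun [set: Omega] (past_integral k t).
  apply: (measurable_fun_fubini_tonelli_F (m2 := mu) (fun p : Omega * R =>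
    ell k p.1 p.2 * (ind (0 < p.2 <= t)%R * (Q A * compensator k p.2 p.1 * Q A)))).
    apply: emeasurable_funM; first exact: (measurable_ell N x0 m f_meas k).
    apply: emeasurable_funM.
      exact: (measurableT_comp (measurable_ind_oc t) measurable_snd).
    apply: emeasurable_funM => //; apply: emeasurable_funM => //.
    exact: (measurable_compensator2 N x0 m f_meas k).
  by move=> p; rewrite !mule_ge0 ?hawkes_intensity_ge0 ?ind_ge0 ?compensator_ge0.
have past0 w : 0 <= past_integral k t w.
  apply: integral_ge0 => s _.
  by rewrite !mule_ge0 ?hawkes_intensity_ge0 ?ind_ge0 ?compensator_ge0.
have mpair : measurable_fun [set: Omega] (pair_sum k t).
  apply: emeasurable_sum => n; apply: emeasurable_funM.
    exact: measurable_ind_event.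
  apply: emeasurable_funM; first exact: (measurableT_comp measurable_chi (measurable_mark N x0 n)).
  have h : measurable_fun [set: Omega] (fun w => (w, arrival n w)).
    by apply: measurable_fun_pair => //; exact: measurable_arrival.
  exact: (measurableT_comp measurable_count_before h).
have pair0 w : 0 <= pair_sum k t w.
  by apply: sume_ge0 => n _; rewrite !mule_ge0 ?ind_ge0 ?measure_ge0.
have mpt : measurable_fun [set: Omega] (past_term k t).
  apply: emeasurable_sum => n; apply: emeasurable_funM.
    exact: measurable_ind_event.
  apply: emeasurable_funM; first exact: (measurableT_comp measurable_chi (measurable_mark N x0 n)).
  apply: emeasurable_funM => //.
  have h : measurable_fun [set: Omega] (fun w => (w, arrival n w)).
    by apply: measurable_fun_pair => //; exact: measurable_arrival.
  exact: (measurableT_comp (measurable_compensator2 N x0 m f_meas k) h).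
have pt0 w : 0 <= past_term k t w.
  by apply: sume_ge0 => n _; rewrite !mule_ge0 ?ind_ge0 ?compensator_ge0.
apply: (@le_trans _ _ (\int[P]_w mark_sum k t chi w)); last first.
  rewrite (expectation_mark_sum x0 f_meas f_bounded N_hawkes)//; last 2 first.
  - exact: measurable_chi.
  - by move=> x; exact: ind_ge0.
  rewrite integral_chi -[leRHS]mul1e; apply: lee_pmul => //.
  - by apply: integral_ge0 => w _; exact: compensator_ge0.
  - exact: (expectation_compensator_le x0 f_meas f_bounded N_hawkes q_lt1 qE).
(* Here u is the mean of [cross_term] and v that of [past_integral]. The bounds [k.+1] and [B] serve
   only for finiteness and do not enter the conclusion. *)
apply: (@expectation_square_sub _ _ _ P _ _ k.+1%:R B
  (\int[P]_w cross_term k t w) (\int[P]_w past_integral k t w)) => //.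
- exact: emeasurable_funM.
- move=> w; rewrite ms0/= -sume1; apply: lee_sum => n _.
  by rewrite -[leRHS]mule1; apply: lee_pmul; rewrite ?ind_ge0 ?ind_le1.
- move=> w; rewrite mule_ge0 ?compensator_ge0//=.
  by rewrite -[leRHS]mul1e; apply: lee_pmul => //; exact: compensator_ge0.
- under eq_integral do rewrite mark_sum_sqr.
  rewrite ge0_integralD//.
  + by congr (_ + _); rewrite ge0_integralD// expectation_pair_sum.
  + by move=> w _; exact: adde_ge0.
  + exact: emeasurable_funD.
- under eq_integral do rewrite mark_sum_compensator.
  by rewrite ge0_integralD// expectation_past_term.
- rewrite -ge0_integralD//; apply: ge0_le_integral => //.
  + by move=> w _; rewrite !mule_ge0 ?compensator_ge0.
  + by apply: emeasurable_funM; exact: emeasurable_funM.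
  + exact: emeasurable_funD.
  + by move=> w _; exact: compensator_sqr.
Qed.

End second_moment.

(** * Law of large numbers for the point process *)

Section simple_minorant.
Context (R : realType) d (S : measurableType d) (nu : {measure set S -> \bar R}).
Local Open Scope ereal_scope.
Import HBNNSimple finmap.

(** Meant for the mass of a mark, which may be unbounded while second moments are controlled for
    indicators: the simple part gives centered counts, and the remainder is small in mean. *)
Lemma simple_minorant (h : S -> \bar R) (q e : R) :
  measurable_fun [set: S] h -> (forall x, 0 <= h x) ->
  \int[nu]_x h x = q%:E -> (0 < e)%R ->
  exists (p : nat) (y : nat -> R) (B : nat -> set S) (rho : S -> \bar R),
  [/\ forall i, measurable (B i) /\ (0 <= y i)%R,
      measurable_fun [set: S] rho /\ (forall x, 0 <= rho x),
      forall x, h x = \sum_(0 <= i < p) (y i)%:E * ind (x \in B i) + rho x,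
      \int[nu]_x rho x <= e%:E &
      q%:E = \sum_(0 <= i < p) (y i)%:E * nu (B i) + \int[nu]_x rho x].
Proof.
move=> mh h0 qE e0.
pose g n : {nnsfun S >-> R} := nnsfun_approx measurableT mh n.
have gh n x : (g n x)%:E <= h x.
  by rewrite nnsfun_approxE; apply: le_approx.
have mg n : measurable_fun [set: S] (fun x => (g n x)%:E).
  exact/measurable_EFinP/measurable_funP.
have g0 n x : 0 <= (g n x)%:E by rewrite lee_fin.
(* Otherwise monotone convergence would bound the integral of [h] by q - e. *)
have [n gn] : exists n, (q - e)%:E < \int[nu]_x (g n x)%:E.
  apply/not_existsP => H.
  have : \int[nu]_x h x <= (q - e)%:E.
    rewrite (_ : \int[nu]_x h x = \int[nu]_x limn (fun n => (g n x)%:E)).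
      have nd x : nondecreasing_seq (fun n => (g n x)%:E).
        by move=> a b ab; rewrite lee_fin; exact/lefP/nd_nnsfun_approx.
      rewrite monotone_convergence//; apply: lime_le.
        apply: ereal_nondecreasing_is_cvgn => a b ab.
        by apply: ge0_le_integral => // x _; exact: nd.
      by apply: nearW => n; rewrite leNgt; apply/negP/H.
    apply: eq_integral => x _; apply/esym/cvg_lim => //.
    exact: cvg_nnsfun_approx.
  by rewrite qE lee_fin leNgt ltrBlDr ltrDl e0.
have gfin : \int[nu]_x (g n x)%:E \is a fin_num.
  rewrite ge0_fin_numE ?integral_ge0//; apply: (@le_lt_trans _ _ (\int[nu]_x h x)).
    by apply: ge0_le_integral.
  by rewrite qE ltry.
pose s := finmap.enum_fset (fset_set (g n @` setT)).
have gE x : (g n x)%:E =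
    \sum_(0 <= i < size s) (nth 0%R s i)%:E * ind (x \in g n @^-1` [set nth 0%R s i]).
  rewrite fimfunEord -sumEFin big_mkord; apply: eq_bigr => i _.
  by rewrite indicE EFinM; case: (x \in _).
have s0 i : (0 <= nth 0 s i)%R.
  have [si|si] := ltnP i (size s); last by rewrite nth_default.
  have : nth 0%R s i \in fset_set (g n @` setT) by exact: mem_nth.
  by rewrite in_fset_set// => /set_mem[x _ <-].
have mB i : measurable (g n @^-1` [set nth 0%R s i]) by [].
pose rho x := h x - (g n x)%:E.
have mrho : measurable_fun [set: S] rho by exact: emeasurable_funB.
have rho0 x : 0 <= rho x by rewrite sube_ge0.
have hE : \int[nu]_x h x = \int[nu]_x (g n x)%:E + \int[nu]_x rho x.
  by rewrite -ge0_integralD//; apply: eq_integral => x _; rewrite addeC subeK.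
exists (size s), (nth 0%R s), (fun i => g n @^-1` [set nth 0%R s i]), rho; split => //.
- by move=> x; rewrite -gE addeC subeK.
- rewrite -(leeD2lE _ _ gfin) -hE qE -leeBlDr// -EFinB.
  exact: ltW.
- rewrite -qE hE; congr (_ + _); under eq_integral do rewrite gE.
  rewrite ge0_integral_sum//.
  + apply: eq_bigr => i _; rewrite ge0_integralZl//.
    * congr (_ * _); rewrite integral_ind_measure; last exact: measurable_mem_set.
      by congr (nu _); apply/seteqP; split => x => [/set_mem|/mem_set].
    * by apply: measurable_ind; exact: measurable_mem_set.
    * by move=> x _; exact: ind_ge0.
    * by rewrite lee_fin.
  + move=> i; apply: emeasurable_funM => //; apply: measurable_ind.
    exact: measurable_mem_set.
  + by move=> i x _; rewrite mule_ge0 ?ind_ge0 ?lee_fin.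
Qed.

End simple_minorant.

Section absolute_moment.
Context (R : realType) d (S : measurableType d) (P : probability S R).
Local Open Scope ereal_scope.

Lemma integral_cst_probability (c : R) : \int[P]_w c%:E = c%:E.
Proof.
by rewrite integral_cst// [X in _ * X](_ : _ = 1) ?mule1//; exact: probability_setT.
Qed.

(** From |M| <= M^2 / (e t) + e t. A second moment linear in [t] thus becomes a first moment with
    arbitrarily small slope in [t]. *)
Lemma expectation_abs_le (M : S -> R) (c t e : R) :
  measurable_fun [set: S] M -> (0 < t)%R -> (0 < e)%R ->
  \int[P]_w ((M w ^+ 2)%R)%:E <= (c * t)%:E ->
  \int[P]_w `|M w|%:E <= (c / e + e * t)%:E.
Proof.
move=> mM t0 e0 M2; have et0 : (0 < e * t)%R by rewrite mulr_gt0.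
have mM2 : measurable_fun [set: S] (fun w => ((M w ^+ 2)%R)%:E).
  by apply/measurable_EFinP; exact: measurable_funX.
have M20 w : 0 <= ((M w ^+ 2)%R)%:E by rewrite lee_fin sqr_ge0.
apply: (@le_trans _ _ (\int[P]_w (((e * t)^-1)%:E * ((M w ^+ 2)%R)%:E + (e * t)%:E))).
  apply: ge0_le_integral => //.
  - by apply/measurable_EFinP; exact: measurableT_comp.
  - by apply: emeasurable_funD => //; exact: emeasurable_funM.
  move=> w _; rewrite -EFinM -EFinD lee_fin.
  rewrite -(ler_pM2l et0) mulrDr mulrA divff ?gt_eqF// mul1r.
  rewrite -(real_normK (num_real (M w))).
  have := sqr_ge0 (`|M w| - (e * t))%R; have := normr_ge0 (M w); nra.
rewrite ge0_integralD//; last 3 first.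
- by move=> w _; rewrite mule_ge0// lee_fin invr_ge0 ltW.
- exact: emeasurable_funM.
- by move=> w _; rewrite lee_fin ltW.
rewrite integral_cst_probability EFinD leeD// ge0_integralZl//; last first.
  by rewrite lee_fin invr_ge0 ltW.
apply: (@le_trans _ _ (((e * t)^-1)%:E * (c * t)%:E)).
  by rewrite lee_wpmul2l// lee_fin invr_ge0 ltW.
rewrite -EFinM lee_fin le_eqVlt; apply/orP; left; apply/eqP.
by field; rewrite !gt_eqF.
Qed.

Lemma markov_le (G : S -> \bar R) (a : R) (b : \bar R) :
  measurable_fun [set: S] G -> (forall w, 0 <= G w) -> (0 < a)%R ->
  \int[P]_w G w <= b -> P [set w | a%:E <= G w] <= (a^-1)%:E * b.
Proof.
move=> mG G0 a0 Gb.
have := le_integral_abse P measurableT mG a0; rewrite setTI.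
have -> : [set x | a%:E <= `|G x|] = [set x | a%:E <= G x].
  by apply/seteqP; split=> x /=; rewrite gee0_abs.
under eq_integral do rewrite gee0_abs//.
move=> H; rewrite -(@lee_pmul2l _ a%:E) ?lte_fin//.
by rewrite muleA -EFinM divff ?gt_eqF// mul1e (le_trans H).
Qed.

End absolute_moment.

Section law_of_large_numbers.
Context (R : realType) dO (Omega : measurableType dO) (P : probability Omega R)
  dX (X : measurableType dX).
Variables (N : marked_point_process R Omega X) (x0 : X).
Variables (m : {nonneg R}) (f : R * X -> {nonneg R}) (Q : probability X R).
Hypothesis f_meas : measurable_fun ((`[0, +oo[ : set R) `*` [set: X])
  (fun p => (f p)%:num).
Hypothesis f_bounded : exists M : R, forall t x, 0 <= t -> (f (t, x))%:num <= M.
Hypothesis N_hawkes : marked_hawkes N m f Q P.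
Variable q : R.
Hypothesis q_lt1 : q < 1.
Hypothesis qE : (\int[lebesgue_measure]_t mean_causal f Q t = q%:E)%E.
Local Open Scope ereal_scope.
Local Notation mu := (@lebesgue_measure R).
Local Notation T := (event_time N).
Local Notation arrival := (arrival N).
Local Notation mark := (mark N x0).
Local Notation F := (mean_causal f Q).

Local Notation rate := (rate m q).
Local Notation mark_sum := (mark_sum N x0).
Local Notation tail_sum := (tail_sum N x0 f).
Local Notation compensator := (compensator N m f).
Hypothesis F_moment : \int[mu]_s (s%:E * F s) < +oo.

Local Notation chi B := (fun x : X => ind (x \in B) : \bar R).

(** T_k <= t forces k + 1 stopped events by time [t], whose mean number is bounded independently of
    [k]; Markov's inequality concludes. *)
Lemma stop_probability k t : (0 <= t)%R ->
  P [set w | T k w <= t%:E] <= (k.+1%:R^-1 * (rate * t))%:E.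
Proof.
move=> t0; pose G := mark_sum k t (fun=> 1).
have mG : measurable_fun [set: Omega] G by exact: measurable_mark_sum.
have G0 w : 0 <= G w by apply: mark_sum_ge0 => x; exact: lee01.
have EG : \int[P]_w G w <= (rate * t)%:E.
  rewrite (expectation_mark_sum x0 f_meas f_bounded N_hawkes)//.
  rewrite (integral_cst_probability Q 1) mul1e.
  exact: (expectation_compensator_le x0 f_meas f_bounded N_hawkes q_lt1 qE).
have := markov_le (a := k.+1%:R) mG G0 _ EG; rewrite EFinM => /(_ (ltr0Sn _ _)).
apply: le_trans; apply: le_measure; rewrite ?inE.
- rewrite -[X in measurable X]setTI; exact: measurable_lee.
- rewrite -[X in measurable X]setTI; exact: measurable_lee.
- move=> w /= Tk; rewrite -sume1 le_eqVlt; apply/orP; left; apply/eqP.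
  apply: eq_big_nat => n /andP[_ nk].
  by rewrite mule1 (le_trans _ Tk)//; exact: event_time_le_of_le.
Qed.

(** The number of terms in [compound_process], which unfolds to it. *)
Definition event_number t (A : set X) w : nat := Num.truncn (fine (event_count N t A w)).

Lemma event_count_mark_sum k t A w : t%:E < T k w ->
  event_count N t A w = mark_sum k t (chi A) w.
Proof.
move=> tk; rewrite (event_countE N x0).
rewrite (nneseries_split 0%N k.+1)//; last by move=> *; rewrite indM_ge0 ?ind_ge0.
rewrite [X in _ + X]eseries0 ?adde0; last first.
  move=> n kn _; rewrite /ind ifF ?mul0e//; apply/negbTE; rewrite -ltNge.
  by apply: lt_le_trans tk _; apply: event_time_le_of_le; exact: ltnW.
by rewrite add0n.
Qed.

Lemma event_numberE k t A w : t%:E < T k w ->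
  (event_number t A w)%:R%:E = mark_sum k t (chi A) w.
Proof.
move=> tk; rewrite /event_number (event_count_mark_sum _ tk).
have -> : mark_sum k t (chi A) w =
    (\sum_(0 <= n < k.+1) nat_of_bool ((T n w <= t%:E)%E && (mark n w \in A)))%N%:R%:E.
  rewrite natr_sum -sumEFin; apply: eq_bigr => n _.
  by rewrite -ind_and; case: (_ && _).
by rewrite /= natrK.
Qed.

Lemma event_number_le t A w : (event_number t A w)%:R%:E <= event_count N t A w.
Proof.
rewrite /event_number; have c0 : 0 <= event_count N t A w by exact: measure_ge0.
have [fin|] := boolP (event_count N t A w \is a fin_num).
  by rewrite -[leRHS](fineK fin) lee_fin truncn_le fine_ge0.
by rewrite ge0_fin_numE// -leNgt leye_eq => /eqP ->; rewrite leey.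
Qed.

Lemma measurable_event_number t A : measurable A ->
  measurable_fun [set: Omega] (fun w => (event_number t A w)%:R : R).
Proof.
move=> mA; apply: (measurableT_comp (f := fun x : R => (Num.truncn x)%:R : R)).
  apply: nondecreasing_measurable => // x y xy.
  by rewrite ler_nat; exact: le_truncn.
exact: (measurableT_comp (fine_measurable measurableT) (measurable_event_count N x0 t mA)).
Qed.

Lemma expectation_event_number_le t A : (0 <= t)%R -> measurable A ->
  \int[P]_w (event_number t A w)%:R%:E <= (rate * t)%:E.
Proof.
move=> t0 mA; apply: (@le_trans _ _ (\int[P]_w event_count N t A w)).
  apply: ge0_le_integral => //.
  - by apply/measurable_EFinP; exact: measurable_event_number.
  - exact: (measurable_event_count N x0 t mA).
  - by move=> w _; exact: event_number_le.
have mterm n : measurable_fun [set: Omega] (fun w => ind (T n w <= t%:E) * chi A (mark n w)).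
  apply: emeasurable_funM; first exact: measurable_ind_event.
  exact: (measurableT_comp (measurable_chi mA) (measurable_mark N x0 n)).
have term0 n w : 0 <= ind (T n w <= t%:E) * chi A (mark n w).
  by rewrite mule_ge0 ?ind_ge0.
under eq_integral do rewrite (event_countE N x0).
rewrite integral_nneseries//; apply: lime_le.
  by apply: is_cvg_nneseries => n _ _; exact: integral_ge0.
(* The partial sums of the series are the stopped sums. The empty one is treated apart, since
   [mark_sum k] has k + 1 terms. *)
apply: nearW => -[|k]; first by rewrite big_geq// lee_fin mulr_ge0// (rate_ge0 m q_lt1).
rewrite -ge0_integral_sum//.
rewrite -[X in X <= _]/(\int[P]_w mark_sum k t (chi A) w).
rewrite (expectation_mark_sum x0 f_meas f_bounded N_hawkes)//; last 2 first.
- exact: measurable_chi.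
- by move=> x; exact: ind_ge0.
rewrite integral_chi// -[leRHS]mul1e; apply: lee_pmul => //.
- by apply: integral_ge0 => w _; exact: compensator_ge0.
- exact: probability_le1.
- exact: (expectation_compensator_le x0 f_meas f_bounded N_hawkes q_lt1 qE).
Qed.


(** The stopped martingale N(t, B) - Q(B) Lam(t), as a real number. *)
Definition centered k t (B : set X) w : R :=
  (fine (mark_sum k t (chi B) w) - fine (Q B * compensator k t w))%R.

Lemma compensator_fin k t w : (0 <= t)%R -> compensator k t w \is a fin_num.
Proof.
move=> t0; have [B [B0 cB]] := compensator_bound N x0 m f_meas f_bounded k t0.
by rewrite ge0_fin_numE ?compensator_ge0// (le_lt_trans (cB w))// ltry.
Qed.

Lemma centeredE k t (B : set X) w : (0 <= t)%R -> measurable B ->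
  centered k t B w = (\sum_(0 <= n < k.+1)
    ((T n w <= t%:E)%E && (mark n w \in B))%:R -
    fine (Q B) * fine (compensator k t w))%R.
Proof.
move=> t0 mB; rewrite /centered fineM ?compensator_fin//; last first.
  exact: fin_num_measure.
congr (_ - _)%R; rewrite -[RHS]/(fine (_%:E)) -sumEFin; congr fine.
by apply: eq_bigr => n _; rewrite -ind_and; case: (_ && _).
Qed.

Lemma measurable_centered k t (B : set X) : measurable B ->
  measurable_fun [set: Omega] (centered k t B).
Proof.
move=> mB; apply: measurable_funB.
  apply: (measurableT_comp (fine_measurable measurableT)).
  exact: (measurable_mark_sum N x0 k t (measurable_chi mB)).
apply: (measurableT_comp (fine_measurable measurableT)).
apply: emeasurable_funM => //; exact: (measurable_compensator N x0 m f_meas k t).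
Qed.

(* The deviation of the count is controlled by terms of mean o(t): the main term
   of the balance equation is linear in the compensator up to martingale terms,
   once the mass of a mark is approximated by a simple function. *)
Lemma event_number_deviation k t (A : set X) w (p : nat) (y : nat -> R)
    (B : nat -> set X) (rho : X -> \bar R) (rq : R) :
  (0 <= t)%R -> measurable A -> t%:E < T k w ->
  (forall i, measurable (B i) /\ (0 <= y i)%R) ->
  measurable_fun [set: X] rho /\ (forall x, 0 <= rho x) ->
  (forall x, mass f x = \sum_(0 <= i < p) (y i)%:E * ind (x \in B i) + rho x) ->
  (0 <= rq)%R ->
  q%:E = \sum_(0 <= i < p) (y i)%:E * Q (B i) + rq%:E ->
  `|((event_number t A w)%:R - rate * fine (Q A) * t)%R|%:E <=
  `|centered k t A w|%:E + ((1 - q)^-1)%:E *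
    (\sum_(0 <= i < p) (y i)%:E * `|centered k t (B i) w|%:E +
     (mark_sum k t rho w + (rq%:E * compensator k t w + tail_sum k t w))).
Proof.
move=> t0 mA tk By [mrho rho0] massE rq0 qE'.
have k0 : (0 < (1 - q)^-1)%R by rewrite invr_gt0 subr_gt0.
have sy0 : 0 <= \sum_(0 <= i < p) (y i)%:E * `|centered k t (B i) w|%:E.
  by apply: sume_ge0 => i _; rewrite mule_ge0 ?lee_fin//; case: (By i).
have r0 : 0 <= mark_sum k t rho w by exact: mark_sum_ge0.
have ta0 := tail_sum_ge0 N x0 f k t w.
have rc0 : 0 <= rq%:E * compensator k t w.
  by rewrite mule_ge0 ?compensator_ge0 ?lee_fin.
(* An infinite remainder or tail makes the bound trivial; in the remaining case all quantities are
   real and ordinary algebra applies. *)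
have infty Z : Z = +oo -> `|((event_number t A w)%:R - rate * fine (Q A) * t)%R|%:E <=
  `|centered k t A w|%:E + ((1 - q)^-1)%:E * Z.
  by move=> ->; rewrite gt0_muley ?lte_fin// addey ?leey.
have nNy (Z : \bar R) : 0 <= Z -> Z != -oo.
  by move=> Z0; rewrite gt_eqF// (lt_le_trans ltNy0 Z0).
have [finr|] := boolP (mark_sum k t rho w \is a fin_num); last first.
  rewrite ge0_fin_numE// -leNgt leye_eq => /eqP E; apply: infty.
  by rewrite E addye ?addey// nNy// adde_ge0.
have [fint|] := boolP (tail_sum k t w \is a fin_num); last first.
  rewrite ge0_fin_numE// -leNgt leye_eq => /eqP E; apply: infty.
  by rewrite E addey ?nNy// addey ?nNy// addey ?nNy.
have finc := compensator_fin k w t0.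
pose b n (C : set X) : R := ((T n w <= t%:E)%E && (mark n w \in C))%:R.
pose s C := (\sum_(0 <= n < k.+1) b n C)%R.
have balance := compensator_balance x0 m f_meas t0 tk.
have cntE : (event_number t A w)%:R = s A :> R.
  apply: EFin_inj; rewrite (event_numberE _ tk) -sumEFin; apply: eq_bigr => n _.
  by rewrite -ind_and /b; case: (_ && _).
have massE' : mark_sum k t (mass f) w =
    (\sum_(0 <= i < p) y i * s (B i))%:E + mark_sum k t rho w.
  transitivity (\sum_(0 <= n < k.+1)
      ((\sum_(0 <= i < p) y i * b n (B i))%:E + ind (T n w <= t%:E) * rho (mark n w))).
    apply: eq_bigr => n _; rewrite massE -sumEFin.
    case: (leP (T n w) t%:E) => tn /=; last first.
      rewrite !mul0e adde0 big1// => i _.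
      by rewrite /b leNgt tn/= mulr0.
    rewrite !mul1e; congr (_ + _); apply: eq_bigr => i _.
    by rewrite /b tn EFinM; case: (_ \in _).
  rewrite big_split/=; congr (_ + _); rewrite sumEFin; congr EFin.
  rewrite exchange_big/=; apply: eq_bigr => i _.
  by rewrite /s mulr_sumr.
set L := fine (compensator k t w).
have LE : compensator k t w = L%:E by rewrite fineK.
have qR : (q = \sum_(0 <= i < p) y i * fine (Q (B i)) + rq)%R.
  apply: EFin_inj; rewrite qE' EFinD -sumEFin; congr (_ + _).
  apply: eq_bigr => i _; rewrite EFinM fineK//.
  by apply: fin_num_measure; case: (By i).
set r := fine (mark_sum k t rho w).
have rE : mark_sum k t rho w = r%:E by rewrite fineK.
set ta := fine (tail_sum k t w).
have taE : tail_sum k t w = ta%:E by rewrite fineK.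
have balR : (L + ta = m%:num * t + (\sum_(0 <= i < p) y i * s (B i) + r))%R.
  by apply: EFin_inj; rewrite !EFinD -LE -taE balance massE' rE.
rewrite rE LE taE.
under eq_bigr do rewrite -EFinM.
rewrite sumEFin -!EFinM -!EFinD lee_fin.
have L0 : (0 <= L)%R by rewrite fine_ge0// compensator_ge0.
have r0' : (0 <= r)%R by rewrite fine_ge0.
have ta0' : (0 <= ta)%R by rewrite fine_ge0.
have cB i : centered k t (B i) w = (s (B i) - fine (Q (B i)) * L)%R.
  by rewrite centeredE//; case: (By i).
(* The balance equation, with each count of [B i] replaced by its compensator plus its centered
   part: the compensators add up to (q - rq) L. *)
have sumE : ((1 - q) * L - m%:num * t =
    \sum_(0 <= i < p) y i * centered k t (B i) w + r - rq * L - ta)%R.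
  have -> : (\sum_(0 <= i < p) y i * centered k t (B i) w =
    \sum_(0 <= i < p) y i * s (B i) - (\sum_(0 <= i < p) y i * fine (Q (B i))) * L)%R.
    rewrite mulr_suml -sumrB; apply: eq_bigr => i _.
    by rewrite cB mulrBr mulrA.
  rewrite qR; have -> : (ta = m%:num * t + (\sum_(0 <= i < p) y i * s (B i) + r) - L)%R.
    by rewrite -balR addrC addKr.
  by ring.
have QA0 : (0 <= fine (Q A))%R by exact: fine_ge0.
have QA1 : (fine (Q A) <= 1)%R.
  by rewrite -lee_fin fineK ?fin_num_measure//; exact: probability_le1.
(* A martingale term plus Q(A) / (1 - q) times the distance of (1 - q) Lam(t) from m t. *)
have dev : ((event_number t A w)%:R - rate * fine (Q A) * t =
    centered k t A w + fine (Q A) * (1 - q)^-1 * ((1 - q) * L - m%:num * t))%R.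
  rewrite cntE centeredE// -/L -/(s A) /rate.
  by field; rewrite gt_eqF// subr_gt0.
have cmp : (`|(1 - q) * L - m%:num * t| <=
    \sum_(0 <= i < p) y i * `|centered k t (B i) w| + (r + (rq * L + ta)))%R.
  have S1 : (`|\sum_(0 <= i < p) y i * centered k t (B i) w| <=
      \sum_(0 <= i < p) y i * `|centered k t (B i) w|)%R.
    apply: le_trans (ler_norm_sum _ _ _) _; apply: ler_sum => i _.
    by rewrite normrM ger0_norm//; case: (By i).
  have rL0 : (0 <= rq * L)%R by exact: mulr_ge0.
  by rewrite sumE; move: S1; rewrite !ler_norml => /andP[S1 S2]; apply/andP; split; lra.
rewrite dev; apply: (le_trans (ler_normD _ _)); rewrite lerD2l normrM.
have nn : (0 <= fine (Q A) * (1 - q)^-1)%R by rewrite mulr_ge0// ltW.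
rewrite (ger0_norm nn).
apply: (@le_trans _ _ (1 * (1 - q)^-1 * `|(1 - q) * L - m%:num * t|)%R).
  by rewrite ler_wpM2r// ler_wpM2r// ltW.
by rewrite mul1r ler_wpM2l// ltW.
Qed.

(** The constant [B] depends on [d] but on neither [t] nor [eps], so for large [t] the bound is
    close to d / eps, and [d] is free. *)
Lemma event_number_concentration (A : set X) (d : R) : measurable A -> (0 < d)%R ->
  exists B : R, (0 <= B)%R /\ forall t eps : R, (0 < t)%R -> (0 < eps)%R ->
    P [set w | (eps * t <= `|(event_number t A w)%:R - rate * fine (Q A) * t|)%R] <=
    ((B + d * t) / (eps * t))%:E.
Proof.
move=> mA d0.
have k0 : (0 < (1 - q)^-1)%R by rewrite invr_gt0 subr_gt0.
set K0 := (1 - q)^-1%R in k0 *.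
have C0 : (0 <= rate)%R by exact: (rate_ge0 m q_lt1).
(* The sum of [rho] over the marks and [rq] times the compensator each have mean at most e rate t,
   weighted by [K0]. This [e] keeps their total slope below d / 2; the 1 covers a zero rate. *)
pose e := (d / (4 * K0 * (rate + 1)))%R.
have e0 : (0 < e)%R by rewrite divr_gt0// mulr_gt0 ?mulr_gt0// ltr_wpDl.
have massq : \int[Q]_x mass f x = q%:E by rewrite (integral_mass Q f_meas).
have [p [y [B [rho [By [mrho rho0] massE rhoe qE']]]]] :=
  simple_minorant (measurable_mass f_meas) (@mass_ge0 _ _ _ f) massq e0.
have rhofin : \int[Q]_x rho x \is a fin_num.
  by rewrite ge0_fin_numE ?integral_ge0// (le_lt_trans rhoe)// ltry.
pose rq := fine (\int[Q]_x rho x).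
have rqE : \int[Q]_x rho x = rq%:E by rewrite fineK.
have rq0 : (0 <= rq)%R by rewrite fine_ge0// integral_ge0.
have rqe : (rq <= e)%R by rewrite -lee_fin -rqE.
rewrite rqE in qE'.
have y0 i : (0 <= y i)%R by case: (By i).
have mB i : measurable (B i) by case: (By i).
pose Ys := (\sum_(0 <= i < p) y i)%R.
have Ys0 : (0 <= Ys)%R by apply: sumr_ge0.
have KY : (0 < 1 + K0 * Ys)%R by rewrite ltr_wpDr// mulr_ge0// ltW.
(* Chosen after the simple function, since the centered terms carry the total weight 1 + K0 Ys;
   their slope in [t] becomes exactly d / 2. *)
pose e' := (d / (2 * (1 + K0 * Ys)))%R.
have e'0 : (0 < e')%R by rewrite divr_gt0// mulr_gt0.
have momfin : \int[mu]_s (s%:E * F s) \is a fin_num.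
  rewrite ge0_fin_numE//; apply: integral_ge0 => s _.
  have [s0|s0] := leP s 0%R; first by rewrite mean_causal_le0// mule0.
  by rewrite mule_ge0 ?mean_causal_ge0// lee_fin ltW.
pose D := fine (\int[mu]_s (s%:E * F s)).
have D0 : (0 <= D)%R.
  rewrite fine_ge0//; apply: integral_ge0 => s _.
  have [s0|s0] := leP s 0%R; first by rewrite mean_causal_le0// mule0.
  by rewrite mule_ge0 ?mean_causal_ge0// lee_fin ltW.
(* The contributions that do not grow with [t]: rate / e' from each centered term, and the mean
   bound of the tails. *)
pose c := ((1 + K0 * Ys) * (rate / e') + K0 * (rate * D))%R.
exists c; split.
  apply: addr_ge0; apply: mulr_ge0.
  - exact: ltW.
  - by rewrite divr_ge0// ltW.
  - exact: ltW.
  - exact: mulr_ge0.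
move=> t eps t0 eps0; have t0' := ltW t0.
pose G k w := `|centered k t A w|%:E + K0%:E *
    (\sum_(0 <= i < p) (y i)%:E * `|centered k t (B i) w|%:E +
     (mark_sum k t rho w + (rq%:E * compensator k t w + tail_sum k t w))).
have mabs k (C : set X) : measurable C ->
    measurable_fun [set: Omega] (fun w => `|centered k t C w|%:E).
  move=> mC; apply/measurable_EFinP.
  exact: (measurableT_comp _ (measurable_centered k t mC)).
have Eabs k (C : set X) : measurable C ->
    \int[P]_w `|centered k t C w|%:E <= (rate / e' + e' * t)%:E.
  move=> mC; apply: expectation_abs_le => //; first exact: measurable_centered.
  exact: (expectation_centered_sqr x0 f_meas f_bounded N_hawkes q_lt1 qE mC k t0').
have msum k : measurable_fun [set: Omega]
    (fun w => \sum_(0 <= i < p) (y i)%:E * `|centered k t (B i) w|%:E).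
  by apply: emeasurable_sum => i; apply: emeasurable_funM => //; exact: mabs.
have sum0 k w : 0 <= \sum_(0 <= i < p) (y i)%:E * `|centered k t (B i) w|%:E.
  by apply: sume_ge0 => i _; rewrite mule_ge0 ?lee_fin.
have mrs k : measurable_fun [set: Omega] (mark_sum k t rho).
  exact: measurable_mark_sum.
have rs0 k w : 0 <= mark_sum k t rho w by exact: mark_sum_ge0.
have mcomp k := measurable_compensator N x0 m f_meas k t.
have mrc k : measurable_fun [set: Omega] (fun w => rq%:E * compensator k t w).
  by apply: emeasurable_funM => //; exact: mcomp.
have rc0 k w : 0 <= rq%:E * compensator k t w.
  by rewrite mule_ge0 ?compensator_ge0 ?lee_fin.
have mtail k := measurable_tail_sum N x0 f_meas k t.
have ta0 k w := tail_sum_ge0 N x0 f k t w.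
have mrct k : measurable_fun [set: Omega]
    (fun w => rq%:E * compensator k t w + tail_sum k t w).
  by apply: emeasurable_funD => //; exact: mtail.
have mrest k : measurable_fun [set: Omega]
    (fun w => mark_sum k t rho w + (rq%:E * compensator k t w + tail_sum k t w)).
  exact: emeasurable_funD.
have minner k : measurable_fun [set: Omega]
    (fun w => \sum_(0 <= i < p) (y i)%:E * `|centered k t (B i) w|%:E +
     (mark_sum k t rho w + (rq%:E * compensator k t w + tail_sum k t w))).
  exact: emeasurable_funD.
have rct0 k w : 0 <= rq%:E * compensator k t w + tail_sum k t w by exact: adde_ge0.
have rest0 k w : 0 <= mark_sum k t rho w + (rq%:E * compensator k t w + tail_sum k t w).
  exact: adde_ge0.
have inner0 k w : 0 <= \sum_(0 <= i < p) (y i)%:E * `|centered k t (B i) w|%:E +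
     (mark_sum k t rho w + (rq%:E * compensator k t w + tail_sum k t w)).
  exact: adde_ge0.
have k0' : 0 <= K0%:E by rewrite lee_fin ltW.
have mG k : measurable_fun [set: Omega] (G k).
  apply: emeasurable_funD; first exact: mabs.
  exact: emeasurable_funM.
have G0 k w : 0 <= G k w by rewrite adde_ge0// ?lee_fin// mule_ge0.
have EG k : \int[P]_w G k w <= (c + d * t)%:E.
  have Ec := expectation_compensator_le x0 f_meas f_bounded N_hawkes q_lt1 qE k t0'.
  have Er : \int[P]_w mark_sum k t rho w <= (e * (rate * t))%:E.
    rewrite (expectation_mark_sum x0 f_meas f_bounded N_hawkes)// EFinM.
    apply: lee_pmul => //; first exact: integral_ge0.
    by apply: integral_ge0 => w _; exact: compensator_ge0.
  have Erc : \int[P]_w (rq%:E * compensator k t w) <= (e * (rate * t))%:E.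
    rewrite ge0_integralZl//; last by move=> w _; exact: compensator_ge0.
    rewrite EFinM; apply: lee_pmul => //; rewrite ?lee_fin//.
    by apply: integral_ge0 => w _; exact: compensator_ge0.
  have Et : \int[P]_w tail_sum k t w <= (rate * D)%:E.
    rewrite EFinM fineK//.
    exact: (expectation_tail_sum x0 f_meas f_bounded N_hawkes q_lt1 qE k t0').
  have Es : \int[P]_w (\sum_(0 <= i < p) (y i)%:E * `|centered k t (B i) w|%:E) <=
      (Ys * (rate / e' + e' * t))%:E.
    rewrite ge0_integral_sum//; last 2 first.
    - by move=> i; apply: emeasurable_funM => //; exact: mabs.
    - by move=> i w _; rewrite mule_ge0 ?lee_fin.
    rewrite mulr_suml -sumEFin; apply: lee_sum => i _.
    rewrite ge0_integralZl ?lee_fin//; last exact: mabs.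
    by rewrite EFinM lee_wpmul2l ?lee_fin//; exact: Eabs.
  rewrite ge0_integralD//; last 3 first.
  - exact: mabs.
  - by move=> w _; rewrite mule_ge0.
  - exact: emeasurable_funM.
  rewrite ge0_integralZl// ge0_integralD// ge0_integralD// ge0_integralD//.
  apply: (@le_trans _ _ ((rate / e' + e' * t)%:E + K0%:E *
    ((Ys * (rate / e' + e' * t))%:E + ((e * (rate * t))%:E +
      ((e * (rate * t))%:E + (rate * D)%:E))))).
    apply: leeD; first exact: Eabs.
    apply: lee_wpmul2l => //; apply: leeD => //; apply: leeD => //.
    exact: leeD.
  rewrite -!EFinD lee_fin /c.
  have e1 : ((1 + K0 * Ys) * e' = d / 2)%R by rewrite /e'; field; rewrite gt_eqF.
  have e2 : (K0 * (2 * (e * rate)) <= d / 2)%R.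
    have -> : (K0 * (2 * (e * rate)) = d / 2 * (rate / (rate + 1)))%R.
      by rewrite /e; field; rewrite !gt_eqF// ltr_wpDl.
    rewrite -[leRHS]mulr1; apply: ler_wpM2l; first by rewrite ltW// divr_gt0.
    by rewrite ler_pdivrMr ?mul1r ?lerDl// ltr_wpDl.
  have -> : (rate / e' + e' * t + K0 * (Ys * (rate / e' + e' * t) +
     (e * (rate * t) + (e * (rate * t) + rate * D))) =
     ((1 + K0 * Ys) * (rate / e') + K0 * (rate * D)) +
     ((1 + K0 * Ys) * e' + K0 * (2 * (e * rate))) * t)%R by ring.
  by rewrite lerD2l ler_wpM2r// e1; lra.
have mdev : measurable
    [set w | (eps * t <= `|(event_number t A w)%:R - rate * fine (Q A) * t|)%R].
  apply: measurable_pred; apply: measurable_fun_ler => //.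
  apply: measurableT_comp => //; apply: measurable_funB => //.
  exact: measurable_event_number.
(* The stopping index enters only through P(T_k <= t), which is at most [z] for the chosen [k]; the
   other bound is the same for all [k]. *)
apply/lee_addgt0Pr => z z0.
pose k := Num.truncn (rate * t / z).
have kz : (k.+1%:R^-1 * (rate * t) <= z)%R.
  rewrite ler_pdivrMl// ltW// -ltr_pdivrMr//.
  exact: truncnS_gt.
have et0 : (0 < eps * t)%R by exact: mulr_gt0.
have mT : measurable [set w | T k w <= t%:E].
  rewrite -[X in measurable X]setTI; exact: measurable_lee.
have mGs : measurable [set w | (eps * t)%:E <= G k w].
  rewrite -[X in measurable X]setTI; exact: measurable_lee.
apply: (@le_trans _ _ (P ([set w | (eps * t)%:E <= G k w] `|` [set w | T k w <= t%:E]))).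
  apply: le_measure; rewrite ?inE//; first exact: measurableU.
  move=> w /= dev; case: (leP (T k w) t%:E) => tk; [by right|left].
  apply: le_trans (event_number_deviation t0' mA tk By (conj mrho rho0) massE rq0 qE').
  by rewrite lee_fin.
apply: (le_trans (measureU2 _ _ _)) => //; apply: leeD.
  apply: le_trans (markov_le (mG k) (G0 k) et0 (EG k)) _.
  by rewrite -EFinM lee_fin mulrC.
by apply: (le_trans (stop_probability k t0')); rewrite lee_fin.
Qed.

End law_of_large_numbers.

(** * The resolvent *)

Section resolvent.
Context (R : realType).
Variables (F r : R -> R) (Fe : R -> \bar R) (M q : R).
Local Open Scope ereal_scope.
Local Notation mu := (@lebesgue_measure R).
Hypothesis mFe : measurable_fun [set: R] Fe.
Hypothesis FeE : forall t, (0 < t)%R -> Fe t = (F t)%:E.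
Hypothesis Fe0 : forall t, (t <= 0)%R -> Fe t = 0.
Hypothesis F_ge0 : forall t, (0 <= F t)%R.
Hypothesis F_le : forall t, (0 < t)%R -> (F t <= M)%R.
Hypothesis q_lt1 : (q < 1)%R.
Hypothesis FqE : \int[mu]_t Fe t = q%:E.
Hypothesis Hr : is_resolvent F r.

Let Fe_ge0 t : 0 <= Fe t.
Proof.
by have [t0|t0] := leP t 0%R; [rewrite Fe0|rewrite FeE// lee_fin].
Qed.

Let abs_r (t : R) : \bar R := ind (0 < t)%R * `|r t|%:E.
Let pos_r (t : R) : \bar R := ind (0 < t)%R * (Num.max (r t) 0%R)%:E.

Let abs_r_ge0 t : 0 <= abs_r t.
Proof. by rewrite indM_ge0// lee_fin. Qed.

Let pos_r_ge0 t : 0 <= pos_r t.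
Proof. by rewrite indM_ge0// lee_fin le_max lexx orbT. Qed.

Let pos_r_le t : pos_r t <= abs_r t.
Proof. by rewrite lee_wpmul2l ?ind_ge0// lee_fin ge_max normr_ge0 ler_norm. Qed.

Lemma measurable_ind_pos (g : R -> R) :
  measurable_fun (`[0%R, +oo[ : set R) g ->
  measurable_fun [set: R] (fun t => ind (0 < t)%R * (g t)%:E : \bar R).
Proof.
move=> mg.
have -> : (fun t => ind (0 < t)%R * (g t)%:E) = (EFin \o g) \_ `]0%R, +oo[%classic.
  apply/funext => t; rewrite patchE.
  have -> : (t \in `]0%R, +oo[%classic) = (0 < t)%R.
    by apply/idP/idP => [/set_mem|h]; [|apply/mem_set]; rewrite /= in_itv/= andbT.
  by case: ifP; rewrite ?mul1e ?mul0e.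
have mD : measurable (`]0%R, +oo[%classic : set R) by [].
apply/(measurable_restrictT _ mD)/measurable_EFinP.
apply: measurable_funS mg => // t; rewrite /= !in_itv/= !andbT; exact: ltW.
Qed.

Let mabs_r : measurable_fun [set: R] abs_r.
Proof.
have [mr _ _] := Hr; apply: (measurable_ind_pos (g := fun t => `|r t|%R)).
exact: measurableT_comp.
Qed.

Let mpos_r : measurable_fun [set: R] pos_r.
Proof.
have [mr _ _] := Hr; apply: (measurable_ind_pos (g := fun t => Num.max (r t) 0%R)).
exact: measurable_maxr.
Qed.

Let mFe2 : measurable_fun [set: R * R] (fun p => Fe (p.1 - p.2)%R).
Proof. by apply: (measurableT_comp mFe); exact: measurable_funB. Qed.

Let mFe_sub t : measurable_fun [set: R] (fun s => Fe (t - s)%R).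
Proof. by apply: (measurableT_comp mFe); exact: measurable_funB. Qed.

(** Tonelli and translation invariance: the integral of a convolution is the product of the
    integrals. *)
Lemma integral_convolution (h : R -> \bar R) : measurable_fun [set: R] h ->
  (forall t, 0 <= h t) ->
  \int[mu]_t \int[mu]_s (Fe (t - s)%R * h s) = q%:E * \int[mu]_t h t.
Proof.
move=> mh h0.
have mk : measurable_fun [set: R * R] (fun p => Fe (p.1 - p.2)%R * h p.2).
  by apply: emeasurable_funM => //; exact: (measurableT_comp mh measurable_snd).
rewrite (fubini_tonelli (m1 := mu) (m2 := mu) (fun p => Fe (p.1 - p.2)%R * h p.2))//=; last first.
  by move=> p; exact: mule_ge0.
rewrite -FqE -ge0_integralZl//; last by apply: integral_ge0.
apply: eq_integral => s _; rewrite ge0_integralZr//.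
- by rewrite (ge0_integral_shift (- s)%R mFe).
- by apply: (measurableT_comp mFe); exact: measurable_funB.
Qed.

Lemma measurable_convolution (h : R -> \bar R) : measurable_fun [set: R] h ->
  (forall t, 0 <= h t) ->
  measurable_fun [set: R] (fun t => \int[mu]_s (Fe (t - s)%R * h s)).
Proof.
move=> mh h0.
apply: (measurable_fun_fubini_tonelli_F (m2 := mu)
  (fun p : R * R => Fe (p.1 - p.2)%R * h p.2)).
  by apply: emeasurable_funM => //; exact: (measurableT_comp mh measurable_snd).
by move=> p; exact: mule_ge0.
Qed.

Let convolution_ge0 (g : R -> R) t : (forall s, 0 <= g s)%R -> (0 < t)%R ->
  \int[mu]_(s in `]0%R, t[) (F (t - s) * g s)%:E =
  \int[mu]_s (Fe (t - s)%R * (ind (0 < s)%R * (g s)%:E)).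
Proof.
move=> g0 t0.
rewrite (@integral_ind _ _ (measurableTypeR R) _ _ (fun s : R => 0 < s < t)%R); last first.
  by move=> s; rewrite /= in_itv.
apply: eq_integral => s _; have [s0|s0] := leP s 0%R; first by rewrite !mul0e mule0.
have [st|st] := ltP s t; last by rewrite Fe0 ?mul0e// subr_le0.
by rewrite FeE ?subr_gt0//= !mul1e EFinM.
Qed.

Let measurable_integrand t : (0 < t)%R ->
  measurable_fun (`]0%R, t[ : set R) (fun s => (F (t - s) * r s)%:E).
Proof.
move=> t0; have [mr _ _] := Hr; apply/measurable_EFinP/measurable_funM.
  apply/measurable_EFinP; apply: (eq_measurable_fun (fun s : R => Fe (t - s)%R)).
    move=> s /set_mem; rewrite /= in_itv/= => /andP[_ st].
    by rewrite FeE ?subr_gt0.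
  exact: measurable_funTS.
apply: measurable_funS mr => // s; rewrite /= !in_itv/= => /andP[/ltW -> _].
by [].
Qed.

Let convolutionE t : (0 < t)%R ->
  convolution F r t = fine (\int[mu]_(s in `]0%R, t[) (F (t - s) * r s)%:E).
Proof.
move=> t0; rewrite /convolution /Rintegral.
by rewrite integral_itv_bndoo//; exact: measurable_integrand.
Qed.

(** [convolution] is a [fine] and could be the default value 0; the bound survives in that case. *)
Let le_abs_fine (x y : \bar R) : `|x| <= y -> (`|fine x|%R)%:E <= y.
Proof.
by case: x => [x| |] //= h; rewrite normr0 (le_trans _ h)// leey.
Qed.

Let resolvent_abs_le t : abs_r t <= Fe t + \int[mu]_s (Fe (t - s)%R * abs_r s).
Proof.
have c0 : 0 <= \int[mu]_s (Fe (t - s)%R * abs_r s).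
  by apply: integral_ge0 => s _; exact: mule_ge0.
have [t0|t0] := leP t 0%R.
  by rewrite /abs_r ltNge t0 mul0e adde_ge0.
have [_ _ rE] := Hr.
rewrite /abs_r t0 mul1e FeE// (rE _ (ltW t0)).
apply: (@le_trans _ _ (`|F t|%:E + `|convolution F r t|%:E)).
  by rewrite -EFinD lee_fin [leRHS]addrC ler_normB.
rewrite ger0_norm// leeD2l// convolutionE//; apply: le_abs_fine.
apply: (le_trans (le_abse_integral mu (measurable_itv _) (measurable_integrand t0))).
rewrite le_eqVlt; apply/orP; left; apply/eqP.
rewrite -(convolution_ge0 (g := fun s => `|r s|%R))//.
by apply: eq_integral => s _; rewrite /= normrM ger0_norm.
Qed.

(* The positive part of [r] satisfies [u <= F * u] with [q < 1], so it vanishes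
   almost everywhere, and then [`|r| = F + F * `|r|]. *)
Let resolvent_pos_le t : pos_r t <= \int[mu]_s (Fe (t - s)%R * pos_r s).
Proof.
have c0 : 0 <= \int[mu]_s (Fe (t - s)%R * pos_r s).
  by apply: integral_ge0 => s _; exact: mule_ge0.
have [t0|t0] := leP t 0%R; first by rewrite {1}/pos_r ltNge t0 mul0e.
have [_ _ rE] := Hr.
rewrite {1}/pos_r t0 mul1e EFin_max ge_max c0 andbT (rE _ (ltW t0)).
apply: (@le_trans _ _ (convolution F r t)%:E).
  by rewrite lee_fin gerBl.
rewrite convolutionE// -(convolution_ge0 (g := fun s => Num.max (r s) 0%R))//; last first.
  by move=> s; rewrite le_max lexx orbT.
set I := \int[mu]_(s in _) _.
(* The maximum with 0 covers an infinite [I], whose [fine] is 0. *)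
apply: (@le_trans _ _ (maxe I 0)).
  by case: I => [x| |] /=; rewrite le_max ?lexx// orbT.
rewrite ge_max; apply/andP; split; last first.
  by apply: integral_ge0 => s _; rewrite lee_fin mulr_ge0// le_max lexx orbT.
rewrite /I integralE; apply: (@le_trans _ _ (\int[mu]_(s in `]0%R, t[)
    ((fun s => (F (t - s) * r s)%:E)^\+ s))).
  by rewrite geeDl// oppe_le0 integral_ge0.
rewrite le_eqVlt; apply/orP; left; apply/eqP; apply: eq_integral => s _.
rewrite funeposE -EFin_max; congr EFin.
by rewrite maxr_pMr// mulr0.
Qed.

(** Integrating the inequality gives I <= b q + q I, which can be solved because I is finite. It is
    used with b = 1 for |r| and with b = 0 for the positive part of r. *)
Let renewal_bound (h : R -> \bar R) (b : R) : measurable_fun [set: R] h ->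
  (forall t, 0 <= h t) -> \int[mu]_t h t < +oo -> (0 <= b)%R ->
  (forall t, h t <= b%:E * Fe t + \int[mu]_s (Fe (t - s)%R * h s)) ->
  \int[mu]_t h t <= (b * (q / (1 - q)))%:E.
Proof.
move=> mh h0 fin b0 hle.
have finh : \int[mu]_t h t \is a fin_num by rewrite ge0_fin_numE// integral_ge0.
have : \int[mu]_t h t <= (b * q)%:E + q%:E * \int[mu]_t h t.
  rewrite -integral_convolution// EFinM -FqE -ge0_integralZl ?lee_fin//.
  have c0 t : 0 <= \int[mu]_s (Fe (t - s)%R * h s).
    by apply: integral_ge0 => s _; exact: mule_ge0.
  rewrite -ge0_integralD//; last 3 first.
  - by move=> t _; rewrite mule_ge0 ?lee_fin.
  - exact: emeasurable_funM.
  - exact: measurable_convolution.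
  apply: ge0_le_integral => //.
  apply: emeasurable_funD; first exact: emeasurable_funM.
  exact: measurable_convolution.
rewrite -(fineK finh) -EFinM -EFinD !lee_fin mulrA ler_pdivlMr ?subr_gt0//.
by move=> hq; rewrite mulrBr mulr1 lerBlDr (mulrC (fine _)).
Qed.

(** Only local integrability of [r] is known, so |r| is cut at [n] before [renewal_bound] is
    applied, and monotone convergence removes the cut. The cut keeps the inequality, as the
    convolution at [t] involves only times s <= t. *)
Let integral_abs_r_le : \int[mu]_t abs_r t <= (q / (1 - q))%:E.
Proof.
pose g n t := ind (t <= n%:R)%R * abs_r t.
have g0 n t : 0 <= g n t by rewrite indM_ge0.
have mg n : measurable_fun [set: R] (g n).
  apply: emeasurable_funM => //; apply: measurable_ind; exact: measurable_fun_ler.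
have gle n t : g n t <= abs_r t.
  by rewrite -[leRHS]mul1e lee_wpmul2r// ind_le1.
have gbound n : \int[mu]_t g n t <= (q / (1 - q))%:E.
  rewrite -[X in X%:E]mul1r; apply: renewal_bound => //.
  - have [mr ir _] := Hr; have := ir n%:R (ler0n _ _) => /integrableP[_].
    apply: le_lt_trans.
    have -> : \int[mu]_t g n t = \int[mu]_(t in `]0%R, n%:R]) `|(EFin \o r) t|.
      rewrite [RHS](@integral_ind _ _ (measurableTypeR R) _ _
        (fun s : R => 0 < s <= n%:R)%R); last by move=> s; rewrite /= in_itv.
      by apply: eq_integral => s _; rewrite /g /abs_r muleA -ind_and andbC.
    apply: ge0_subset_integral => //.
    + apply: measurableT_comp => //; apply/measurable_EFinP.
      by apply: measurable_funS mr => // s; rewrite /= !in_itv/= => /andP[->].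
    + by move=> s; rewrite /= !in_itv/= => /andP[/ltW -> ->].
  - move=> t; rewrite mul1e /g; have [tn|tn] := leP t n%:R; last first.
      rewrite mul0e adde_ge0// integral_ge0// => s _; rewrite mule_ge0//.
      by rewrite indM_ge0.
    rewrite mul1e; apply: le_trans (resolvent_abs_le t) _; rewrite leeD2l//.
    rewrite le_eqVlt; apply/orP; left; apply/eqP; apply: eq_integral => s _.
    have [st|st] := leP s t; last by rewrite Fe0 ?mul0e// subr_le0 ltW.
    by rewrite (le_trans st tn) mul1e.
rewrite (_ : \int[mu]_t abs_r t = \int[mu]_t limn (g^~ t)).
  have nd t : nondecreasing_seq (g^~ t).
    move=> a b ab; rewrite lee_wpmul2r// le_ind//; apply/implyP => /le_trans; apply.
    by rewrite ler_nat.
  rewrite monotone_convergence//; apply: lime_le; last exact: nearW.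
  apply: ereal_nondecreasing_is_cvgn => a b ab.
  apply: ge0_le_integral => //; [exact: mg|exact: mg|].
  by move=> t _; exact: nd.
apply: eq_integral => t _; apply/esym/cvg_lim => //.
apply: cvg_near_cst; exists (Num.truncn t).+1 => // n /= tn.
rewrite /g (_ : (t <= n%:R)%R) ?mul1e//.
apply: ltW; apply: lt_le_trans (truncnS_gt t) _; by rewrite ler_nat.
Qed.

Let integral_abs_r_fin : \int[mu]_t abs_r t < +oo.
Proof. exact: le_lt_trans integral_abs_r_le (ltry _). Qed.

Let pos_r_eq0 : ae_eq mu setT pos_r (cst 0).
Proof.
apply/ae_eq_integral_abs => //; apply/eqP; rewrite eq_le; apply/andP; split.
  under eq_integral do rewrite gee0_abs//.
  rewrite -[leRHS]/((0%R)%:E) -(mul0r (q / (1 - q))%R).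
  apply: renewal_bound => //.
    apply: le_lt_trans integral_abs_r_fin; exact: ge0_le_integral.
  by move=> t; rewrite mul0e add0e.
exact: integral_ge0.
Qed.

(** Almost everywhere r <= 0, hence F * r = - F * |r| at every positive time, and r = - (F + F *
    |r|). The bound on F makes the convolution finite, so that [fine] is exact. *)
Let abs_rE t : abs_r t = Fe t + \int[mu]_s (Fe (t - s)%R * abs_r s).
Proof.
have [t0|t0] := leP t 0%R.
  rewrite /abs_r ltNge t0 mul0e Fe0// add0e integral0_eq// => s _.
  have [s0|s0] := leP s 0%R; first by rewrite mul0e mule0.
  by rewrite Fe0 ?mul0e// (le_trans _ t0)// gerBl ltW.
have [mr _ rE] := Hr.
set c := \int[mu]_s _.
have c0 : 0 <= c by apply: integral_ge0 => s _; exact: mule_ge0.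
have M0 : (0 <= M)%R by rewrite (le_trans (F_ge0 1)) ?F_le.
have FM s : Fe s <= M%:E.
  have [s0|s0] := leP s 0%R; first by rewrite Fe0// lee_fin.
  by rewrite FeE// lee_fin F_le.
have cfin : c \is a fin_num.
  rewrite ge0_fin_numE//; apply: (@le_lt_trans _ _ (\int[mu]_s (M%:E * abs_r s))).
    apply: ge0_le_integral => //.
    - by move=> s _; exact: mule_ge0.
    - by apply: emeasurable_funM; [exact: mFe_sub|exact: mabs_r].
    - by apply: emeasurable_funM; [exact: measurable_cst|exact: mabs_r].
    - by move=> s _; rewrite lee_wpmul2r.
  rewrite ge0_integralZl ?lee_fin// lte_mul_pinfty ?lee_fin//.
have -> : abs_r t = `|r t|%:E by rewrite /abs_r t0 mul1e.
have IE : \int[mu]_(s in `]0%R, t[) (F (t - s) * r s)%:E = - c.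
  rewrite /c -(convolution_ge0 (g := fun s => `|r s|%R))//.
  rewrite -integral_ge0N; last by move=> s _; rewrite lee_fin mulr_ge0.
  apply: ae_eq_integral => //.
  - exact: measurable_integrand.
  - apply: (eq_measurable_fun (fun s : R => - `|(F (t - s) * r s)%:E|)).
      by move=> s _; rewrite /= normrM ger0_norm.
    apply: measurableT_comp => //; apply: measurableT_comp => //.
    exact: measurable_integrand.
  - apply: filterS pos_r_eq0 => s /(_ I) ps; rewrite /= in_itv/= => /andP[s0 _].
    move: ps; rewrite /pos_r s0 mul1e /= => -[] ps.
    have r0 : (r s <= 0)%R by rewrite -ps le_max lexx.
    by rewrite ler0_norm// mulrN opprK.
rewrite (rE _ (ltW t0)) convolutionE// IE FeE// -[in RHS](fineK cfin) -EFinD fineN.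
by congr EFin; rewrite -opprD normrN addrC ger0_norm// addr_ge0// fine_ge0.
Qed.

Lemma L1norm_resolvent : L1norm (fun t => - r t)%R = (q / (1 - q))%:E.
Proof.
have [mr _ _] := Hr.
have -> : L1norm (fun t => - r t)%R = \int[mu]_t abs_r t.
  rewrite /L1norm -integral_itv_obnd_cbnd; last first.
    apply: measurableT_comp => //; apply/measurable_EFinP.
    apply: measurableT_comp => //; apply: measurable_funS mr => // s.
    by rewrite /= !in_itv/= !andbT => /ltW.
  rewrite (@integral_ind _ _ (measurableTypeR R) _ _ (fun s : R => 0 < s)%R); last first.
    by move=> s; rewrite /= in_itv/= andbT.
  by apply: eq_integral => s _; rewrite /= normrN.
have finr : \int[mu]_t abs_r t \is a fin_num.
  by rewrite ge0_fin_numE ?integral_ge0// integral_abs_r_fin.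
have : \int[mu]_t abs_r t = q%:E + q%:E * \int[mu]_t abs_r t.
  rewrite -integral_convolution// -FqE -ge0_integralD//.
  - by apply: eq_integral => t _; exact: abs_rE.
  - by move=> t _; apply: integral_ge0 => s _; exact: mule_ge0.
  - exact: measurable_convolution.
rewrite -(fineK finr) -EFinM -EFinD => -[] e; congr EFin.
apply: (@mulIf _ (1 - q)%R); first by rewrite gt_eqF// subr_gt0.
rewrite divfK ?gt_eqF ?subr_gt0// mulrBr mulr1 {1}e; ring.
Qed.

End resolvent.

(** * Random sums of independent variables *)

Section iid_sums.
Context (R : realType) d (S : measurableType d) (P : probability S R).
Variable Z : nat -> {RV P >-> R}.
Hypothesis Z_independent : mutually_independent Z.
Hypothesis Z_identical : identically_distributed Z.
Hypothesis Z_integrable : forall n, P.-integrable [set: S] (EFin \o Z n).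
Local Open Scope ereal_scope.

Let mZ n : measurable_fun [set: S] (Z n).
Proof. exact: measurable_funP. Qed.

Lemma ge0_expectation_identical (h : R -> \bar R) n :
  measurable_fun [set: R] h -> (forall x, 0 <= h x) ->
  \int[P]_w h (Z n w) = \int[P]_w h (Z 0%N w).
Proof.
move=> mh h0.
rewrite -(ge0_integral_distribution (Z n) mh h0) -(ge0_integral_distribution (Z 0%N) mh h0).
by apply: eq_measure_integral => A mA _; exact: Z_identical.
Qed.

Lemma expectation_identical (h : R -> R) n : measurable_fun [set: R] h ->
  (forall k, P.-integrable [set: S] (EFin \o (h \o Z k))) ->
  \int[P]_w (h (Z n w))%:E = \int[P]_w (h (Z 0%N w))%:E.
Proof.
move=> mh ih.
have mh' : measurable_fun [set: R] (EFin \o h) by exact/measurable_EFinP.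
rewrite -(integral_distribution (X := Z n) mh' (ih n)).
rewrite -(integral_distribution (X := Z 0%N) mh' (ih 0%N)).
by apply: eq_measure_integral => A mA _; exact: Z_identical.
Qed.

Lemma independent_pair i j (A B : set R) : i != j -> measurable A -> measurable B ->
  P ((Z i @^-1` A) `&` (Z j @^-1` B)) = P (Z i @^-1` A) * P (Z j @^-1` B).
Proof.
move=> ij mA mB; pose U k := if k == i then A else B.
have := @Z_independent [:: i; j] U; rewrite /= inE ij => /(_ isT).
rewrite big_cons big_seq1 /U eqxx eq_sym (negbTE ij) => <-.
  congr (P _); apply/seteqP; split=> w /=.
    move=> [Aw Bw] k /=; rewrite !inE => /orP[] /eqP ->; rewrite ?eqxx//.
    by rewrite eq_sym (negbTE ij).
  move=> H; split.
    by have := H i; rewrite /= inE eqxx; apply.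
  by have := H j; rewrite /= !inE eqxx orbT eq_sym (negbTE ij); apply.
by move=> k; case: ifP.
Qed.

Section bounded.
Variables (h : R -> R) (K : R).
Hypothesis mh : measurable_fun [set: R] h.
Hypothesis h_le : forall x, (`|h x| <= K)%R.
Hypothesis h_mean0 : \int[P]_w (h (Z 0%N w))%:E = 0.

Let K0 : (0 <= K)%R.
Proof. exact: le_trans (h_le 0%R). Qed.

Lemma bounded_integrable d' (S' : measurableType d') (P' : probability S' R)
    (g : S' -> R) (C : R) : measurable_fun [set: S'] g ->
  (forall x, (`|g x| <= C)%R) -> P'.-integrable [set: S'] (EFin \o g).
Proof.
move=> mg gC; apply: measurable_bounded_integrable => //.
  by rewrite (le_lt_trans (probability_le1 _ _))// ltry.
exists C; split; first by rewrite num_real.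
by move=> M CM x _ /=; apply: le_trans (gC x) (ltW CM).
Qed.

Let ih n : P.-integrable [set: S] (EFin \o (h \o Z n)).
Proof.
apply: (@bounded_integrable _ _ P (h \o Z n) K) => [|w]; last exact: h_le.
exact: measurableT_comp.
Qed.

(** The joint law agrees with the product of the marginals on rectangles, hence everywhere, and the
    inner integral of Fubini's theorem is the zero mean. *)
Lemma expectation_pair0 i j : i != j ->
  \int[P]_w (h (Z i w) * h (Z j w))%:E = 0.
Proof.
move=> ij.
pose phi w := (Z i w, Z j w).
have mphi : measurable_fun [set: S] phi by exact: measurable_fun_pair.
pose k (p : R * R) := (h p.1 * h p.2)%R.
have mk : measurable_fun [set: R * R] k.
  by apply: measurable_funM; exact: measurableT_comp.
have kK p : (`|k p| <= K * K)%R by rewrite normrM ler_pM.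
have mk' : measurable_fun [set: R * R] (EFin \o k) by exact/measurable_EFinP.
have ik : P.-integrable (phi @^-1` setT) ((EFin \o k) \o phi).
  apply: (@bounded_integrable _ _ P (k \o phi) (K * K)%R) => [|w]; last exact: kK.
  exact: measurableT_comp.
have := integral_pushforward mphi mk' ik measurableT.
rewrite preimage_setT => E.
pose m1 := distribution P (Z i); pose m2 := distribution P (Z j).
have E2 : \int[(m1 \x m2)%E]_p (EFin \o k) p = \int[pushforward P phi]_p (EFin \o k) p.
  apply: eq_measure_integral => A mA _.
  apply: product_measure_unique => // A1 A2 mA1 mA2.
  exact: independent_pair.
transitivity (\int[(m1 \x m2)%E]_p (EFin \o k) p); first by rewrite E2 E.
have fin12 : (m1 \x m2)%E [set: R * R] < +oo.
  rewrite -setXTT product_measure1E//.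
  by rewrite -ge0_fin_numE ?mule_ge0// fin_numM// fin_num_measure.
have ik' : (m1 \x m2)%E.-integrable [set: R * R] (EFin \o k).
  apply: measurable_bounded_integrable => //.
  exists (K * K)%R; split; first by rewrite num_real.
  by move=> M CM x _ /=; apply: le_trans (kK x) (ltW CM).
rewrite -integral12_prod_meas1//= integral0_eq// => x _; rewrite /fubini_F /k/=.
have ihj : m2.-integrable [set: R] (EFin \o h).
  apply: (@bounded_integrable _ _ m2 h K) => //.
under eq_integral do rewrite EFinM.
rewrite integralZl// (_ : \int[m2]_y (h y)%:E = 0) ?mule0//.
rewrite -h_mean0 -(expectation_identical j mh ih).
have mhE : measurable_fun [set: R] (EFin \o h) by exact/measurable_EFinP.
by rewrite -(integral_distribution (X := Z j) mhE (ih j)).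
Qed.

(** Off-diagonal terms have mean zero; each of the [n] diagonal ones is at most K^2. *)
Lemma expectation_sum_sqr_le n :
  \int[P]_w ((\sum_(i < n) h (Z i w))%R ^+ 2)%:E <= ((K ^+ 2) * n%:R)%:E.
Proof.
have mhZ i : measurable_fun [set: S] (fun w => h (Z i w)) by exact: measurableT_comp.
have ip i j : P.-integrable [set: S] (fun w => (h (Z i w) * h (Z j w))%:E).
  apply: (@bounded_integrable _ _ P (fun w => h (Z i w) * h (Z j w))%R (K * K)%R).
    exact: measurable_funM.
  by move=> w; rewrite normrM ler_pM.
under eq_integral.
  move=> w _.
  have -> : ((\sum_(i < n) h (Z i w))%R ^+ 2)%:E =
      \sum_(i < n) \sum_(j < n) (h (Z i w) * h (Z j w))%:E.
    rewrite expr2 mulr_suml -sumEFin; apply: eq_bigr => i _.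
    by rewrite mulr_sumr -sumEFin.
  over.
rewrite integral_sum//; last first.
  by move=> i; apply: integrable_sum => // j _; exact: ip.
apply: (@le_trans _ _ (\sum_(i < n) (K ^+ 2)%:E)); last first.
  by rewrite sumEFin lee_fin sumr_const card_ord mulr_natr.
apply: lee_sum => i _; rewrite integral_sum//.
rewrite (bigD1 i)//= big1 ?adde0 => [|j ji]; last first.
  by rewrite expectation_pair0// eq_sym.
apply: (@le_trans _ _ (\int[P]_w (K ^+ 2)%:E)).
  apply: ge0_le_integral => //.
  - by move=> w _; rewrite lee_fin -expr2 sqr_ge0.
  - by apply/measurable_EFinP; exact: measurable_funM.
  move=> w _; rewrite lee_fin -expr2 -(real_normK (num_real _)).
  by rewrite ler_sqr ?nnegrE.
by rewrite integral_cst_probability.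
Qed.

End bounded.

Let mean := fine (\int[P]_w (Z 0%N w)%:E).

Let meanE : \int[P]_w (Z 0%N w)%:E = mean%:E.
Proof. by rewrite fineK//; exact: (integrable_fin_num measurableT (Z_integrable 0%N)). Qed.

(** The variables have only a first moment; truncation provides the second moment that orthogonality
    needs. *)
Let trunc (c x : R) : R := if (`|x| <= c)%R then x else 0%R.

Let mtrunc c : measurable_fun [set: R] (trunc c).
Proof.
apply: measurable_fun_ifT => //; apply: measurable_fun_ler => //.
Qed.

Let truncation (e : R) : (0 < e)%R -> exists2 c : R, (0 <= c)%R &
  \int[P]_w (`|trunc c (Z 0%N w) - Z 0%N w|)%:E <= e%:E.
Proof.
move=> e0.
have h1 n : measurable_fun [set: S] (fun w => (trunc n%:R (Z 0%N w))%:E).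
  by apply/measurable_EFinP; exact: (measurableT_comp (mtrunc _)).
have h2 : measurable_fun [set: S] (EFin \o Z 0%N) by exact/measurable_EFinP.
have h3 : {ae P, forall w, [set: S] w ->
    (trunc n%:R (Z 0%N w))%:E @[n --> \oo] --> (EFin \o Z 0%N) w}.
  apply: aeW => w _; apply: cvg_near_cst; exists (Num.truncn `|Z 0%N w|).+1 => // n /= zn.
  rewrite /trunc ifT//; apply: ltW; apply: lt_le_trans (truncnS_gt _) _.
  by rewrite ler_nat.
have h4 : P.-integrable [set: S] (abse \o (EFin \o Z 0%N)) by exact: integrable_abse.
have h5 : {ae P, forall w n, [set: S] w ->
    `|(trunc n%:R (Z 0%N w))%:E| <= (abse \o (EFin \o Z 0%N)) w}.
  apply: aeW => w n _; rewrite /= lee_fin /trunc; case: ifP => // _.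
  by rewrite normr0.
have [_ cv _] := dominated_convergence measurableT h1 h2 h3 h4 h5.
have [n un] : exists n, \int[P]_w `|(trunc n%:R (Z 0%N w))%:E - (Z 0%N w)%:E| <= e%:E.
  apply/not_existsP => H; have : e%:E <= 0.
    rewrite -(cvg_lim _ cv)//; apply: lime_ge; first by apply/cvg_ex; exists 0.
    by apply: nearW => n; rewrite ltW// ltNge; apply/negP/H.
  by rewrite lee_fin leNgt e0.
by exists n%:R.
Qed.

(** An L1 law of large numbers, in the affine form required when [n] is replaced by a random count.
    The centered truncations are handled by their variance, the truncation errors by their first
    moment. *)
Lemma iid_sum_deviation (e : R) : (0 < e)%R -> exists B : R, (0 <= B)%R /\
  forall n, \int[P]_w (`|\sum_(i < n) Z i w - n%:R * mean|%R)%:E <=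
    (B + e * n%:R)%:E.
Proof.
(* Each summand may lose e / 4 to truncation and e / 4 to the shift of the mean; the remaining slope
   e / 2 goes to the variance term. *)
move=> e0; have e4 : (0 < e / 4)%R by rewrite divr_gt0.
have e2 : (0 < e / 2)%R by rewrite divr_gt0.
have [c c0 tr] := truncation e4.
have trunc_le x : (`|trunc c x| <= c)%R.
  by rewrite /trunc; case: ifP => //; rewrite normr0.
have itr n : P.-integrable [set: S] (EFin \o (trunc c \o Z n)).
  apply: (@bounded_integrable _ _ P (trunc c \o Z n) c) => [|w]; last exact: trunc_le.
  exact: measurableT_comp.
pose au := fine (\int[P]_w (trunc c (Z 0%N w))%:E).
have auE : \int[P]_w (trunc c (Z 0%N w))%:E = au%:E.
  by rewrite fineK//; exact: (integrable_fin_num measurableT (itr 0%N)).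
pose h x := (trunc c x - au)%R.
have mh : measurable_fun [set: R] h by exact: measurable_funB.
have hK x : (`|h x| <= c + `|au|)%R.
  by rewrite (le_trans (ler_normB _ _))// lerD2r.
have h0 : \int[P]_w (h (Z 0%N w))%:E = 0.
  under eq_integral do rewrite EFinB.
  rewrite (integralB_EFin measurableT (itr 0%N)); last first.
    exact: finite_measure_integrable_cst.
  by rewrite auE integral_cst_probability subee.
have dm : (`|mean - au| <= e / 4)%R.
  rewrite -lee_fin; apply: le_trans tr.
  have iB : P.-integrable [set: S] (fun w => (trunc c (Z 0%N w) - Z 0%N w)%:E).
    exact: (integrableB measurableT (itr 0%N) (Z_integrable 0%N)).
  have -> : (`|mean - au|)%:E = `|\int[P]_w (trunc c (Z 0%N w) - Z 0%N w)%:E|.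
    under eq_integral do rewrite EFinB.
    by rewrite (integralB_EFin measurableT (itr 0%N))// auE meanE distrC.
  exact: (le_abse_integral P measurableT (measurable_int P iB)).
pose K := (c + `|au|)%R.
exists (K ^+ 2 / (e / 2))%R; split.
  by rewrite divr_ge0 ?sqr_ge0// ltW.
(* [expectation_abs_le] requires a positive time parameter, here [n]. *)
move=> n; have [->|n0] := posnP n.
  under eq_integral do rewrite big_ord0 mul0r subr0 normr0.
  by rewrite integral0 mulr0 addr0 lee_fin divr_ge0 ?sqr_ge0// ltW.
have nR0 : (0 < n%:R :> R)%R by rewrite ltr0n.
have mhs : measurable_fun [set: S] (fun w => \sum_(i < n) h (Z i w))%R.
  by apply: measurable_sum => i; exact: measurableT_comp.
have mabs i : measurable_fun [set: S] (fun w => (`|trunc c (Z i w) - Z i w| + e / 4)%R%:E).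
  apply/measurable_EFinP; apply: measurable_funD => //; apply: measurableT_comp => //.
  by apply: measurable_funB => //; exact: measurableT_comp.
have abs0 i w : 0 <= (`|trunc c (Z i w) - Z i w| + e / 4)%R%:E.
  by rewrite lee_fin addr_ge0// ltW.
apply: (@le_trans _ _ (\int[P]_w ((`|\sum_(i < n) h (Z i w)|)%R%:E +
    \sum_(i < n) (`|trunc c (Z i w) - Z i w| + e / 4)%R%:E))).
  apply: ge0_le_integral => //.
  - apply/measurable_EFinP; apply: measurableT_comp => //; apply: measurable_funB => //.
    exact: measurable_sum.
  - apply: emeasurable_funD; last exact: emeasurable_sum.
    by apply/measurable_EFinP; exact: measurableT_comp.
  move=> w _; rewrite sumEFin -EFinD lee_fin.
  have -> : (\sum_(i < n) Z i w - n%:R * mean =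
      \sum_(i < n) h (Z i w) + \sum_(i < n) (Z i w - trunc c (Z i w) - (mean - au)))%R.
    rewrite -big_split/= mulr_natl -[in X in (_ - X)%R](card_ord n) -sumr_const -sumrB.
    by apply: eq_bigr => i _; rewrite /h; ring.
  apply: le_trans (ler_normD _ _) _; rewrite lerD2l.
  apply: le_trans (ler_norm_sum _ _ _) _; apply: ler_sum => i _.
  by apply: le_trans (ler_normB _ _) _; rewrite distrC lerD2l.
rewrite ge0_integralD//; last 3 first.
- by apply/measurable_EFinP; exact: measurableT_comp.
- by move=> w _; apply: sume_ge0 => i _.
- exact: emeasurable_sum.
have -> : (K ^+ 2 / (e / 2) + e * n%:R =
    (K ^+ 2 / (e / 2) + e / 2 * n%:R) + (e / 2) * n%:R)%R by field; rewrite gt_eqF.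
rewrite EFinD; apply: leeD.
  by apply: expectation_abs_le => //; exact: expectation_sum_sqr_le.
rewrite ge0_integral_sum//.
apply: (@le_trans _ _ (\sum_(i < n) (e / 2)%:E)); last first.
  by rewrite sumEFin lee_fin sumr_const card_ord mulr_natr.
apply: lee_sum => i _.
under eq_integral do rewrite EFinD.
have mabs' : measurable_fun [set: R] (fun x : R => (`|trunc c x - x|)%R%:E).
  apply/measurable_EFinP; apply: measurableT_comp => //; exact: measurable_funB.
rewrite ge0_integralD//; last 2 first.
- exact: (measurableT_comp mabs' (mZ i)).
- by move=> w _; rewrite lee_fin ltW.
rewrite integral_cst_probability (ge0_expectation_identical i mabs')//.
by apply: (le_trans (leeD tr (lexx _))); rewrite -EFinD lee_fin; lra.
Qed.

End iid_sums.

Section random_sum.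
Context (R : realType) d (S : measurableType d) (P : probability S R).
Variable Z : nat -> {RV P >-> R}.
Hypothesis Z_independent : mutually_independent Z.
Hypothesis Z_identical : identically_distributed Z.
Hypothesis Z_integrable : forall n, P.-integrable [set: S] (EFin \o Z n).
Local Open Scope ereal_scope.
Local Notation mean := (fine (\int[P]_w (Z 0%N w)%:E)).

Lemma sigma_sequence_partial_sum n (D : set R) : measurable D ->
  sigma_sequence Z ((fun w => \sum_(i < n) Z i w)%R @^-1` D).
Proof.
move=> mD.
pose G := \bigcup_n preimage_set_system setT (Z n) measurable.
have mZ i : measurable_fun [set: g_sigma_algebraType G] (Z i : g_sigma_algebraType G -> R).
  move=> _ Y mY; apply: sub_sigma_algebra; exists i => //.
  by exists Y.
have ms : measurable_fun [set: g_sigma_algebraType G] (fun w => \sum_(i < n) Z i w)%R.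
  by apply: measurable_sum => i; exact: mZ.
by have := ms measurableT D mD; rewrite setTI.
Qed.

Lemma measurable_random_sum (cnt : S -> nat) :
  (forall n, measurable [set w | cnt w = n]) ->
  measurable_fun [set: S] (fun w => \sum_(i < cnt w) Z i w)%R.
Proof.
move=> mcnt _ Y mY; rewrite setTI.
have -> : (fun w => \sum_(i < cnt w) Z i w)%R @^-1` Y = \bigcup_n
    ([set w | cnt w = n] `&` (fun w => \sum_(i < n) Z i w)%R @^-1` Y).
  apply/seteqP; split=> w /=; first by move=> Yw; exists (cnt w).
  by move=> [n _ /= [<-]].
apply: bigcupT_measurable => n; apply: measurableI => //.
have ms : measurable_fun [set: S] (fun w => \sum_(i < n) Z i w)%R.
  by apply: measurable_sum => i; exact: measurable_funP.
by have := ms measurableT Y mY; rewrite setTI.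
Qed.

(** Writes a function of a random count as a series over its values, so that sum and expectation can
    be exchanged. *)
Lemma eseries_ind (c : nat) (u : nat -> \bar R) : (forall n, 0 <= u n) ->
  \sum_(n <oo) ind (c == n) * u n = u c.
Proof.
move=> u0; rewrite (nneseries_split 0%N c.+1)//; last first.
  by move=> n _; rewrite indM_ge0.
rewrite [X in _ + X]eseries0 ?adde0; last first.
  by move=> n cn _; rewrite ltn_eqF ?mul0e.
rewrite add0n big_nat_recr//= eqxx mul1e big_nat_cond big1 ?add0e// => n.
by rewrite andbT => nc; rewrite gtn_eqF ?mul0e.
Qed.

(** On the event that the count is [n], independence factors the probability and Markov's inequality
    bounds it by (B + e n) / a. Being affine in [n], these bounds sum to an expression in the mean
    count. *)
Lemma random_sum_deviation (cnt : S -> nat) (a B e b : R) :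
  (forall n, measurable [set w | cnt w = n]) ->
  (forall n D, sigma_sequence Z D ->
     P (D `&` [set w | cnt w = n]) = P D * P [set w | cnt w = n]) ->
  (0 < a)%R -> (0 <= B)%R -> (0 <= e)%R ->
  (forall n, \int[P]_w (`|\sum_(i < n) Z i w - n%:R * mean|%R)%:E <=
    (B + e * n%:R)%:E) ->
  \int[P]_w (cnt w)%:R%:E <= b%:E ->
  P [set w | (a <= `|\sum_(i < cnt w) Z i w - (cnt w)%:R * mean|)%R] <=
    ((B + e * b) / a)%:E.
Proof.
move=> mcnt indep a0 B0 e0 dev Ecnt.
pose D n := [set w | (a <= `|\sum_(i < n) Z i w - n%:R * mean|)%R].
have ms n : measurable_fun [set: S] (fun w => \sum_(i < n) Z i w)%R.
  by apply: measurable_sum => i; exact: measurable_funP.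
have sD n : sigma_sequence Z (D n).
  pose Y := [set x : R | (a <= `|x - n%:R * mean|)%R].
  have mY : measurable Y.
    apply: measurable_pred; apply: measurable_fun_ler => //.
    by apply: measurableT_comp => //; exact: measurable_funB.
  exact: (sigma_sequence_partial_sum n mY).
have mdist n : measurable_fun [set: S] (fun w => (`|\sum_(i < n) Z i w - n%:R * mean|%R)%:E).
  by apply/measurable_EFinP; apply: measurableT_comp => //; exact: measurable_funB.
have mD n : measurable (D n).
  have -> : D n = [set w | a%:E <= (`|\sum_(i < n) Z i w - n%:R * mean|%R)%:E].
    by apply/seteqP; split => w /=; rewrite lee_fin.
  by rewrite -[X in measurable X]setTI; exact: measurable_lee.
have PD n : P (D n) <= ((B + e * n%:R) / a)%:E.
  have -> : D n = [set w | a%:E <= (`|\sum_(i < n) Z i w - n%:R * mean|%R)%:E].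
    by apply/seteqP; split => w /=; rewrite lee_fin.
  apply: le_trans (markov_le (mdist n) _ a0 (dev n)) _ => //.
  by rewrite -EFinM lee_fin mulrC.
have -> : [set w | (a <= `|\sum_(i < cnt w) Z i w - (cnt w)%:R * mean|)%R] =
    \bigcup_n (D n `&` [set w | cnt w = n]).
  apply/seteqP; split=> w /=; first by move=> Dw; exists (cnt w).
  by move=> [n _ [Dw /= cn]]; rewrite cn.
have mDc n : measurable (D n `&` [set w | cnt w = n]) by exact: measurableI.
have mind n : measurable_fun [set: S] (fun w => ind (cnt w == n) : \bar R).
  apply: measurable_ind; apply: (@measurable_fun_bool _ _ _ _ true); rewrite setTI.
  have -> : (fun w => cnt w == n) @^-1` [set true] = [set w | cnt w = n].
    by apply/seteqP; split => w /= /eqP.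
  exact: mcnt.
have bn0 n : 0 <= ((B + e * n%:R) / a)%:E.
  by rewrite lee_fin divr_ge0 ?addr_ge0 ?mulr_ge0// ltW.
rewrite measure_semi_bigcup//; last 2 first.
- move=> i j _ _ [w [[_ /= wi] [_ /= wj]]]; by rewrite -wi -wj.
- exact: bigcupT_measurable.
apply: (@le_trans _ _ (\sum_(n <oo)
    \int[P]_w (ind (cnt w == n) * ((B + e * n%:R) / a)%:E))).
  apply: lee_nneseries => // n _.
  apply: (@le_trans _ _ (P (D n) * P [set w | cnt w = n])).
    by rewrite le_eqVlt; apply/orP; left; apply/eqP; exact: indep.
  rewrite ge0_integralZr//; last by move=> w _; exact: ind_ge0.
  rewrite integral_ind_measure; last first.
    apply: (@measurable_fun_bool _ _ _ _ true); rewrite setTI.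
    have -> : (fun w => cnt w == n) @^-1` [set true] = [set w | cnt w = n].
      by apply/seteqP; split => w /= /eqP.
    exact: mcnt.
  have -> : [set w | cnt w == n] = [set w | cnt w = n].
    by apply/seteqP; split => w /= /eqP.
  by rewrite muleC lee_wpmul2l.
rewrite -integral_nneseries//; last 2 first.
- by move=> n; exact: emeasurable_funM.
- by move=> n w _; rewrite indM_ge0.
have mcr : measurable_fun [set: S] (fun w => (cnt w)%:R%:E : \bar R).
  have -> : (fun w => (cnt w)%:R%:E : \bar R) =
      (fun w => \sum_(n <oo | n \in predT) ind (cnt w == n) * n%:R%:E).
    apply/funext => w.
    have n0 n : 0 <= (n%:R : R)%:E by rewrite lee_fin.
    by rewrite -[LHS](eseries_ind (cnt w) n0); apply: eq_eseriesl.
  apply: ge0_emeasurable_sum => [n w _ _|n _]; first by rewrite indM_ge0.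
  exact: emeasurable_funM.
have -> : \int[P]_w (\sum_(n <oo) ind (cnt w == n) * ((B + e * n%:R) / a)%:E) =
    \int[P]_w ((B / a)%:E + (e / a)%:E * (cnt w)%:R%:E).
  apply: eq_integral => w _.
  rewrite (eseries_ind (cnt w) (u := fun n => ((B + e * n%:R) / a)%:E))//.
  by rewrite -EFinM -EFinD; congr EFin; ring.
have ea0 : (0 <= e / a)%R by rewrite divr_ge0// ltW.
rewrite ge0_integralD//; last 3 first.
- by move=> w _; rewrite lee_fin divr_ge0// ltW.
- by move=> w _; rewrite mule_ge0 ?lee_fin.
- exact: emeasurable_funM.
rewrite integral_cst_probability ge0_integralZl ?lee_fin//.
have -> : ((B + e * b) / a)%:E = (B / a)%:E + (e / a)%:E * b%:E.
  by rewrite -EFinM -EFinD; congr EFin; ring.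
by rewrite leeD2l// lee_wpmul2l ?lee_fin.
Qed.

End random_sum.

(** * Assembly of the limit *)

Section conclusion.
Context (R : realType) dO (Omega : measurableType dO) dX (X : measurableType dX).
Variables (N : marked_point_process R Omega X) (x0 : X).

(** The measurability of the count is replayed on [Omega] with the sigma-algebra generated by the
    process, as independence from the summands is formulated there. *)
Lemma sigma_process_event_number t (A : set X) n : measurable A ->
  sigma_process N [set w | event_number N t A w = n].
Proof.
move=> mA.
pose G := \bigcup_n (preimage_set_system setT (event_time N n) measurable `|`
                 preimage_set_system setT (event_mark N n) measurable).
have mT i : measurable_fun [set: g_sigma_algebraType G]
    (event_time N i : g_sigma_algebraType G -> \bar R).
  by move=> _ Y mY; apply: sub_sigma_algebra; exists i => //; left; exists Y.
have mX i : measurable_fun [set: g_sigma_algebraType G]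
    (event_mark N i : g_sigma_algebraType G -> extended_mark X).
  by move=> _ Y mY; apply: sub_sigma_algebra; exists i => //; right; exists Y.
have mark_G i : measurable_fun [set: g_sigma_algebraType G]
    (mark N x0 i : g_sigma_algebraType G -> X).
  exact: (measurableT_comp (measurable_inner_mark x0) (mX i)).
have mcount : measurable_fun [set: g_sigma_algebraType G]
    (event_count N t A : g_sigma_algebraType G -> \bar R).
  have -> : (event_count N t A : g_sigma_algebraType G -> \bar R) = (fun w =>
      \sum_(n <oo) ind (event_time N n w <= t%:E) * ind (mark N x0 n w \in A))%E.
    by apply/funext => w; exact: event_countE.
  exact: measurable_count.
have mnum : measurable_fun [set: g_sigma_algebraType G]
    (fun w => (event_number N t A w)%:R : R).
  apply: (measurableT_comp (f := fun x : R => (Num.truncn x)%:R : R)).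
    apply: nondecreasing_measurable => // x y xy.
    by rewrite ler_nat; exact: le_truncn.
  exact: (measurableT_comp (fine_measurable measurableT) mcount).
have := mnum measurableT [set n%:R] (measurable_set1 _); rewrite setTI.
suff -> : (fun w => (event_number N t A w)%:R) @^-1` [set (n%:R : R)] =
    [set w | event_number N t A w = n] by [].
by apply/seteqP; split=> w /= => [/eqP|->//]; rewrite eqr_nat => /eqP.
Qed.

Lemma event_number0 (A : set X) w : event_number N 0 A w = 0%N.
Proof.
rewrite /event_number (event_countE N x0) eseries0 ?truncn0// => n _ _.
by rewrite leNgt event_time_gt0 mul0e.
Qed.

End conclusion.

(** Supplies the default mark [x0]: a probability measure does not live on an empty space. *)
Lemma probability_inhabited (R : realType) d (X : measurableType d)
  (Q : probability X R) : exists x : X, True.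
Proof.
have [[x _]|/set0P/negP/negPn/eqP E] := pselect ([set: X] !=set0); first by exists x.
have : (Q [set: X] = 1)%E by exact: probability_setT.
by rewrite E measure0 => /eqP; rewrite eq_sym onee_eq0.
Qed.

Lemma cvge0_of_le (R : realType) (p : R -> \bar R) :
  (forall T, 0 <= p T)%E ->
  (forall e : R, 0 < e -> exists T0 : R, forall T, T0 < T -> (p T <= e%:E)%E) ->
  p T @[T --> +oo] --> 0%E.
Proof.
move=> p0 H; apply/fine_cvgP; split.
  have [T0 HT] := H 1 ltr01; exists T0; split; first by rewrite num_real.
  move=> T /HT pT; rewrite ge0_fin_numE//.
  exact: le_lt_trans pT (ltry _).
apply/cvgr0Pnorm_le => e e0.
have [T0 HT] := H e e0; exists T0; split; first by rewrite num_real.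
move=> T /HT pT /=; rewrite ger0_norm ?fine_ge0// -lee_fin fineK//.
by rewrite ge0_fin_numE// (le_lt_trans pT)// ltry.
Qed.

(** Each of the two summands contributes at most e / 4. *)
Lemma deviation_ratio_le (R : realFieldType) (B D x t e : R) :
  0 < x -> 0 < t -> 0 < e -> (4 * B) / (x * e) <= t -> D <= x * e * t / 4 ->
  (B + D) / (x * t) <= e / 2.
Proof.
move=> x0 t0 e0; rewrite !ler_pdivrMr ?mulr_gt0// => Bt Dt.
have -> : e / 2 * (x * t) = t * (x * e) / 4 + x * e * t / 4 by field.
by apply: lerD => //; rewrite ler_pdivlMr// mulrC.
Qed.

Theorem theorem4p3 (R : realType)
    (dO : measure_display) (Omega : measurableType dO) (P : probability Omega R)
    (dX : measure_display) (X : measurableType dX) (hX : borel_space R X)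
    (N : marked_point_process R Omega X)
    (m : {nonneg R}) (f : R * X -> {nonneg R}) (Q : probability X R)
    (f_meas : measurable_fun ((`[0, +oo[ : set R) `*` [set: X]) (fun p => (f p)%:num))
    (f_bounded : exists M : R, forall t x, 0 <= t -> (f (t, x))%:num <= M)
    (f_L2 : (\int[Q]_x (L1norm (fun t => (f (t, x))%:num) ^+ 2) < +oo)%E)
    (N_hawkes : marked_hawkes N m f Q P)
    (r : R -> R) (r_resolvent : is_resolvent (mean_kernel f Q) r)
    (F_lt1 : (L1norm (mean_kernel f Q) < 1)%E)
    (F_moment : (\int[lebesgue_measure]_(t in `[0%R, +oo[)
                   (t * mean_kernel f Q t)%:E < +oo)%E)
    (A : set X) (A_meas : measurable A)
    (Z : nat -> {RV P >-> R})
    (Z_independent : mutually_independent Z)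
    (Z_identical : identically_distributed Z)
    (Z_integrable : forall n, P.-integrable [set: Omega] (EFin \o Z n))
    (Z_indep_N : independent_systems P (sigma_sequence Z) (sigma_process N))
    (v : R) (v_ge0 : 0 <= v) :
  cvg_in_probability P
    (fun T w => T^-1 * compound_process N Z A (T * v) w)
    (upsilon m%:num Q A (fun t => - r t) Z v).
Proof.
have [x0 _] := probability_inhabited Q.
have normE := L1norm_mean_kernel Q f_meas f_bounded.
have norm0 : (0 <= \int[lebesgue_measure]_t mean_causal f Q t)%E.
  by apply: integral_ge0 => t _; exact: mean_causal_ge0.
rewrite normE in F_lt1.
have normfin : (\int[lebesgue_measure]_t mean_causal f Q t)%E \is a fin_num.
  by rewrite ge0_fin_numE// (lt_le_trans F_lt1)// leey.
pose q := fine (\int[lebesgue_measure]_t mean_causal f Q t)%E.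
have qE : (\int[lebesgue_measure]_t mean_causal f Q t = q%:E)%E by rewrite fineK.
have q1 : q < 1 by rewrite -lte_fin -qE.
have moment : (\int[lebesgue_measure]_s (s%:E * mean_causal f Q s) < +oo)%E.
  by rewrite -(integral_mean_kernel Q f_meas f_bounded (h := id)).
have [M fM] := f_bounded; pose M' := Num.max M 0.
have M'0 : 0 <= M' by rewrite le_max lexx orbT.
have F_le t : 0 < t -> mean_kernel f Q t <= M'.
  move=> t0; rewrite -lee_fin -(mean_causalE Q f_meas f_bounded)//.
  rewrite -(integral_cst_probability Q M'); apply: ge0_le_integral => //.
  - by move=> x _; exact: causal_ge0.
  - exact: (measurableT_comp (measurable_causal f_meas) (pair1_measurable t)).
  - move=> x _; apply: causal_le => // s y s0.
    by rewrite le_max fM.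
have rnorm : L1norm (fun t => - r t) = (q / (1 - q))%:E.
  apply: (@L1norm_resolvent _ (mean_kernel f Q) r (mean_causal f Q) M' q) => //.
  - exact: measurable_mean_causal.
  - by move=> t t0; exact: mean_causalE.
  - by move=> t t0; exact: mean_causal_le0.
  - by move=> t; exact: mean_kernel_ge0.
set mean := fine (\int[P]_w (Z 0%N w)%:E)%E.
pose c := rate m q * fine (Q A).
(* Since ||R||_1 + 1 = q / (1 - q) + 1 = 1 / (1 - q), the limit is [v] times the rate of events with
   marks in [A] times the mean of a summand. *)
have upsE : upsilon m%:num Q A (fun t => - r t) Z v = v * (c * mean).
  rewrite /upsilon rnorm /= expectation_def -/mean /c /rate.
  by field; rewrite gt_eqF// subr_gt0.
rewrite upsE => eps eps0.
have mcnt t n : measurable [set w | event_number N t A w = n].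
  have -> : [set w | event_number N t A w = n] =
      (fun w => (event_number N t A w)%:R : R) @^-1` [set n%:R].
    by apply/seteqP; split=> w /= => [->//|/eqP]; rewrite eqr_nat => /eqP.
  by rewrite -[X in _ X]setTI; exact: (measurable_event_number N x0 t A_meas).
have mcomp t : measurable_fun [set: Omega] (compound_process N Z A t).
  exact: (measurable_random_sum Z (mcnt t)).
apply: cvge0_of_le => // e e0.
(* For v = 0 no event has occurred and both sides vanish; the constants below divide by [v]. *)
move: v_ge0; rewrite le_eqVlt => /orP[/eqP v0|v0].
  exists 0 => T T0; rewrite -v0 (_ : [set w | _] = set0) ?measure0 ?lee_fin ?ltW//.
  apply/seteqP; split=> w //=; rewrite /compound_process mulr0.
  rewrite -/(event_number N 0 A w) (event_number0 N x0) big_ord0 mulr0 mul0r subr0.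
  by rewrite normr0 ltNge (ltW eps0).
have rate0 := rate_ge0 m q1.
(* With t = T v, the tolerance T eps is halved between the random sum, [e1 * t], and the count,
   whose error is multiplied by the mean; |mean| + 1 avoids a division by zero. *)
pose e1 := eps / (2 * v).
pose e2 := eps / (2 * v * (`|mean| + 1)).
have mean1 : 0 < `|mean| + 1 by rewrite ltr_wpDl.
have e10 : 0 < e1 by rewrite divr_gt0// mulr_gt0.
have e20 : 0 < e2 by rewrite divr_gt0// !mulr_gt0.
(* The slopes [d1] and [d2] make the part of each deviation bound that is proportional to [t] at
   most e / 4; for [d1] this uses that the mean count is at most rate t. *)
pose d1 := e1 * e / (4 * (rate m q + 1)).
have r10 : 0 < rate m q + 1 by rewrite ltr_wpDl.
have d10 : 0 < d1 by apply: divr_gt0; apply: mulr_gt0.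
pose d2 := e2 * e / 4.
have d20 : 0 < d2 by apply: divr_gt0 => //; apply: mulr_gt0.
have [B1 [B10 HB1]] := iid_sum_deviation Z_independent Z_identical Z_integrable d10.
have [B2 [B20 HB2]] := event_number_concentration x0 f_meas f_bounded N_hawkes q1 qE
  moment A_meas d20.
(* Beyond this threshold t = T v exceeds both quotients, so the constants [B1] and [B2] also
   contribute at most e / 4 each. *)
exists (((4 * B1) / (e1 * e) + (4 * B2) / (e2 * e)) / v) => T.
rewrite ltr_pdivrMr//; set t := T * v => tbig.
have b10 : 0 <= (4 * B1) / (e1 * e) by apply: divr_ge0; [apply: mulr_ge0|apply/ltW/mulr_gt0].
have b20 : 0 <= (4 * B2) / (e2 * e) by apply: divr_ge0; [apply: mulr_ge0|apply/ltW/mulr_gt0].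
have t0 : 0 < t by rewrite (le_lt_trans _ tbig)// addr_ge0.
have T0 : 0 < T by rewrite -(pmulr_lgt0 _ v0).
pose S1 := [set w | e1 * t <= `|compound_process N Z A t w -
  (event_number N t A w)%:R * mean|].
pose S2 := [set w | e2 * t <= `|(event_number N t A w)%:R - rate m q * fine (Q A) * t|].
have mnum := measurable_event_number N x0 t A_meas.
have mS1 : measurable S1.
  apply: measurable_pred; apply: measurable_fun_ler => //.
  apply: measurableT_comp => //; apply: measurable_funB; first exact: mcomp.
  exact: measurable_funM.
have mS2 : measurable S2.
  apply: measurable_pred; apply: measurable_fun_ler => //.
  by apply: measurableT_comp => //; exact: measurable_funB.
have PS1 : (P S1 <= ((B1 + d1 * (rate m q * t)) / (e1 * t))%:E)%E.
  apply: (random_sum_deviation (mcnt t) _ _ B10 (ltW d10) HB1).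
  - move=> n D sD; apply: Z_indep_N => //.
    exact: (sigma_process_event_number x0 t n A_meas).
  - exact: mulr_gt0.
  - exact: (expectation_event_number_le x0 f_meas f_bounded N_hawkes q1 qE (ltW t0) A_meas).
have PS2 : (P S2 <= ((B2 + d2 * t) / (e2 * t))%:E)%E by exact: HB2.
apply: (@le_trans _ _ (P (S1 `|` S2))).
  apply: le_measure; rewrite ?inE//.
  - apply: measurable_pred; apply: measurable_fun_ltr => //.
    apply: measurableT_comp => //; apply: measurable_funB => //.
    by apply: measurable_funM => //; exact: mcomp.
  - exact: measurableU.
  move=> w /= big; have [|s1] := leP (e1 * t) `|compound_process N Z A t w -
    (event_number N t A w)%:R * mean|; [by left|right].
  rewrite /S2 /= leNgt; apply/negP => s2.
  move: big; apply/negP; rewrite -leNgt.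
  (* The random sum is compared with the count times the mean, and the count with its linear
     limit. *)
  have -> : T^-1 * compound_process N Z A t w - v * (c * mean) =
      T^-1 * ((compound_process N Z A t w - (event_number N t A w)%:R * mean) +
        mean * ((event_number N t A w)%:R - rate m q * fine (Q A) * t)).
    by rewrite /t /c; field; rewrite gt_eqF.
  rewrite normrM gtr0_norm ?invr_gt0// ler_pdivrMl//.
  apply: le_trans (ler_normD _ _) _; rewrite normrM.
  have -> : T * eps = e1 * t + (`|mean| + 1) * (e2 * t).
    by rewrite /e1 /e2 /t; field; rewrite !gt_eqF.
  apply: lerD; first exact: ltW.
  by apply: ler_pM => //; [rewrite lerDl|exact: ltW].
apply: (le_trans (measureU2 _ mS1 mS2)).
apply: (le_trans (leeD PS1 PS2)); rewrite -EFinD lee_fin.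
have le1 : (B1 + d1 * (rate m q * t)) / (e1 * t) <= e / 2.
  apply: deviation_ratio_le => //.
    by rewrite ltW// (le_lt_trans _ tbig)// lerDl.
  have -> : d1 * (rate m q * t) = e1 * e * t / 4 * (rate m q / (rate m q + 1)).
    by rewrite /d1; field; rewrite gt_eqF.
  rewrite -[leRHS]mulr1; apply: ler_wpM2l.
    by rewrite ltW// divr_gt0// mulr_gt0// mulr_gt0.
  by rewrite ler_pdivrMr// mul1r lerDl.
have le2 : (B2 + d2 * t) / (e2 * t) <= e / 2.
  apply: deviation_ratio_le => //.
    by rewrite ltW// (le_lt_trans _ tbig)// lerDr.
  by rewrite le_eqVlt; apply/orP; left; apply/eqP; rewrite /d2; field.
by rewrite [leRHS]splitr lerD.
Qed.
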